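(* Let $k$ be a nonnegative integer, let $M$ be a $3$-connected matroid, let $\mathcal{T}$ be a tangle of $M$, let $N$ be a minor of $M$ with no loops and no coloops, and let $t := \rank_{\mathcal{T}}(E(N))$. If the order of $\mathcal{T}$ is at least $20k + t - 13$, then there is a set $X \subseteq E(M)$ with $|X|=k$ such that $\rank_{\mathcal{T}}(E(N)\cup X) = t + k$, and such that one of $M\setminus X$ and $M/X$ is $3$-connected with $N$ as a minor.
   Context: The connectivity function of a matroid $M$ is $\lambda_M(X) = \rank_M(X) + \rank_M(E(M)\setminus X) - \rank(M)$ for $X\subseteq E(M)$. A tangle of order $\theta$ of $M$ is a collection $\mathcal{T}$ of subsets of $E(M)$ such that: (i) $\lambda_M(X)<\theta$ for all $X\in\mathcal{T}$; (ii) for every $X\subseteq E(M)$ with $\lambda_M(X)<\theta$, either $X\in\mathcal{T}$ or $E(M)\setminus X\in\mathcal{T}$; (iii) if $X,Y,Z\in\mathcal{T}$ then $X\cup Y\cup Z\neq E(M)$; (iv) $E(M)\setminus\{e\}\notin\mathcal{T}$ for every $e\in E(M)$. The tangle matroid $M(\mathcal{T})$ is the matroid on $E(M)$ whose rank function $\rank_{\mathcal{T}}$ is given by $\rank_{\mathcal{T}}(X) = \min\{\lambda_M(Y): X\subseteq Y\in\mathcal{T}\}$ if some member of $\mathcal{T}$ contains $X$, and $\rank_{\mathcal{T}}(X)=\theta$ otherwise (this is a matroid rank function). ''$M'$ has $N$ as a minor'' means $N$ itself (with labelled ground set) equals $M'/C\setminus D$ for some disjoint $C,D\subseteq E(M')$.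 *)

(* Defs.v *)
From mathcomp Require Import all_boot.
Set Implicit Arguments. Unset Strict Implicit. Unset Printing Implicit Defensive.

Record matroid (T : finType) := Matroid { ground : {set T}; rk : {set T} -> nat }.

Section Matroids.
Variable T : finType.
Implicit Types (M N : matroid T) (X Y Z C D : {set T}).

Definition is_matroid M : Prop :=
  [/\ forall X, X \subset ground M -> rk M X <= #|X|,
      forall X Y, X \subset Y -> Y \subset ground M -> rk M X <= rk M Y &
      forall X Y, X \subset ground M -> Y \subset ground M ->
        rk M (X :|: Y) + rk M (X :&: Y) <= rk M X + rk M Y].

Definition delete M D : matroid T := Matroid (ground M :\: D) (rk M).
Definition contract M C : matroid T :=
  Matroid (ground M :\: C) (fun X => rk M (X :|: C) - rk M C).

Definition matroid_eq M N : Prop :=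
  ground M = ground N /\ forall X, X \subset ground M -> rk M X = rk N X.

Definition has_minor M N : Prop :=
  exists C D, [/\ C \subset ground M, D \subset ground M, [disjoint C & D] &
                  matroid_eq N (delete (contract M C) D)].

Definition lambda M X : nat :=
  rk M X + rk M (ground M :\: X) - rk M (ground M).

Definition separation M (k : nat) X : Prop :=
  [/\ X \subset ground M, k <= #|X|, k <= #|ground M :\: X| & lambda M X < k].

Definition three_connected M : Prop :=
  forall k, 1 <= k < 3 -> forall X, ~ separation M k X.

Definition is_loop M (e : T) : Prop := e \in ground M /\ rk M [set e] = 0.
Definition is_coloop M (e : T) : Prop :=
  e \in ground M /\ rk M (ground M :\ e) < rk M (ground M).

Definition no_loops M : Prop := forall e, ~ is_loop M e.
Definition no_coloops M : Prop := forall e, ~ is_coloop M e.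

Definition is_tangle M (theta : nat) (Tg : {set {set T}}) : Prop :=
  [/\ forall X, X \in Tg -> X \subset ground M /\ lambda M X < theta,
      forall X, X \subset ground M -> lambda M X < theta ->
        X \in Tg \/ (ground M :\: X) \in Tg,
      forall X Y Z, X \in Tg -> Y \in Tg -> Z \in Tg ->
        X :|: Y :|: Z <> ground M &
      forall e, e \in ground M -> (ground M :\ e) \notin Tg].

Definition tangle_rank M (theta : nat) (Tg : {set {set T}}) X : nat :=
  if [exists Y in Tg, X \subset Y]
  then \big[minn/theta]_(Y in Tg | X \subset Y) lambda M Y
  else theta.

End Matroids.

(* Main.v *)
Require Import Defs.
From mathcomp Require Import all_boot.
From mathcomp Require Import zify.
From Stdlib Require Import Classical ClassicalEpsilon.

(** Let [F] be the ground set of [N].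

    One element.  Let [P] contain [F] and be closed in the tangle matroid.  If
    deleting [x] destroys 3-connectivity, then [x] lies in the coclosure of a
    set [A] such that [A] and [x |: A] are 3-separating and small for the
    tangle; dually for contraction.  A small 3-separating set not contained in
    [P] meets [P] in at most one element, so [N] leaves much freedom inside it.
    Uncrossing a minimal such [A] brings it down to two or three elements;
    Tutte's triangle lemma then produces a fan, and an end of a maximal fan that
    avoids [P] can be removed keeping both 3-connectivity and [N].

    Many elements.  Iterating [10k - 6] times gives disjoint sets [D] (deleted)
    and [G] (contracted) with [D :|: G] independent over [F] in the tangle
    matroid and [M \ D / G] 3-connected with [N] as a minor; each step costs two
    units of tangle order.  For [K] inside [D], the matroid [M \ K] can only fail
    to be 3-connected because of a series pair [{z, w}] with [z] in [G], and for
    each such [z] the elements of [D] creating the pair form a set that must not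
    be contained in [K].  Dually for [G].  By orthogonality of circuits and
    cocircuits the two conflict relations agree, and every conflict of an element
    involves an element removed later.  Following a later conflict partner gives
    a forest, in which leaves, or vertices without leaf children taken two levels
    out of four, form conflict-free sets; one of these has [k] elements. *)

Set Implicit Arguments. Unset Strict Implicit. Unset Printing Implicit Defensive.

(** * Single-element removal in a 3-connected matroid *)

(** The one-element argument is carried out for an abstract pair of rank functions with predicates
    [del] and [con]; exchanging them gives every dual statement without a second proof. The minor is
    labelled, so an element counts as deletable or contractible when some contraction set realizing
    the minor avoids or contains it, and local exchanges between such sets replace any knowledge of
    the minor itself.

    Removing [n] elements costs order twice: the tangle rank of what must be avoided grows to
    [t + n], and connectivity in the minor can be [n] lower than in [M]. Removal number [n + 1]
    therefore needs [t + 2n < theta], and [10k - 6] removals need [theta >= t + 2(10k - 6) - 1 = t +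
    20k - 13].

    The obstacle that remains is that deletions and contractions come mixed, while only one kind may
    survive. Putting elements back keeps [N] a minor at no cost, but it may create series or
    parallel pairs, and the second half of the proof controls exactly these. *)

Ltac rewrite_facts :=
  repeat match goal with
  | H : is_true (~~ ?b) |- context [?b] => rewrite (negbTE H)
  | H : is_true (~~ (?x == ?y)) |- context [?y == ?x] =>
      rewrite (eq_sym y x) (negbTE H)
  | H : is_true (?x \in ?A) |- context [?x \in ?A] => rewrite H
  end.
Ltac case_atoms :=
  rewrite_facts; rewrite ?eqxx /=;
  repeat match goal with
  | |- context [?x \in ?A] => case: (x \in A) => /=
  | |- context [?x == ?y] => case: (x == y) => /=
  end.
(** Each inclusion in the context is specialised to the point [u], then all membership and equality
    atoms are enumerated. The cost is exponential in the inclusions present, hence the many [clear]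
    calls before [set_solve]. *)
Ltac set_point u :=
  repeat match goal with
  | H : is_true (_ \subset _) |- _ => move: (introT implyP (subsetP H u)); clear H
  end;
  rewrite ?inE; rewrite_facts;
  repeat match goal with
  | |- context [u == ?x] => case: (eqVneq u x) => [?|?]; [subst u|]
  end;
  case_atoms; try by [].
Ltac clear_subsets :=
  repeat match goal with H : is_true (_ \subset _) |- _ => clear H end.
Ltac set_point_any u :=
  first [ solve [clear_subsets; set_point u] | set_point u ].
Ltac set_solve :=
  match goal with
  | |- @eq _ _ _ => let u := fresh "u" in apply/setP=> u; set_point_any u
  | |- is_true (_ \subset _) =>
      let u := fresh "u" in apply/subsetP=> u; set_point_any u
  | |- is_true (?u \in _) => set_point_any u
  | |- is_true (~~ (?u \in _)) => set_point_any u
  end.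

Ltac nlia :=
  intros;
  repeat match goal with
  | H : is_true (~~ _) |- _ => clear H
  | H : is_true (_ \in _) |- _ => clear H
  | H : is_true (_ \subset _) |- _ => clear H
  | H : @eq (set_of _) _ _ |- _ => clear H
  | H : @eq bool _ _ |- _ => clear H
  end; lia.

Section SetFacts.
Variable T : finType.
Implicit Types (x y z : T) (A B : {set T}).

Lemma card_gt_set1 A x : 1 < #|A| -> exists2 z, z \in A & z != x.
Proof.
move=> h; have : 0 < #|A :\ x| by have := cardsD1 x A; lia.
by case/card_gt0P=> z; rewrite !inE => /andP[zx zA]; exists z.
Qed.

Lemma cards3 x y z : x != y -> x != z -> y != z -> #|[set x; y; z]| = 3.
Proof.
move=> xy xz yz; rewrite setUC cardsU1 cards2 xy !inE.
by rewrite (eq_sym z x) (eq_sym z y) (negbTE xz) (negbTE yz).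
Qed.

Lemma card3P A : #|A| = 3 ->
  exists x y z, [/\ x != y, x != z, y != z & A = [set x; y; z]].
Proof.
move=> h; have /card_gt0P[x xA] : 0 < #|A| by lia.
have : #|A :\ x| == 2 by apply/eqP; have := cardsD1 x A; rewrite xA; lia.
case/cards2P=> y [z [yz e]].
have : y \in A :\ x by rewrite e !inE eqxx.
have : z \in A :\ x by rewrite e !inE eqxx orbT.
rewrite !inE => /andP[zx zA] /andP[yx yA].
exists x, y, z; split=> //; try by rewrite eq_sym.
by rewrite -(setD1K xA) e setUA.
Qed.

Lemma card2_with A y : #|A| = 2 -> y \in A ->
  exists2 w, w != y & A = [set y; w].
Proof.
move=> cA yA; have /cards1P[w e] : #|A :\ y| == 1.
  by apply/eqP; have := cardsD1 y A; rewrite yA; lia.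
have : w \in A :\ y by rewrite e set11.
by rewrite !inE => /andP[wy _]; exists w => //; rewrite -(setD1K yA) e.
Qed.

Lemma card_le1_eq A x y : #|A| <= 1 -> x \in A -> y \in A -> x = y.
Proof. by move=> /card_le1_eqP h xA yA; apply: h. Qed.

End SetFacts.

(** * Axioms for rank, minor and tangle, and their first consequences *)

Section SingleStep.
Variable T : finType.
Implicit Types (A B C D S V X Y Z : {set T}) (e f p q u v w x y z : T).

Variables (lam : {set T} -> nat) (small : {set T} -> Prop) (P F : {set T}).

(* [r] is a rank function, [s] its dual and [lam] the connectivity function;
   exchanging [r] and [s] is matroid duality. *)
Record rank_axioms (r s : {set T} -> nat) : Prop := {
  rk_card : forall X, r X <= #|X|;
  rk_mono : forall X Y, X \subset Y -> r X <= r Y;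
  rk_sub : forall X Y, r (X :|: Y) + r (X :&: Y) <= r X + r Y;
  rk_lam : forall X, r X + s X = #|X| + lam X;
  rk_dual : forall X, s X + r setT = #|X| + r (~: X)
}.

Section RankFacts.
Variables (r s : {set T} -> nat).
Hypotheses (R : rank_axioms r s) (S' : rank_axioms s r).

Lemma rank_add x A : r A <= r (x |: A) <= r A + 1.
Proof.
have := rk_mono R (subsetUr [set x] A); have := rk_sub R [set x] A.
have := rk_card R [set x]; rewrite cards1; lia.
Qed.

Lemma rank_cl_mono x A B : A \subset B -> r (x |: A) = r A -> r (x |: B) = r B.
Proof.
move=> AB e; have := rk_sub R (x |: A) B; have := rank_add x B.
have -> : (x |: A) :|: B = x |: B by set_solve.
have : r A <= r ((x |: A) :&: B) by apply: (rk_mono R); set_solve.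
lia.
Qed.

(** Orthogonality: an element cospanned by a set disjoint from [x |: Z] cannot be spanned by [Z].
    Coclosure is monotone, so [V] may be enlarged to the whole complement and the claim dualised. *)
Lemma rank_add_co x Z V : x \notin Z -> V \subset ~: (x |: Z) ->
  s (x |: V) = s V -> r (x |: Z) = r Z + 1.
Proof.
move=> xZ VZ e.
have : s (x |: ~: (x |: Z)) = s (~: (x |: Z)).
  have := rk_sub S' (x |: V) (~: (x |: Z)).
  have -> : (x |: V) :|: ~: (x |: Z) = x |: ~: (x |: Z) by set_solve.
  have := rk_mono S' (subsetUr [set x] (~: (x |: Z))).
  have : s V <= s ((x |: V) :&: ~: (x |: Z)) by apply: (rk_mono S'); set_solve.
  lia.
have -> : x |: ~: (x |: Z) = ~: Z by set_solve.
have := rk_dual S' Z; have := rk_dual S' (x |: Z); have := cardsU1 x Z.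
rewrite xZ; lia.
Qed.

End RankFacts.

(* [del x] and [con x] stand for: the fixed minor on [F] is a minor of [M \ x],
   respectively of [M / x]. *)
Record minor_axioms (r s : {set T} -> nat) (del con : T -> Prop) : Prop := {
  minor_or : forall x, x \notin F -> del x \/ con x;
  minor_triad : forall e a b, e != a -> e != b -> a != b ->
    s [set e; a; b] <= 2 -> del e -> b \notin F -> con b;
  minor_quad : forall e x y z, e != x -> e != y -> e != z ->
    x != y -> x != z -> y != z -> r [set x; y; z] <= 2 ->
    (forall u, u \in [set x; y; z] ->
       s ([set e; x; y; z] :\ u) = s [set e; x; y; z]) ->
    del e -> x \notin F -> y \notin F \/ z \notin F -> del x;
  minor_indep : forall A, A \subset ~: F -> (forall x, x \in A -> ~ del x) ->
    r A = #|A|;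
  minor_span : forall a A, a \notin A -> A \subset ~: F -> s (a |: A) = s A ->
    exists2 x, x \in A & con x
}.

(* [small] sets are the members of order at most 3 of the tangle. *)
Record setup (r s : {set T} -> nat) (del con : T -> Prop) : Prop := {
  su_rk : rank_axioms r s;
  su_rk' : rank_axioms s r;
  su_mn : minor_axioms r s del con;
  su_mn' : minor_axioms s r con del;
  su_conn1 : forall A, 0 < #|A| -> 0 < #|~: A| -> 1 <= lam A;
  su_conn2 : forall A, 1 < #|A| -> 1 < #|~: A| -> 2 <= lam A;
  su_lam : forall A, small A -> lam A <= 2;
  su_or : forall A, lam A <= 2 -> small A \/ small (~: A);
  su_cover : forall A B C, small A -> small B -> small C -> A :|: B :|: C <> setT;
  su_pair : forall A, #|A| <= 2 -> small A;
  su_P : forall S x, small S -> x \in S -> x \notin P -> #|S :&: P| <= 1;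
  su_FP : F \subset P
}.

Lemma setup_flip r s del con : setup r s del con -> setup s r con del.
Proof. by case; split. Qed.

(* [tri s A x] witnesses that [M \ x] is not 3-connected, [tri r A x] that
   [M / x] is not. *)
Definition tri (t : {set T} -> nat) A x :=
  [/\ x \notin A, 1 < #|A|, small (x |: A), lam A <= 2 /\ lam (x |: A) <= 2 &
      t (x |: A) = t A].

Section Basic.
Variables (r s : {set T} -> nat) (del con : T -> Prop).
Hypothesis H : setup r s del con.
Let R := su_rk H.
Let S' := su_rk' H.

Lemma lamC A : lam (~: A) = lam A.
Proof.
have := rk_lam R A; have := rk_lam R (~: A); have := rk_dual R A.
have := rk_dual R (~: A); rewrite setCK; lia.
Qed.

Lemma lam_sub A B : lam (A :|: B) + lam (A :&: B) <= lam A + lam B.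
Proof.
have := rk_sub R A B; have := rk_sub S' A B; have := cardsUI A B.
have := rk_lam R A; have := rk_lam R B; have := rk_lam R (A :|: B).
have := rk_lam R (A :&: B); lia.
Qed.

Lemma lam_subD A B : lam (A :\: B) + lam (B :\: A) <= lam A + lam B.
Proof.
have := lam_sub A (~: B); rewrite lamC -setDE.
have -> : A :|: ~: B = ~: (B :\: A) by set_solve.
rewrite lamC; lia.
Qed.

Lemma small_sub A B : small B -> A \subset B -> lam A <= 2 -> small A.
Proof.
move=> sB AB lA; case: (su_or H lA) => // sA.
have [] := su_cover H sA sB sB; set_solve.
Qed.

Lemma small_un A B : small A -> small B -> lam (A :|: B) <= 2 -> small (A :|: B).
Proof.
move=> sA sB l; case: (su_or H l) => // sC.
have [] := su_cover H sA sB sC; set_solve.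
Qed.

(** A remainder of at most two elements would itself be small and complete a cover by three small
    sets. This provides the lower bound on complements that uncrossing needs. *)
Lemma card_co_small A B : small A -> small B -> 2 < #|~: (A :|: B)|.
Proof.
move=> sA sB; rewrite ltnNge; apply/negP => h.
have [] := su_cover H sA sB (su_pair H h); set_solve.
Qed.

Lemma card_co_small1 A : small A -> 2 < #|~: A|.
Proof. by move=> sA; have := card_co_small sA sA; rewrite setUid. Qed.

Lemma lam_ge2 A : small A -> 1 < #|A| -> 2 <= lam A.
Proof.
move=> sA cA; apply: (su_conn2 H cA); have := card_co_small1 sA; lia.
Qed.

Lemma lam_eq2 A : small A -> 1 < #|A| -> lam A = 2.
Proof. by move=> sA cA; have := lam_ge2 sA cA; have := su_lam H sA; lia. Qed.

Lemma lam_I A B : small A -> small B -> 1 < #|A :|: B| -> lam (A :&: B) <= 2.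
Proof.
move=> sA sB c; have := lam_sub A B; have := su_lam H sA; have := su_lam H sB.
have := su_conn2 H c; have := card_co_small sA sB; lia.
Qed.

Lemma lam_U A B : small A -> small B -> 1 < #|A :&: B| -> lam (A :|: B) <= 2.
Proof.
move=> sA sB c; have := lam_sub A B; have := su_lam H sA; have := su_lam H sB.
have := su_conn2 H c; have := card_co_small sA sB.
have : #|~: (A :|: B)| <= #|~: (A :&: B)| by apply: subset_leq_card; set_solve.
lia.
Qed.

Lemma small_U A B x y : small A -> small B -> x \in A :&: B -> y \in A :&: B ->
  x != y -> small (A :|: B).
Proof.
move=> sA sB xI yI xy; apply: small_un => //; apply: lam_U => //.
have : [set x; y] \subset A :&: B by rewrite subUset !sub1set xI yI.
by move/subset_leq_card; rewrite cards2 xy.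
Qed.

Lemma rk2 x y : x != y -> r [set x; y] = 2 /\ s [set x; y] = 2.
Proof.
move=> xy; have c : #|[set x; y]| = 2 by rewrite cards2 xy.
have := lam_eq2 (su_pair H (eq_leq c)); rewrite c => /(_ isT).
have := rk_lam R [set x; y]; have := rk_card R [set x; y].
have := rk_card S' [set x; y]; lia.
Qed.

Lemma rk1 x : r [set x] = 1 /\ s [set x] = 1.
Proof.
have c : #|[set x]| = 1 by rewrite cards1.
have : 1 <= lam [set x].
  apply: (su_conn1 H); first by rewrite c.
  have := card_co_small1 (su_pair H (leqW (eq_leq c))); lia.
have := rk_lam R [set x]; have := rk_card R [set x].
have := rk_card S' [set x]; rewrite c; lia.
Qed.

Lemma rk_add x A : r A <= r (x |: A) <= r A + 1.
Proof. exact: rank_add R _ _. Qed.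

Lemma cl_mono x A B : A \subset B -> r (x |: A) = r A -> r (x |: B) = r B.
Proof. exact: rank_cl_mono R _ _ _. Qed.

Lemma rk_add_co x Z V : x \notin Z -> V \subset ~: (x |: Z) ->
  s (x |: V) = s V -> r (x |: Z) = r Z + 1.
Proof. exact: rank_add_co S' _ _ _. Qed.

Lemma lam_rem x Z V : x \notin Z -> V \subset ~: (x |: Z) ->
  s (x |: V) = s V -> lam Z <= lam (x |: Z).
Proof.
move=> xZ VZ e; have := rk_add_co xZ VZ e.
have := rk_mono S' (subsetUr [set x] Z).
have := rk_lam R Z; have := rk_lam R (x |: Z); have := cardsU1 x Z.
rewrite xZ; lia.
Qed.

(** With both connectivities equal to 2, equality of [s] forces [r] to rise by one from [A] to
    [x |: A]; dually, the other side of the separation cospans [x] as well. *)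
Lemma tri_co A x : tri s A x -> s (x |: ~: (x |: A)) = s (~: (x |: A)).
Proof.
case=> xA cA sA [lA lxA] e.
have sm : small A by apply: small_sub sA (subsetUr _ _) lA.
have c1 : 1 < #|x |: A| by rewrite cardsU1 xA; lia.
have := lam_eq2 sm cA; have := lam_eq2 sA c1.
have := rk_lam R A; have := rk_lam R (x |: A); have := cardsU1 x A.
have := rk_dual R (x |: ~: (x |: A)); have := rk_dual R (~: (x |: A)).
rewrite setCK.
have -> : ~: (x |: ~: (x |: A)) = A by set_solve.
have := cardsU1 x (~: (x |: A)); rewrite xA !inE eqxx; lia.
Qed.

Lemma tri_r A x : tri s A x -> r (x |: A) = r A + 1.
Proof.
move=> t; have e := tri_co t; case: t => xA *.
by apply: rk_add_co xA (subxx _) e.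
Qed.

(** Both [A] and the remaining side cospan [x], and one of them avoids [Z]. By orthogonality [x]
    raises the rank of [Z] and the connectivity of [Z] is at most that of [x |: Z]; both being 2,
    [s] cannot change. *)
Lemma tri_transfer A x Z : tri s A x -> x \notin Z -> 1 < #|Z| ->
  small (x |: Z) -> (Z \subset A \/ Z \subset ~: A) -> tri s Z x.
Proof.
move=> tA xZ cZ sZ h; have eB := tri_co tA; case: tA => xA cA sA [lA lxA] e.
have lxZ := su_lam H sZ.
have rZ : r (x |: Z) = r Z + 1 /\ lam Z <= lam (x |: Z).
  case: h => h.
    have h' : ~: (x |: A) \subset ~: (x |: Z) by set_solve.
    by split; [apply: rk_add_co h' eB | apply: lam_rem h' eB].
  have h' : A \subset ~: (x |: Z) by set_solve.
  by split; [apply: rk_add_co h' e | apply: lam_rem h' e].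
have lZ : lam Z <= 2 by lia.
have sm : small Z by apply: small_sub sZ (subsetUr _ _) lZ.
have c1 : 1 < #|x |: Z| by rewrite cardsU1 xZ; lia.
split=> //; have := lam_eq2 sm cZ; have := lam_eq2 sZ c1.
have := rk_lam R Z; have := rk_lam R (x |: Z); have := cardsU1 x Z.
rewrite xZ; lia.
Qed.

Lemma small3 x y z : x != y -> x != z -> y != z ->
  (r [set x; y; z] <= 2 \/ s [set x; y; z] <= 2) -> small [set x; y; z].
Proof.
move=> xy xz yz h; apply: small_un.
- by apply: (su_pair H); rewrite cards2 xy.
- by apply: (su_pair H); rewrite cards1.
have := rk_lam R [set x; y; z]; have := rk_card R [set x; y; z].
have := rk_card S' [set x; y; z]; rewrite cards3 //; lia.
Qed.

Lemma tri3 x y z : x != y -> x != z -> y != z ->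
  s [set x; y; z] <= 2 -> tri s [set y; z] x.
Proof.
move=> xy xz yz h; have sm := small3 xy xz yz (or_intror h).
have e : x |: [set y; z] = [set x; y; z] by set_solve.
have c : #|[set y; z]| = 2 by rewrite cards2 yz.
split; rewrite ?e ?c //.
- by rewrite !inE negb_or xy.
- by split; apply: (su_lam H) => //; apply: (su_pair H); rewrite c.
- have := proj2 (rk2 yz); have := rk_mono S' (subsetUr [set x] [set y; z]).
  rewrite e; lia.
Qed.

Lemma not_triangle_triad x y z : x != y -> x != z -> y != z ->
  r [set x; y; z] <= 2 -> s [set x; y; z] <= 2 -> False.
Proof.
move=> xy xz yz h1 h2; have sm := small3 xy xz yz (or_introl h1).
have := lam_eq2 sm; rewrite cards3 // => /(_ isT).
have := rk_lam R [set x; y; z]; rewrite cards3 //; lia.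
Qed.

End Basic.

(** * Tutte's triangle lemma *)

Section Triangle.
Variables (r s : {set T} -> nat) (del con : T -> Prop).
Hypothesis H : setup r s del con.
Let R := su_rk H.
Let S' := su_rk' H.

Lemma lamE X : lam X + r setT = r X + r (~: X).
Proof. by have := rk_lam R X; have := rk_dual R X; nlia. Qed.

(** A 2-separation of [M \ x]. Unlike in [tri], neither side has to be small, so the sides can be
    exchanged; Tutte's lemma uses this to choose the side that contains a given element. *)
Definition split2 x A :=
  [/\ x \notin A, 1 < #|A|, 1 < #|~: (x |: A)| &
      r A + r (~: (x |: A)) <= r setT + 1].

Lemma split2C x A : split2 x A -> split2 x (~: (x |: A)).
Proof.
case=> xA cA cB h; have e : ~: (x |: ~: (x |: A)) = A by set_solve.
by split; rewrite ?e // ?inE ?eqxx // addnC.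
Qed.

Lemma tri_split2 A x : tri s A x -> split2 x A.
Proof.
move=> t; have e := tri_r H t; case: t => xA cA sA [lA lxA] _.
split=> //; first by have := card_co_small1 H sA; nlia.
by have := lamE (x |: A); nlia.
Qed.

Lemma split2_pair x y w : y != w -> split2 x [set y; w] -> s [set x; y; w] <= 2.
Proof.
move=> yw [xA _ _]; have e : x |: [set y; w] = [set x; y; w] by set_solve.
rewrite e (proj1 (rk2 H yw)); have := rk_dual R [set x; y; w].
rewrite -e cardsU1 xA cards2 yw; nlia.
Qed.

Lemma cl_triangle x y z : y != z -> r [set x; y; z] <= 2 ->
  r (x |: [set y; z]) = r [set y; z].
Proof.
move=> yz h; have := proj1 (rk2 H yz).
have := rk_mono R (subsetUr [set x] [set y; z]).
have -> : x |: [set y; z] = [set x; y; z] by set_solve.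
nlia.
Qed.

Lemma split2_triangle x y z A : x != y -> x != z -> y != z ->
  r [set x; y; z] <= 2 -> split2 x A -> y \in A -> z \notin A.
Proof.
move=> xy xz yz h [xA cA cB hA] yA; apply/negP => zA.
have e := cl_triangle yz h.
have yzA : [set y; z] \subset A by rewrite subUset !sub1set yA zA.
have := cl_mono H yzA e; have := lamE (x |: A).
have := su_conn2 H (A := x |: A); rewrite cardsU1 xA; nlia.
Qed.

(** The 2-separations [(A, B)] of [M \ x] and [(C, D)] of [M \ y] are crossed. The triangle puts [y]
    in the closure of [B :|: C] and [x] in that of [A :|: D], so the corners [A :&: D] and [B :&: C]
    have total connectivity at most 2, and one with two elements forces the other to be empty.
    Similarly [A :&: C] and [B :&: D] cannot both have two elements. By counting, one of [A], [B],
    [C] has two elements, or [A :&: C] is a singleton and [B :&: D] is not; each case shows a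
    triad. *)
Lemma tutte_core x y z A C : x != y -> x != z -> y != z ->
  r [set x; y; z] <= 2 -> split2 x A -> split2 y C ->
  y \in A -> z \notin A -> x \in C -> z \notin C ->
  exists2 w, w \notin [set x; y; z] &
    s [set x; y; w] <= 2 \/ s [set x; z; w] <= 2.
Proof.
move=> xy xz yz h sA sC yA zA xC zC.
have [xA cA cB hA] := sA; have [yC cC cD hC] := sC.
have sB := split2C sA.
have tx := cl_triangle yz h.
have ty : r (y |: [set x; z]) = r [set x; z].
  by apply: cl_triangle => //; have -> : [set y; x; z] = [set x; y; z] by set_solve.
have [B BE] : exists B, B = ~: (x |: A) by exists (~: (x |: A)).
have [D DE] : exists D, D = ~: (y |: C) by exists (~: (y |: C)).
rewrite -BE in cB hA sB *; rewrite -DE in cD hC *.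
have zB : z \in B by rewrite BE !inE negb_or eq_sym xz.
have zD : z \in D by rewrite DE !inE negb_or eq_sym yz.
have xB : x \notin B by rewrite BE !inE eqxx.
have yB : y \notin B by rewrite BE !inE yA orbT.
have BDE : B :&: D = ~: (A :|: C) by rewrite BE DE; set_solve.
have i1 := rk_sub R A C; have i2 := rk_sub R B D.
have i3 := rk_sub R A D; have i4 := rk_sub R B C.
have l1 := lamE (A :|: C); rewrite -BDE in l1.
have l2 : lam (A :&: D) + lam (B :&: C) <= 2.
  have e1 : ~: (A :&: D) = y |: (B :|: C) by rewrite BE DE; set_solve.
  have e2 : ~: (B :&: C) = x |: (A :|: D) by rewrite BE DE; set_solve.
  have f1 : r (y |: (B :|: C)) = r (B :|: C).
    apply: (@cl_mono _ _ _ _ H _ [set x; z]).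
      by rewrite subUset !sub1set !inE xC zB !orbT.
    by [].
  have f2 : r (x |: (A :|: D)) = r (A :|: D).
    apply: (@cl_mono _ _ _ _ H _ [set y; z]).
      by rewrite subUset !sub1set !inE yA zD orbT.
    by [].
  have := lamE (A :&: D); have := lamE (B :&: C); rewrite e1 e2 f1 f2; nlia.
have cAD : 1 < #|~: (A :&: D)|.
  have : [set x; z] \subset ~: (A :&: D) by set_solve.
  by move/subset_leq_card; rewrite cards2 xz.
have cBC : 1 < #|~: (B :&: C)|.
  have : [set x; y] \subset ~: (B :&: C) by set_solve.
  by move/subset_leq_card; rewrite cards2 xy.
have b2 : 1 < #|A :&: D| -> #|B :&: C| = 0.
  move=> c; have := su_conn2 H c cAD => l.
  by have := su_conn1 H (A := B :&: C); nlia.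
have c2 : 1 < #|B :&: C| -> #|A :&: D| = 0.
  move=> c; have := su_conn2 H c cBC => l.
  by have := su_conn1 H (A := A :&: D); nlia.
have cAC : 1 < #|A :|: C|.
  have : [set x; y] \subset A :|: C by set_solve.
  by move/subset_leq_card; rewrite cards2 xy.
have bd : 1 < #|B :&: D| -> r (A :&: C) + r (B :|: D) <= r setT.
  move=> c; have := su_conn2 H cAC; rewrite -BDE => /(_ c); nlia.
have a2 : 1 < #|A :&: C| -> #|B :&: D| <= 1.
  move=> c; rewrite leqNgt; apply/negP => /bd q.
  have e1 : ~: (A :&: C) = x |: (y |: (B :|: D)) by rewrite BE DE; set_solve.
  have f1 : r (x |: (y |: (B :|: D))) = r (y |: (B :|: D)).
    apply: (@cl_mono _ _ _ _ H _ [set y; z]).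
      by rewrite subUset !sub1set !inE zB eqxx orbT.
    by [].
  have f2 := rk_add H y (B :|: D).
  have := lamE (A :&: C); rewrite e1 f1.
  have : 1 < #|~: (A :&: C)|.
    have : [set x; y] \subset ~: (A :&: C) by set_solve.
    by move/subset_leq_card; rewrite cards2 xy.
  by move/(su_conn2 H c); nlia.
have kA : #|A| = #|A :&: C| + #|A :&: D| + 1.
  have := cardsID C A; have -> : A :\: C = y |: (A :&: D) by rewrite DE; set_solve.
  rewrite cardsU1 DE !inE eqxx /= andbF; nlia.
have kC : #|C| = #|A :&: C| + #|B :&: C| + 1.
  have := cardsID A C; have -> : C :\: A = x |: (B :&: C) by rewrite BE; set_solve.
  rewrite cardsU1 inE (negbTE xB) setIC /=; nlia.
have kB : #|B| = #|B :&: D| + #|B :&: C|.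
  have := cardsID D B; have -> : B :\: D = B :&: C by rewrite BE DE; set_solve.
  nlia.
have kD : #|D| = #|B :&: D| + #|A :&: D|.
  have := cardsID B D; have -> : D :\: B = A :&: D by rewrite BE DE; set_solve.
  rewrite setIC; nlia.
have : #|A| = 2 \/ #|C| = 2 \/ #|B| = 2 \/ (#|A :&: C| = 1 /\ 1 < #|B :&: D|).
  by clear -b2 c2 a2 kA kB kC kD cA cB cC cD; nlia.
case=> [k|[k|[k|[k kd]]]].
- have [w wy e] := card2_with k yA; rewrite e in sA zA xA.
  exists w; last by left; apply: split2_pair sA; rewrite eq_sym.
  by move: zA xA; rewrite !inE !negb_or wy andbT !(eq_sym _ w) => /andP[_ ->] /andP[_ ->].
- have [w wx e] := card2_with k xC; rewrite e in sC zC yC.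
  exists w; last first.
    left; have -> : [set x; y; w] = [set y; x; w] by set_solve.
    by apply: split2_pair sC; rewrite eq_sym.
  by move: zC yC; rewrite !inE !negb_or wx !(eq_sym _ w) => /andP[_ ->] /andP[_ ->].
- have [w wz e] := card2_with k zB; rewrite e in sB xB yB.
  exists w; last by right; apply: split2_pair sB; rewrite eq_sym.
  by move: xB yB; rewrite !inE !negb_or wz !(eq_sym _ w) => /andP[_ ->] /andP[_ ->].
(* Here [bd] leaves rank at most [r setT - 1] for [B :|: D], which is the complement of [{x, y, w}];
   hence the triad. *)
have /cards1P[w e] : #|A :&: C| == 1 by rewrite k.
have : w \in A :&: C by rewrite e set11.
rewrite inE => /andP[wA wC].
have wx : w != x by apply: contraNneq xA => <-.
have wy : w != y by apply: contraNneq yC => <-.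
have wz : w != z by apply: contraNneq zA => <-.
exists w; first by rewrite !inE !negb_or wx wy wz.
left; have := bd kd; rewrite e (proj1 (rk1 H w)).
have := rk_dual R [set x; y; w]; rewrite cards3 1?(eq_sym _ w) //.
have -> : ~: [set x; y; w] = B :|: D.
  have -> : B :|: D = ~: ((A :&: C) :|: [set x; y]) by rewrite BE DE; set_solve.
  by rewrite e; set_solve.
nlia.
Qed.

(** Each separation separates the two other elements of the triangle, since otherwise their side
    would span the deleted element and give a 2-separation of the whole matroid. Passing to the
    other side where necessary reduces to [tutte_core]. *)
Lemma tutte_triangle x y z : x != y -> x != z -> y != z ->
  r [set x; y; z] <= 2 -> (exists A, tri s A x) -> (exists A, tri s A y) ->
  exists2 w, w \notin [set x; y; z] &
    s [set x; y; w] <= 2 \/ s [set x; z; w] <= 2.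
Proof.
move=> xy xz yz h [A0 /tri_split2 tA] [C0 /tri_split2 tC].
have [A sA yA] : exists2 A, split2 x A & y \in A.
  case: (boolP (y \in A0)) => yA; first by exists A0.
  by exists (~: (x |: A0)); [apply: split2C | rewrite !inE negb_or eq_sym xy].
have [C sC xC] : exists2 C, split2 y C & x \in C.
  case: (boolP (x \in C0)) => xC; first by exists C0.
  by exists (~: (y |: C0)); [apply: split2C | rewrite !inE negb_or xy].
have zA := split2_triangle xy xz yz h sA yA.
have zC : z \notin C.
  apply: (split2_triangle _ yz xz _ sC xC); first by rewrite eq_sym.
  by have -> : [set y; x; z] = [set x; y; z] by set_solve.
exact: tutte_core h sA sC yA zA xC zC.
Qed.

End Triangle.

(** * Uncrossing a witness with a small set *)

Section Uncross.
Variables (r s : {set T} -> nat) (del con : T -> Prop).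
Hypothesis H : setup r s del con.

(** If [A :&: A'] has two elements, it is the new witness. Otherwise [A :\: A'] without [x] is one
    as soon as [A :\: A'] has connectivity at most 2, which submodularity gives when [A' :\: A] has
    two elements. What escapes is a set [A] of at most three elements, or a pair [A'] with one
    element on each side of [A]. *)
Lemma tri_uncross A A' x : small A -> x \in A -> tri s A' x ->
  [\/ exists A0, [/\ A0 \subset A, #|A0| < #|A| & tri s A0 x], #|A| <= 3 |
      exists y z, [/\ y \in A, y != x, z \notin A, A' = [set y; z] & z != x]].
Proof.
move=> sA xA t; have [xA' cA' sA' [lA' lxA'] _] := t.
have sm' : small A' by apply: (small_sub H) sA' (subsetUr _ _) lA'.
have lA := su_lam H sA.
have done_by A0 : A0 \subset A -> x \notin A0 -> 1 < #|A0| -> small (x |: A0) ->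
    (A0 \subset A' \/ A0 \subset ~: A') ->
    exists A1, [/\ A1 \subset A, #|A1| < #|A| & tri s A1 x].
  move=> s0 x0 c0 sm0 h0; exists A0; split=> //.
    by apply: proper_card; apply/properP; split=> //; exists x.
  exact: (tri_transfer H t).
case: (leqP #|A| 3) => c3; first by constructor 2.
case: (ltnP 1 #|A :&: A'|) => cI.
  constructor 1; apply: (done_by (A :&: A')) => //.
  - exact: subsetIl.
  - by rewrite inE negb_and xA' orbT.
  - have -> : x |: A :&: A' = A :&: (x |: A') by set_solve.
    apply: (small_sub H sA (subsetIl _ _)); apply: (lam_I H) => //.
    by have := subset_leq_card (subsetUl A (x |: A')); nlia.
  - by left; apply: subsetIr.
have cD := cardsID A' A; have cD1 := cardsD1 x (A :\: A').
rewrite !inE xA xA' /= in cD1.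
have nI : A :&: A' = set0 \/ exists y, A :&: A' = [set y].
  have : (#|A :&: A'| == 0) || (#|A :&: A'| == 1) by nlia.
  by rewrite cards_eq0 => /orP[/eqP->|/cards1P[y ->]]; [left | right; exists y].
have fin : lam (A :\: A') <= 2 ->
    exists A1, [/\ A1 \subset A, #|A1| < #|A| & tri s A1 x].
  move=> l; apply: (done_by ((A :\: A') :\ x)).
  - set_solve.
  - by rewrite !inE eqxx.
  - nlia.
  - rewrite setD1K ?inE ?xA ?xA' //.
    by apply: (small_sub H sA (subsetDl _ _) l).
  - right; set_solve.
case: nI => [e|[y e]].
  constructor 1; apply: fin; have -> // : A :\: A' = A.
  by apply/setDidPl; rewrite -setI_eq0 e.
case: (ltnP 1 #|A' :\: A|) => c'.
  constructor 1; apply: fin; have := lam_subD H A A'.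
  have : 1 < #|~: (A' :\: A)|.
    have : A \subset ~: (A' :\: A) by set_solve.
    by move/subset_leq_card; nlia.
  by move/(su_conn2 H c'); nlia.
have yI : y \in A :&: A' by rewrite e set11.
move: yI; rewrite inE => /andP[yA yA'].
have := cardsID A A'; rewrite setIC e cards1 => k.
have [z zy e'] : exists2 z, z != y & A' = [set y; z] by apply: card2_with => //; nlia.
constructor 3; exists y, z; split=> //.
- by apply: contraNneq xA' => <-.
- apply/negP => zA; have : z \in A :&: A' by rewrite inE zA e' !inE eqxx orbT.
  by rewrite e inE (negbTE zy).
- by apply: contraNneq xA' => <-; rewrite e' !inE eqxx orbT.
Qed.

End Uncross.

(** * Fans that cannot be extended forever *)

Definition stuck (r s : {set T} -> nat) (del con : T -> Prop) :=
  (forall x, x \notin P -> del x -> exists A, tri s A x) /\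
  (forall x, x \notin P -> con x -> exists A, tri r A x).

(* [S] contains a fan ending in the triangle [{p, q, w}], with [w] last. *)
Definition fan_end (r s : {set T} -> nat) (del : T -> Prop) S p q w :=
  [/\ [/\ p \in S, q \in S & w \in S], [/\ p != q, p != w & q != w],
      r [set p; q; w] <= 2, small S /\ lam (S :\ w) <= 2 &
      [/\ exists A, tri s A q, w \notin P & del w]].

Section FanStep.
Variables (r s : {set T} -> nat) (del con : T -> Prop).
Hypothesis H : setup r s del con.

Lemma notinF x : x \notin P -> x \notin F.
Proof. by apply: contra; apply: (subsetP (su_FP H)). Qed.

Lemma small_P S x y z : small S -> x \in S -> x \notin P ->
  y \in S -> y \in P -> z \in S -> z \in P -> y = z.
Proof.
move=> sS xS xP yS yP zS zP; apply: (card_le1_eq (su_P H sS xS xP)).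
  by rewrite inE yS.
by rewrite inE zS.
Qed.

Lemma lam_ext S z w u : z \in S -> w \in S -> u \notin S -> z != w ->
  s [set z; w; u] <= 2 -> lam (u |: S) <= lam S.
Proof.
move=> zS wS uS zw h.
have e : s (u |: S) = s S.
  apply: (cl_mono (setup_flip H) (A := [set z; w])).
    by rewrite subUset !sub1set zS wS.
  apply: (cl_triangle (setup_flip H)) => //.
  by have -> : [set u; z; w] = [set z; w; u] by set_solve.
have := rk_add H u S; have := rk_lam (su_rk H) S.
have := rk_lam (su_rk H) (u |: S); rewrite cardsU1 uS e; nlia.
Qed.

Lemma small_ext S z w u : small S -> z \in S -> w \in S -> u \notin S -> z != w ->
  s [set z; w; u] <= 2 -> small (u |: S).
Proof.
move=> sS zS wS uS zw h; apply: (small_un H) => //.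
  by apply: (su_pair H); rewrite cards1.
by have := lam_ext zS wS uS zw h; have := su_lam H sS; nlia.
Qed.

(** Tutte's lemma at the last triangle provides the triad. Were [u] in [S], the end [w] would be
    both spanned and cospanned by [S :\ w], and the connectivity of [S] would drop to 1. *)
Lemma fan_step S p q w : stuck r s del con -> fan_end r s del S p q w ->
  exists z u, [/\ z = p \/ z = q, u \notin S & s [set z; w; u] <= 2].
Proof.
move=> st [[pS qS wS] [pq pw qw] h [sS lS] [bq wP dw]].
have bw := st.1 _ wP dw.
have [||||u uN hu] := tutte_triangle H _ _ _ _ bw bq (z := p).
- by rewrite eq_sym.
- by rewrite eq_sym.
- by rewrite eq_sym.
- by have -> : [set w; q; p] = [set p; q; w] by set_solve.
move: uN; rewrite !inE !negb_or => /andP[/andP[uw uq] up].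
have [z [zpq zS zw hz]] :
    exists z, [/\ z = p \/ z = q, z \in S, z != w & s [set z; w; u] <= 2].
  case: hu => hu; [exists q | exists p]; split; auto.
    by have -> : [set q; w; u] = [set w; q; u] by set_solve.
  by have -> : [set p; w; u] = [set w; p; u] by set_solve.
have uz : u != z by case: zpq => ->.
exists z, u; split=> //; apply/negP => uS.
have e1 : r S = r (S :\ w).
  rewrite -{1}(setD1K wS); apply: (cl_mono H (A := [set p; q])).
    by rewrite subUset !sub1set !inE pw qw pS qS.
  apply: (cl_triangle H) => //.
  by have -> : [set w; p; q] = [set p; q; w] by set_solve.
have e2 : s S = s (S :\ w).
  rewrite -{1}(setD1K wS); apply: (cl_mono (setup_flip H) (A := [set z; u])).
    by rewrite subUset !sub1set !inE zw uw zS uS.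
  apply: (cl_triangle (setup_flip H)); first by rewrite eq_sym.
  by have -> : [set w; z; u] = [set z; w; u] by set_solve.
have := rk_lam (su_rk H) S; have := rk_lam (su_rk H) (S :\ w).
have c := cardsD1 w S; rewrite wS in c.
have : 1 < #|S :\ w|.
  have : [set p; q] \subset S :\ w by rewrite subUset !sub1set !inE pw qw pS qS.
  by move/subset_leq_card; rewrite cards2 pq.
move=> c1; have := lam_ge2 H sS; rewrite e1 e2; nlia.
Qed.

End FanStep.

(** A fan in a stuck situation always grows, yet a small set leaves more than two elements outside.
    If the new element [u] is outside [P], the triad through the deletable end [w] makes [u]
    contractible, and [u] is the end of a fan in the dual. If [u] is in [P], then either [S] already
    met [P] and the small set [u |: S] meets it twice, or growth continues at the other end, with
    [u] as the element of [P] in the fan. *)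
Lemma fan_false n r s del con : setup r s del con -> stuck r s del con ->
  forall S p q w, #|~: S| <= n -> fan_end r s del S p q w ->
  (exists2 a, a \in S & a \in P) \/
  (exists p' q' w', [/\ w' \notin [set p; q; w], w \notin [set p'; q'; w'] &
     fan_end r s del S p' q' w' \/ fan_end s r con S p' q' w']) -> False.
Proof.
elim: n r s del con => [|n IHn] r s del con H st S p q w cS fe.
  have [_ _ _ [sS _] _] := fe.
  by have := card_co_small1 H sS; rewrite ltnNge (leq_trans cS).
move=> oth; have [z [u [zpq uS hu]]] := fan_step H st fe.
have [[pS qS wS] [pq pw qw] h [sS lS] [bq wP dw]] := fe.
have zS : z \in S by case: zpq => ->.
have zw : z != w by case: zpq => ->.
have uw : u != w by apply: contraNneq uS => ->.
have uz : u != z by apply: contraNneq uS => ->.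
have sS1 := small_ext H sS zS wS uS zw hu.
have lS1 S0 : S0 \subset S -> z \in S0 -> w \in S0 -> lam S0 <= 2 -> lam (u |: S0) <= 2.
  move=> s0 z0 w0 l0; apply: leq_trans l0; apply: (lam_ext H z0 w0 _ zw hu).
  by apply: contra uS; apply: (subsetP s0).
have cS1 : #|~: (u |: S)| <= n.
  have e : ~: (u |: S) = ~: S :\ u by set_solve.
  by rewrite e; have := cardsD1 u (~: S); rewrite inE uS; nlia.
have stF : stuck s r con del by case: st.
have HF := setup_flip H.
have up r' s' del' p' q' w' : w' != z -> w' != w ->
    fan_end r' s' del' S p' q' w' -> fan_end r' s' del' (u |: S) p' q' w'.
  move=> w'z w'w [[p'S q'S w'S] ne h' [_ l'] rest].
  have uw' : u != w' by apply: contraNneq uS => ->.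
  split=> //; first by split; rewrite inE ?p'S ?q'S ?w'S orbT.
  split=> //; have -> : (u |: S) :\ w' = u |: (S :\ w') by set_solve.
  by apply: lS1 => //; [apply: subD1set | |]; rewrite !inE 1?eq_sym ?w'z ?w'w.
case: (boolP (u \in P)) => uP.
  case: oth => [[a aS aP]|[p' [q' [w' [w'N wN fe']]]]].
    have := small_P H sS1 (setU1r u wS) wP (setU1r u aS) aP (setU11 u S) uP.
    by move=> e; rewrite -e aS in uS.
  move: w'N; rewrite !inE !negb_or => /andP[/andP[w'p w'q] w'w].
  have w'z : w' != z by case: zpq => ->.
  have a : exists2 a, a \in u |: S & a \in P by exists u => //; apply: setU11.
  case: fe' => fe'.
    exact: (IHn _ _ _ _ H st _ _ _ _ cS1 (up _ _ _ _ _ _ w'z w'w fe') (or_introl a)).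
  exact: (IHn _ _ _ _ HF stF _ _ _ _ cS1 (up _ _ _ _ _ _ w'z w'w fe') (or_introl a)).
have cu : con u.
  apply: (minor_triad (su_mn H) (e := w) (a := z)) (notinF H uP) => //.
  - by rewrite eq_sym.
  - by rewrite eq_sym.
  - by rewrite eq_sym.
  - by have -> : [set w; z; u] = [set z; w; u] by set_solve.
have feN : fan_end s r con (u |: S) z w u.
  split=> //.
  - by split; rewrite inE ?zS ?wS ?set11 ?orbT.
  - by split=> //; rewrite eq_sym.
  - by split=> //; rewrite setU1K //; apply: (su_lam H).
  split=> //; exists [set p; q]; apply: (tri3 HF) => //.
  - by rewrite eq_sym.
  - by rewrite eq_sym.
  - by have -> : [set w; p; q] = [set p; q; w] by set_solve.
apply: (IHn _ _ _ _ HF stF _ _ _ _ cS1 feN).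
case: oth => [[a aS aP]|[p' [q' [w' [w'N wN fe']]]]].
  by left; exists a => //; rewrite inE aS orbT.
right; exists p', q', w'.
move: w'N; rewrite !inE !negb_or => /andP[/andP[w'p w'q] w'w].
have w'z : w' != z by case: zpq => ->.
have [p'S q'S w'S] : [/\ p' \in S, q' \in S & w' \in S] by case: fe' => -[].
split.
- rewrite w'z w'w; by apply: contraNneq uS => <-.
- by rewrite -!negb_or; apply: contra uS => /orP[/orP[]|] /eqP->.
- by case: fe' => fe'; [right|left]; apply: up fe'.
Qed.

(** Whether [v2] is deletable or contractible, the minor passes along the triad and the triangle so
    that [v4] is deletable and [v1] contractible, unless they lie in [P]. At most one end lies in
    [P]; it serves as the first alternative of [fan_false], and two free ends serve as the
    second. *)
Lemma fan4_false r s del con v1 v2 v3 v4 : setup r s del con -> stuck r s del con ->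
  v1 != v2 -> v1 != v3 -> v1 != v4 -> v2 != v3 -> v2 != v4 -> v3 != v4 ->
  s [set v1; v2; v3] <= 2 -> r [set v2; v3; v4] <= 2 ->
  v2 \notin P -> v3 \notin P -> False.
Proof.
move=> H st n12 n13 n14 n23 n24 n34 hs hr p2 p3.
have HF := setup_flip H; have stF : stuck s r con del by case: st.
have [n21 n31 n41] : [/\ v2 != v1, v3 != v1 & v4 != v1] by split; rewrite eq_sym.
have [n32 n42 n43] : [/\ v3 != v2, v4 != v2 & v4 != v3] by split; rewrite eq_sym.
have f2 := notinF H p2; have f3 := notinF H p3.
have e231 : [set v2; v3; v1] = [set v1; v2; v3] by set_solve.
have e321 : [set v3; v2; v1] = [set v1; v2; v3] by set_solve.
have e213 : [set v2; v1; v3] = [set v1; v2; v3] by set_solve.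
have e324 : [set v3; v2; v4] = [set v2; v3; v4] by set_solve.
have e243 : [set v2; v4; v3] = [set v2; v3; v4] by set_solve.
have c1 : v1 \notin P -> con v1.
  move=> /(notinF H) f1; case: (minor_or (su_mn H) f2) => [d2|c2].
    by apply: (minor_triad (su_mn H) (e := v2) (a := v3)) => //; rewrite e231.
  have d3 : del v3.
    by apply: (minor_triad (su_mn' H) (e := v2) (a := v4)) => //; rewrite e243.
  by apply: (minor_triad (su_mn H) (e := v3) (a := v2)) => //; rewrite e321.
have d4 : v4 \notin P -> del v4.
  move=> /(notinF H) f4; case: (minor_or (su_mn H) f2) => [d2|c2]; last first.
    by apply: (minor_triad (su_mn' H) (e := v2) (a := v3)).
  have c3 : con v3.
    by apply: (minor_triad (su_mn H) (e := v2) (a := v1)) => //; rewrite e213.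
  by apply: (minor_triad (su_mn' H) (e := v3) (a := v2)) => //; rewrite e324.
pose S := v4 |: [set v1; v2; v3].
have s1 : small [set v1; v2; v3] by apply: (small3 H) => //; right.
have s4 : small [set v2; v3; v4] by apply: (small3 H) => //; left.
have sS : small S.
  apply: (small_ext HF s1 (z := v2) (w := v3)) => //; rewrite !inE ?eqxx ?orbT //.
  by rewrite (negbTE n41) (negbTE n42).
have [m1 m2 m3 m4] : [/\ v1 \in S, v2 \in S, v3 \in S & v4 \in S].
  by split; rewrite !inE eqxx ?orbT.
have E1 : v1 \notin P -> fan_end s r con S v2 v3 v1.
  move=> p1; split=> //; first by rewrite e231.
    split=> //; have -> : S :\ v1 = [set v2; v3; v4] by rewrite /S; set_solve.
    exact: (su_lam H).
  split; auto; exists [set v2; v4]; apply: (tri3 HF) => //; by rewrite e324.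
have E4 : v4 \notin P -> fan_end r s del S v2 v3 v4.
  move=> p4; split=> //.
    split=> //; have -> : S :\ v4 = [set v1; v2; v3] by rewrite /S; set_solve.
    exact: (su_lam H).
  split; auto; exists [set v2; v1]; apply: (tri3 H) => //; by rewrite e321.
case: (boolP (v4 \in P)) => p4.
  have p1 : v1 \notin P.
    apply/negP => p1; have := small_P H sS m2 p2 m1 p1 m4 p4.
    by move/eqP; rewrite (negbTE n14).
  apply: (fan_false HF stF (leqnn _) (E1 p1)).
  by left; exists v4.
apply: (fan_false H st (leqnn _) (E4 p4)).
case: (boolP (v1 \in P)) => p1; first by left; exists v1.
right; exists v2, v3, v1; split; last by right; apply: E1.
  by rewrite !inE !negb_or n12 n13 n14.
by rewrite !inE !negb_or n42 n43 n41.
Qed.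

(** The fan [e, a, b, c] already meets [P] in [a], so growth at the end [c] alone leads to a
    contradiction. *)
Lemma fan_at r s del con e a b c : setup r s del con -> stuck r s del con ->
  e != a -> e != b -> a != b -> c != a -> c != b ->
  s [set e; a; b] <= 2 -> r [set a; b; c] <= 2 ->
  a \in P -> b \notin P -> c \notin P -> con b -> False.
Proof.
move=> H st ea eb ab ca cb hs hr aP bP cP cnb.
have HF := setup_flip H.
have [ae be ba] : [/\ a != e, b != e & b != a] by split; rewrite eq_sym.
have [ac bc] : a != c /\ b != c by split; rewrite eq_sym.
have ce : c != e.
  apply/eqP => ce; rewrite ce in hr; apply: (not_triangle_triad H ea eb ab) hs.
  by have -> : [set e; a; b] = [set a; b; e] by set_solve.
have sm : small [set e; a; b] by apply: (small3 H) => //; right.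
have cN : c \notin [set e; a; b] by rewrite !inE !negb_or ce ca cb.
have sS : small (c |: [set e; a; b]).
  by apply: (small_ext HF sm (z := a) (w := b)) => //; rewrite !inE eqxx ?orbT.
have fe : fan_end r s del (c |: [set e; a; b]) a b c.
  split=> //.
  - by split; rewrite !inE eqxx ?orbT.
  - by split=> //; rewrite setU1K //; apply: (su_lam H).
  split=> //.
    exists [set e; a]; apply: (tri3 H) => //.
    by have -> : [set b; e; a] = [set e; a; b] by set_solve.
  apply: (minor_triad (su_mn' H) (e := b) (a := a)) (notinF H cP) => //.
  by have -> : [set b; a; c] = [set a; b; c] by set_solve.
apply: (fan_false H st (leqnn _) fe); left; exists a => //.
by rewrite !inE eqxx !orbT.
Qed.

(** * Minimal obstructions to a removal *)

Definition cand (r s : {set T} -> nat) (del con : T -> Prop) A e :=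
  e \notin P /\ ((tri s A e /\ del e) \/ (tri r A e /\ con e)).

(** Candidates pool deletions and contractions, so a smallest candidate remains smallest after
    dualising; the arguments below may then treat the deletion case only. *)
Lemma cand_flip r s del con A e : cand r s del con A e -> cand s r con del A e.
Proof. by case=> eP [h|h]; split=> //; [right|left]. Qed.

Section Cases.
Variables (r s : {set T} -> nat) (del con : T -> Prop).
Hypothesis H : setup r s del con.
Hypothesis st : stuck r s del con.
Let HF := setup_flip H.
Let stF : stuck s r con del. Proof. by case: st. Qed.

Lemma tri_pair_le x y z : tri s [set y; z] x -> s [set x; y; z] <= 2.
Proof.
case=> xN _ _ _ e; have -> : [set x; y; z] = x |: [set y; z] by set_solve.
rewrite e; have := rk_card (su_rk' H) [set y; z]; rewrite cards2.
by case: (y != z); nlia.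
Qed.

(** Without a triad [{e, y, z}] the value [s A] is 3, so connectivity 2 makes [A] a triangle. Each
    of its elements is then cospanned by the rest of [e |: A], the configuration of [minor_quad]. *)
Lemma quad_del A e : tri s A e -> del e -> #|A| = 3 ->
  (forall y z, y \in A -> z \in A -> y != z -> 2 < s [set e; y; z]) ->
  (forall y z, y \in A -> z \in A -> y != z -> y \notin F \/ z \notin F) ->
  [/\ r A <= 2, 2 < s A & forall x, x \in A -> x \notin F -> del x].
Proof.
move=> t de cA pair_no AF; have [eA _ sS [lA lS] e1] := t.
have sm : small A by apply: (small_sub H sS (subsetUr _ _) lA).
have l2 : lam A = 2 by apply: (lam_eq2 H sm); rewrite cA.
have sA : 2 < s A.
  have [x [y [z [xy xz yz eA3]]]] := card3P cA.
  rewrite -e1; apply: leq_trans (pair_no x y _ _ xy) _.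
  - by rewrite eA3 !inE eqxx.
  - by rewrite eA3 !inE eqxx orbT.
  - by apply: (rk_mono (su_rk' H)); rewrite eA3; set_solve.
have rs := rk_lam (su_rk H) A; have cs := rk_card (su_rk' H) A.
have rA : r A <= 2 by nlia.
split=> // x xA xF.
have /cards2P[y [z [yz eA2]]] : #|A :\ x| == 2.
  by have := cardsD1 x A; rewrite xA cA; nlia.
have : y \in A :\ x by rewrite eA2 !inE eqxx.
have : z \in A :\ x by rewrite eA2 !inE eqxx orbT.
rewrite !inE => /andP[zx zA] /andP[yx yA].
have eA3 : A = [set x; y; z] by rewrite -(setD1K xA) eA2; set_solve.
have [xy xz] : x != y /\ x != z by split; rewrite eq_sym.
have ne v : v \in A -> e != v by move=> vA; apply: contraNneq eA => ->.
have [ex ey ez] := And3 (ne _ xA) (ne _ yA) (ne _ zA).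
apply: (minor_quad (su_mn H) ex ey ez xy xz yz) => //; first by rewrite -eA3.
  2: exact: AF.
have eS : [set e; x; y; z] = e |: A by rewrite eA3; set_solve.
move=> u; rewrite -eA3 => uA.
have /cards2P[v [w [vw eu]]] : #|A :\ u| == 2.
  by have := cardsD1 u A; rewrite uA cA; nlia.
have : v \in A :\ u by rewrite eu !inE eqxx.
have : w \in A :\ u by rewrite eu !inE eqxx orbT.
rewrite !inE => /andP[wu wA] /andP[vu vA].
have := pair_no v w vA wA vw.
have -> : [set e; v; w] = [set e; x; y; z] :\ u.
  have eu' := ne _ uA.
  have -> : [set e; v; w] = e |: (A :\ u) by rewrite eu; set_solve.
  by rewrite eS; set_solve.
have := rk_mono (su_rk' H) (subD1set [set e; x; y; z] u).
rewrite eS e1; have := cs; rewrite cA; nlia.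
Qed.

(** Two extensions share [x] and [y], so their union is small; as it contains [x] outside [P], it
    has room for one element of [P] only. *)
Lemma ext_uniq A x y w w' : small A -> x \in A -> y \in A -> x != y -> x \notin P ->
  small (w |: A) -> small (w' |: A) -> w \in P -> w' \in P -> w = w'.
Proof.
move=> sA xA yA xy xP s1 s2 wP wP'.
have sU : small ((w |: A) :|: (w' |: A)).
  by apply: (small_U H s1 s2 (x := x) (y := y)) => //; rewrite !inE ?xA ?yA !orbT.
by apply: (small_P H sU (x := x)) => //; rewrite !inE ?xA ?eqxx ?orbT.
Qed.

(** In [tri_uncross], minimality rules out a smaller witness inside [A], and also a pair [{y, z}]
    with [z] outside [P]. Only a triad reaching [P] is left. *)
Lemma clean_line A x : small A -> A \subset ~: P -> 3 < #|A| ->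
  (forall A' e', A' \subset ~: P -> cand r s del con A' e' -> #|A| <= #|A'|) ->
  x \in A -> del x ->
  exists y z, [/\ y \in A, y != x, z \notin A, z \in P & s [set x; y; z] <= 2].
Proof.
move=> sA AP cA min xA dx.
have xP : x \notin P by have := subsetP AP x xA; rewrite inE.
have [A' tA'] := st.1 _ xP dx.
case: (tri_uncross H sA xA tA') => [[A0 [s0 c0 t0]]|c3|[y [z [yA yx zA eA' zx]]]].
- have cd : cand r s del con A0 x by split=> //; left.
  by have := min _ _ (subset_trans s0 AP) cd; nlia.
- by nlia.
rewrite eA' in tA'; exists y, z; split=> //; last exact: tri_pair_le.
apply/negPn/negP => zP.
have cd : cand r s del con [set y; z] x by split=> //; left.
have yzP : [set y; z] \subset ~: P.
  by rewrite subUset !sub1set !inE zP andbT; have := subsetP AP y yA; rewrite inE.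
have := min _ _ yzP cd; rewrite cards2; case: (y != z) => /=; nlia.
Qed.

End Cases.

(** Minimality forces the triads and triangles met at elements of a large [A] to reach [P], while a
    single element of [P] can be attached to [A] in this way. The triads, or triangles, through that
    element determine too much of [A]. *)
Lemma clean_false r s del con A e : setup r s del con -> stuck r s del con ->
  e \notin P -> tri s A e -> del e -> A \subset ~: P ->
  (forall A' e', A' \subset ~: P -> cand r s del con A' e' -> #|A| <= #|A'|) ->
  False.
Proof.
move=> H st eP t de AP min.
have HF := setup_flip H; have stF : stuck s r con del by case: st.
have minF A' e' : A' \subset ~: P -> cand s r con del A' e' -> #|A| <= #|A'|.
  by move=> h /cand_flip; apply: min.
have [eA cA sS [lA lS] e1] := t.
have sA : small A by apply: (small_sub H sS (subsetUr _ _) lA).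
have l2 := lam_eq2 H sA cA.
have nP x : x \in A -> x \notin P by move=> xA; have := subsetP AP x xA; rewrite inE.
have AF : A \subset ~: F.
  by apply/subsetP => x xA; rewrite inE; apply: (notinF H); apply: nP.
have ne v : v \in A -> e != v by move=> vA; apply: contraNneq eA => ->.
have min2 x y z : x \notin P -> del x -> x != y -> x != z -> y != z ->
    y \notin P -> z \notin P -> s [set x; y; z] <= 2 -> #|A| <= 2.
  move=> xP dx xy xz yz yP zP h.
  have cd : cand r s del con [set y; z] x by split=> //; left; split=> //; apply: (tri3 H).
  have := min _ _ _ cd; rewrite cards2 yz; apply.
  by rewrite subUset !sub1set !inE yP zP.
case: (ltnP 3 #|A|) => c3.
  have [x xA cx] := minor_span (su_mn H) eA AF e1.
  have [y [a [yA yx aA aP h]]] := clean_line HF stF sA AP c3 minF xA cx.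
  have xy : x != y by rewrite eq_sym.
  have sa : small (a |: A) by apply: (small_ext HF sA xA yA aA xy h).
  (* A deletable element would give a triad through the same [a]. Then [A] both spans and cospans
     [a], and [a |: A] has connectivity 1. *)
  have nd x' : x' \in A -> ~ del x'.
    move=> x'A dx'.
    have [y' [a' [y'A y'x' a'A a'P h']]] := clean_line H st sA AP c3 min x'A dx'.
    have x'y' : x' != y' by rewrite eq_sym.
    have sa' : small (a' |: A) by apply: (small_ext H sA x'A y'A a'A x'y' h').
    have ea := ext_uniq H sA xA yA xy (nP _ xA) sa sa' aP a'P; rewrite -ea in h'.
    have r1 : r (a |: A) = r A.
      apply: (cl_mono H (A := [set x; y])); first by rewrite subUset !sub1set xA yA.
      apply: (cl_triangle H) => //.
      by have -> : [set a; x; y] = [set x; y; a] by set_solve.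
    have s1 : s (a |: A) = s A.
      apply: (cl_mono HF (A := [set x'; y'])); first by rewrite subUset !sub1set x'A y'A.
      apply: (cl_triangle HF) => //.
      by have -> : [set a; x'; y'] = [set x'; y'; a] by set_solve.
    have := rk_lam (su_rk H) (a |: A); have := rk_lam (su_rk H) A.
    rewrite r1 s1 cardsU1 aA; have := lam_ge2 H sa; rewrite cardsU1 aA; nlia.
  (* With no deletable element [A] is independent, so connectivity 2 gives [s A = 2]; any two
     elements of [A] form a triad with [e], a candidate of size two. *)
  have rA := minor_indep (su_mn H) AF nd.
  have sA2 : s A <= 2 by have := rk_lam (su_rk H) A; nlia.
  have := min2 e x y eP de (ne _ xA) (ne _ yA) xy (nP _ xA) (nP _ yA).
  have hh : s [set e; x; y] <= 2.
    apply: leq_trans sA2; rewrite -e1; apply: (rk_mono (su_rk' H)); set_solve.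
  by move/(_ hh); nlia.
have : #|A| = 3 \/ #|A| = 2 by nlia.
case=> {}c3.
  have pair_no y z : y \in A -> z \in A -> y != z -> 2 < s [set e; y; z].
    move=> yA zA yz; rewrite ltnNge; apply/negP => h.
    by have := min2 e y z eP de (ne _ yA) (ne _ zA) yz (nP _ yA) (nP _ zA) h; nlia.
  have [|rA sA3 dA] := quad_del H t de c3 pair_no.
    by move=> y z yA _ _; left; apply: (notinF H); apply: nP.
  have dA' x : x \in A -> del x by move=> xA; apply: dA => //; apply: (notinF H); apply: nP.
  (* Any element of the triangle [A] lies in a triad with another one and an element of [P]. Two
     such triads covering [A] share their element of [P] and one more element, so their union has
     [s] at most 2, against [2 < s A]. *)
  have line x y z : x != y -> x != z -> y != z -> A = [set x; y; z] ->
      exists v w, [/\ (v = y \/ v = z), w \notin A, w \in P & s [set x; v; w] <= 2].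
    move=> xy xz yz eA3.
    have [xA yA zA] : [/\ x \in A, y \in A & z \in A].
      by rewrite eA3; split; rewrite !inE eqxx ?orbT.
    have [|w wN hw] := tutte_triangle H xy xz yz _ (st.1 _ (nP _ xA) (dA' _ xA))
                         (st.1 _ (nP _ yA) (dA' _ yA)); first by rewrite -eA3.
    rewrite -eA3 in wN.
    have nw v : v \in A -> v != w by move=> vA; apply: contraNneq wN => <-.
    have [v [vyz vA xv hv]] : exists v, [/\ v = y \/ v = z, v \in A, x != v & s [set x; v; w] <= 2].
      by case: hw => hw; [exists y | exists z]; split; auto.
    exists v, w; split=> //; apply/negPn/negP => wP.
    by have := min2 x v w (nP _ xA) (dA' _ xA) xv (nw _ xA) (nw _ vA) (nP _ vA) wP hv; nlia.
  have [x [y0 [z0 [xy0 xz0 yz0 eA0]]]] := card3P c3.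
  have [v [w [vyz wA wP h1]]] := line x y0 z0 xy0 xz0 yz0 eA0.
  have [o [xv xo vo eA3]] : exists o, [/\ x != v, x != o, v != o & A = [set x; v; o]].
    case: vyz => ->; [exists z0 | exists y0]; split=> //; first by rewrite eq_sym.
    by rewrite eA0; set_solve.
  have [ox ov] : o != x /\ o != v by split; rewrite eq_sym.
  have eA4 : A = [set o; x; v] by rewrite eA3; set_solve.
  have [v' [w' [vyz' wA' wP' h2]]] := line o x v ox ov xv eA4.
  have [xA vA oA] : [/\ x \in A, v \in A & o \in A].
    by rewrite eA3; split; rewrite !inE eqxx ?orbT.
  have ov' : o != v' by case: vyz' => ->.
  have v'A : v' \in A by case: vyz' => ->.
  have ew : w = w'.
    apply: (ext_uniq H sA xA vA xv (nP _ xA)) => //.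
      exact: (small_ext H sA xA vA).
    exact: (small_ext H sA oA v'A).
  rewrite -ew in h2; have v'w : v' != w by apply: contraNneq wA => <-.
  have := rk_sub (su_rk' H) [set x; v; w] [set o; v'; w].
  have : s A <= s ([set x; v; w] :|: [set o; v'; w]).
    by apply: (rk_mono (su_rk' H)); rewrite eA3; set_solve.
  have : s [set v'; w] <= s ([set x; v; w] :&: [set o; v'; w]).
    by apply: (rk_mono (su_rk' H)); case: vyz' => ->; set_solve.
  by rewrite (proj2 (rk2 H v'w)); nlia.
(* Now [e |: A] is a triad whose elements [x] and [y] are contractible; Tutte's lemma in the dual
   adds a triangle and makes a fan of four elements. *)
have [x xA _] := card_gt_set1 e cA.
have [y yx eA2] := card2_with c3 xA.
have xy : x != y by rewrite eq_sym.
have yA : y \in A by rewrite eA2 !inE eqxx orbT.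
have [ex ey] : e != x /\ e != y by split; apply: ne.
have [xe ye] : x != e /\ y != e by split; rewrite eq_sym.
have h : s [set e; x; y] <= 2 by apply: (tri_pair_le H); rewrite -eA2.
have hx : s [set x; y; e] <= 2 by have -> : [set x; y; e] = [set e; x; y] by set_solve.
have hy : s [set e; y; x] <= 2 by have -> : [set e; y; x] = [set e; x; y] by set_solve.
have [xP yP] : x \notin P /\ y \notin P by split; apply: nP.
have cy : con y by apply: (minor_triad (su_mn H) ex ey xy h de (notinF H yP)).
have cx : con x by apply: (minor_triad (su_mn H) ey ex yx hy de (notinF H xP)).
have [w wN hw] := tutte_triangle HF xy xe ye hx (st.2 _ xP cx) (st.2 _ yP cy).
move: wN; rewrite !inE !negb_or => /andP[/andP[wx wy] we].
have [xw yw ew] : [/\ x != w, y != w & e != w] by split; rewrite eq_sym.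
case: hw => hw.
  exact: (fan4_false H st ex ey ew xy xw yw h hw xP yP).
apply: (fan4_false H st yx ye yw xe xw ew _ hw xP eP).
by have -> : [set y; x; e] = [set e; x; y] by set_solve.
Qed.

(** Every candidate meets [P], in exactly one element by smallness. Minimality brings [A] down to a
    pair [{a, b}] with [a] in [P]; the witness [A'] against contracting [b] crosses the triad
    [{e, a, b}] and is analysed through [A' :\ a], which avoids [P]. *)
Lemma unclean_false r s del con A e : setup r s del con -> stuck r s del con ->
  e \notin P -> tri s A e -> del e ->
  (forall A' e', cand r s del con A' e' -> ~ A' \subset ~: P) ->
  (forall A' e', cand r s del con A' e' -> #|A| <= #|A'|) ->
  False.
Proof.
move=> H st eP t de nc min.
have HF := setup_flip H; have stF : stuck s r con del by case: st.
have [eA cA sS [lA lS] e1] := t.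
have sA : small A by apply: (small_sub H sS (subsetUr _ _) lA).
have cd : cand r s del con A e by split=> //; left.
have ne v : v \in A -> e != v by move=> vA; apply: contraNneq eA => ->.
have [a aA aP] : exists2 a, a \in A & a \in P.
  have /negP/subsetPn[a aA] := nc _ _ cd.
  by rewrite inE negbK => aP; exists a.
have nP x : x \in A -> x != a -> x \notin P.
  move=> xA xa; apply/negP => xP.
  have := small_P H sS (setU11 e A) eP (setU1r e xA) xP (setU1r e aA) aP.
  by move/eqP; rewrite (negbTE xa).
have clean_no x y z : x \notin P -> y \notin P -> z \notin P ->
    x != y -> x != z -> y != z ->
    (s [set x; y; z] <= 2 -> del x -> False) /\
    (r [set x; y; z] <= 2 -> con x -> False).
  move=> xP yP zP xy xz yz.
  have yzP : [set y; z] \subset ~: P by rewrite subUset !sub1set !inE yP zP.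
  split=> h dx; apply: (nc [set y; z] x _ yzP); split=> //.
    by left; split=> //; apply: (tri3 H).
  by right; split=> //; apply: (tri3 HF).
have min2 x y z : x \notin P -> del x -> x != y -> x != z -> y != z ->
    s [set x; y; z] <= 2 -> #|A| <= 2.
  move=> xP dx xy xz yz h.
  have cd' : cand r s del con [set y; z] x by split=> //; left; split=> //; apply: (tri3 H).
  by have := min _ _ cd'; rewrite cards2 yz.
(* Uncrossing [A] with a witness for an element outside [P]: a smaller candidate contradicts
   minimality, and a witness with two elements bounds [A] by two. *)
have c3 : #|A| <= 3.
  have [x xA xa] := card_gt_set1 a cA.
  have xP := nP _ xA xa.
  have go A' : cand r s del con A' x ->
      [\/ exists A0, #|A0| < #|A| /\ cand r s del con A0 x, #|A| <= 3 |
          exists y z, A' = [set y; z]].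
    case=> _ [[tA' dx]|[tA' cx]].
      case: (tri_uncross H sA xA tA') => [[A0 [s0 c0 t0]]|?|[y [z [_ _ _ eA' _]]]].
      - by constructor 1; exists A0; split=> //; split=> //; left.
      - by constructor 2.
      - by constructor 3; exists y, z.
    case: (tri_uncross HF sA xA tA') => [[A0 [s0 c0 t0]]|?|[y [z [_ _ _ eA' _]]]].
    - by constructor 1; exists A0; split=> //; split=> //; right.
    - by constructor 2.
    - by constructor 3; exists y, z.
  have [A' cA'] : exists A', cand r s del con A' x.
    case: (minor_or (su_mn H) (notinF H xP)) => [dx|cx].
      by have [A' tA'] := st.1 _ xP dx; exists A'; split=> //; left.
    by have [A' tA'] := st.2 _ xP cx; exists A'; split=> //; right.
  case: (go _ cA') => [[A0 [c0 cd0]]|//|[y [z eA']]].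
    by have := min _ _ cd0; nlia.
  have := min _ _ cA'; rewrite eA' cards2; case: (y != z) => /=; nlia.
have : #|A| = 3 \/ #|A| = 2 by nlia.
case=> {}c3.
  have pair_no y z : y \in A -> z \in A -> y != z -> 2 < s [set e; y; z].
    move=> yA zA yz; rewrite ltnNge; apply/negP => h.
    by have := min2 e y z eP de (ne _ yA) (ne _ zA) yz h; nlia.
  have [|rA sA3 dA] := quad_del H t de c3 pair_no.
    move=> y z yA zA yz; case: (eqVneq y a) => [ya|ya]; [right|left];
      apply: (notinF H); apply: nP => //.
    by rewrite -ya eq_sym.
  have /cards2P[x [y [xy eA2]]] : #|A :\ a| == 2.
    by have := cardsD1 a A; rewrite aA c3; nlia.
  have : x \in A :\ a by rewrite eA2 !inE eqxx.
  have : y \in A :\ a by rewrite eA2 !inE eqxx orbT.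
  rewrite !inE => /andP[ya yA] /andP[xa xA].
  have eA3 : A = [set x; y; a] by rewrite -(setD1K aA) eA2; set_solve.
  have [xP yP] : x \notin P /\ y \notin P by split; apply: nP.
  have dx := dA _ xA (notinF H xP); have dy := dA _ yA (notinF H yP).
  have [|w wN hw] := tutte_triangle H xy xa ya _ (st.1 _ xP dx) (st.1 _ yP dy).
    by rewrite -eA3.
  rewrite -eA3 in wN.
  have nw v : v \in A -> v != w by move=> vA; apply: contraNneq wN => <-.
  case: hw => hw.
    by have := min2 x y w xP dx xy (nw _ xA) (nw _ yA) hw; nlia.
  by have := min2 x a w xP dx xa (nw _ xA) (nw _ aA) hw; nlia.
have [b ba eA2] := card2_with c3 aA.
have bA : b \in A by rewrite eA2 !inE eqxx orbT.
have bP := nP _ bA ba; have ab : a != b by rewrite eq_sym.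
have [ea eb] : e != a /\ e != b by split; apply: ne.
have [ae be] : a != e /\ b != e by split; rewrite eq_sym.
have h : s [set e; a; b] <= 2 by apply: (tri_pair_le H); rewrite -eA2.
have hbea : s (b |: [set e; a]) = s [set e; a].
  apply: (cl_triangle HF) => //.
  by have -> : [set b; e; a] = [set e; a; b] by set_solve.
have haeb : s (a |: [set e; b]) = s [set e; b].
  apply: (cl_triangle HF) => //.
  by have -> : [set a; e; b] = [set e; a; b] by set_solve.
have cb : con b by apply: (minor_triad (su_mn H) ea eb ab h de (notinF H bP)).
have [A' tA'] := st.2 _ bP cb.
have cdA' : cand r s del con A' b by split=> //; right.
have [bA' cA' sA' [lA' lbA'] rA'] := tA'.
have smA' : small A' by apply: (small_sub H sA' (subsetUr _ _) lA').
have smt : small [set e; a; b] by apply: (small3 H) => //; right.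
have [a' aA'' aP'] : exists2 a, a \in A' & a \in P.
  have /negP/subsetPn[a' aA'] := nc _ _ cdA'.
  by rewrite inE negbK => aP'; exists a'.
(* Both sides of the separation of [b] span [b], while [{e, a}] cospans it; by orthogonality [e] and
   [a] are on different sides. Were [e] the one in [A'], the union of [b |: A'] with the triad would
   be small and would force the element of [P] in [A'] to be [a]. *)
have [aA' eA'] : a \in A' /\ e \notin A'.
  case: (boolP (e \in A')) => eA'.
    have sU : small ((b |: A') :|: [set e; a; b]).
      by apply: (small_U H sA' smt (x := b) (y := e)) => //; rewrite !inE ?eqxx ?eA' ?orbT.
    have ea' : a' = a.
      by apply: (small_P H sU (x := b)) => //; rewrite !inE ?eqxx ?aA'' ?orbT.
    rewrite ea' in aA''; exfalso.
    have := tri_co HF tA'.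
    have V : [set e; a] \subset ~: (b |: ~: (b |: A')) by set_solve.
    have bN : b \notin ~: (b |: A') by rewrite !inE eqxx.
    by have := rk_add_co H bN V hbea; nlia.
  split=> //; apply/negPn/negP => aA'.
  have V : [set e; a] \subset ~: (b |: A') by set_solve.
  by have := rk_add_co H bA' V hbea; nlia.
have A'P v : v \in A' -> v != a -> v \notin P.
  move=> vA' va; apply/negP => vP.
  have := small_P H sA' (setU11 b A') bP (setU1r b vA') vP (setU1r b aA') aP.
  by move/eqP; rewrite (negbTE va).
have FL c : c \in A' -> c != a -> r [set a; b; c] <= 2 -> False.
  move=> cA1 ca hc.
  have cb1 : c != b by apply: contraNneq bA' => <-.
  exact: (fan_at H st ea eb ab ca cb1 h hc aP bP (A'P _ cA1 ca) cb).
have kR := cardsD1 a A'; rewrite aA' in kR.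
case: (ltnP 2 #|A'|) => cA'3; last first.
  have c2 : #|A'| = 2 by nlia.
  have [c ca eA3] := card2_with c2 aA'.
  apply: (FL c) => //; first by rewrite eA3 !inE eqxx orbT.
  rewrite eA3 in tA'; have := tri_pair_le HF tA'.
  by have -> : [set a; b; c] = [set b; a; c] by set_solve.
(* The pair [{e, b}] cospans [a] and avoids [A'], so [R] does not span [a]. Equal connectivities
   then make [R] cospan [a], which yields a contractible element of [R]. *)
pose R := A' :\ a.
have aR : a \notin R by rewrite !inE eqxx.
have eR : a |: R = A' by apply: setD1K.
have RA' : R \subset A' by apply: subD1set.
have V : [set e; b] \subset ~: (a |: R) by rewrite eR; set_solve.
have rR := rk_add_co H aR V haeb; have lR := lam_rem H aR V haeb.
rewrite eR in rR lR.
have cR : 1 < #|R| by rewrite /R; nlia.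
have smR : small R by apply: (small_sub H smA' RA'); nlia.
have sR : s A' = s R.
  have := lam_eq2 H smR cR; have := lam_eq2 H smA' (leqW cA'3 : 1 < _).
  have := rk_lam (su_rk H) A'; have := rk_lam (su_rk H) R.
  rewrite kR -/R; nlia.
have RP : R \subset ~: P.
  by apply/subsetP => v; rewrite !inE => /andP[va vA']; apply: A'P.
have RPn v : v \in R -> v \notin P by move=> vR; have := subsetP RP v vR; rewrite inE.
have RF : R \subset ~: F.
  by apply/subsetP => v vR; rewrite inE; apply: (notinF H); apply: RPn.
have [x xR cx] : exists2 x, x \in R & con x.
  by apply: (minor_span (su_mn H) aR RF); rewrite eR.
(* A witness inside [R] would avoid [P]. A witness [{y, z}] leaving [R] has [z = a], and its
   triangle would put [a] in the closure of [R]. *)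
have cR3 : #|R| <= 3.
  have xP := RPn _ xR; have [A2 tA2] := st.2 _ xP cx.
  case: (tri_uncross HF smR xR tA2) => [[A0 [s0 c0 t0]]|//|[y [z [yR yx zR eA3 zx]]]].
    have cd0 : cand r s del con A0 x by split=> //; right.
    by have := nc _ _ cd0; case; apply: subset_trans RP.
  rewrite eA3 in tA2; have hz := tri_pair_le HF tA2.
  have cdz : cand r s del con [set y; z] x by split=> //; right.
  have yP := RPn _ yR.
  have zP : z \in P.
    apply/negPn/negP => zP; apply: (nc _ _ cdz).
    by rewrite subUset !sub1set !inE yP zP.
  have xy : x != y by rewrite eq_sym.
  have xA' := subsetP RA' _ xR; have yA' := subsetP RA' _ yR.
  have za : z = a.
    case: (boolP (z \in A')) => zA'.
      by apply/eqP/negPn/negP => za; have := A'P _ zA' za; rewrite zP.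
    have sz := small_ext HF smA' xA' yA' zA' xy hz.
    by apply: (small_P H sz (x := x)) => //; rewrite !inE ?eqxx ?xA' ?aA' ?orbT.
  rewrite za in hz.
  have : r (a |: R) = r R.
    apply: (cl_mono H (A := [set x; y])); first by rewrite subUset !sub1set xR yR.
    apply: (cl_triangle H) => //.
    by have -> : [set a; x; y] = [set x; y; a] by set_solve.
  by rewrite eR; nlia.
have : #|R| = 3 \/ #|R| = 2 by nlia.
have kx := cardsD1 x R; rewrite xR in kx.
case=> {}cR3.
  have /cards2P[y [z [yz eR2]]] : #|R :\ x| == 2 by nlia.
  have : y \in R :\ x by rewrite eR2 !inE eqxx.
  have : z \in R :\ x by rewrite eR2 !inE eqxx orbT.
  rewrite !inE => /and3P[zx za zA'] /and3P[yx ya yA'].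
  have yR : y \in R by rewrite !inE ya.
  have zR : z \in R by rewrite !inE za.
  have eR3 : R = [set x; y; z] by rewrite -(setD1K xR) eR2; set_solve.
  have [xy xz zy] : [/\ x != y, x != z & z != y] by split; rewrite eq_sym.
  have [xP yP zP] := And3 (RPn _ xR) (RPn _ yR) (RPn _ zR).
  have [xF yF zF] := And3 (notinF H xP) (notinF H yP) (notinF H zP).
  (* Three elements with connectivity 2 have [r R + s R = 5]: a triad or a triangle. Tutte's lemma
     extends either to a fan of four elements. *)
  have [sR2|rR2] : s R <= 2 \/ r R <= 2.
    by have := rk_lam (su_rk H) R; have := lam_eq2 H smR cR; nlia.
    rewrite eR3 in sR2.
    have ey : [set y; x; z] = [set x; y; z] by set_solve.
    have ez : [set z; x; y] = [set x; y; z] by set_solve.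
    have cy : con y.
      case: (minor_or (su_mn H) yF) => // dy; exfalso.
      by apply: (proj1 (clean_no y x z yP xP zP yx yz xz)) dy; rewrite ey.
    have [w wN hw] := tutte_triangle HF xy xz yz sR2 (st.2 _ xP cx) (st.2 _ yP cy).
    move: wN; rewrite !inE !negb_or => /andP[/andP[wx wy] wz].
    have [xw yw zw] : [/\ x != w, y != w & z != w] by split; rewrite eq_sym.
    case: hw => hw.
      by apply: (fan4_false H st zx zy zw xy xw yw _ hw xP yP); rewrite ez.
    by apply: (fan4_false H st yx yz yw xz xw zw _ hw xP zP); rewrite ey.
  rewrite eR3 in rR2.
  have exzy : [set x; z; y] = [set x; y; z] by set_solve.
  have dz : del z by apply: (minor_triad (su_mn' H) xy xz yz rR2 cx zF).
  have dy : del y by apply: (minor_triad (su_mn' H) xz xy zy _ cx yF); rewrite exzy.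
  have [|w wN hw] := tutte_triangle H yz yx zx _ (st.1 _ yP dy) (st.1 _ zP dz).
    by have -> : [set y; z; x] = [set x; y; z] by set_solve.
  move: wN; rewrite !inE !negb_or => /andP[/andP[wy wz] wx].
  case: hw => hw.
    apply: (fan4_false H st wy wz wx yz yx zx _ _ yP zP).
      by have -> : [set w; y; z] = [set y; z; w] by set_solve.
    by have -> : [set y; z; x] = [set x; y; z] by set_solve.
  apply: (fan4_false H st wy wx wz yx yz xz _ _ yP xP).
    by have -> : [set w; y; x] = [set y; x; w] by set_solve.
  by have -> : [set y; x; z] = [set x; y; z] by set_solve.
have [y yx eR2] := card2_with cR3 xR.
have yR : y \in R by rewrite eR2 !inE eqxx orbT.
have xy : x != y by rewrite eq_sym.
have [xP yP] : x \notin P /\ y \notin P by split; apply: RPn.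
have [xA1 yA1] : x \in A' /\ y \in A' by split; apply: (subsetP RA').
have [xa ya] : x != a /\ y != a by move: xR yR; rewrite !inE => /andP[-> _] /andP[-> _].
have [ax ay] : a != x /\ a != y by split; rewrite eq_sym.
have [bx by'] : b != x /\ b != y by split; apply: contraNneq bA' => ->.
have eA'3 : A' = [set x; y; a] by rewrite -eR eR2; set_solve.
have hs : s [set x; y; a] <= 2.
  by rewrite -eA'3 sR eR2 (proj2 (rk2 H xy)).
have r3 : r [set b; x; y; a] = 3.
  have -> : [set b; x; y; a] = b |: A' by rewrite eA'3; set_solve.
  by rewrite rA' rR eR2 (proj1 (rk2 H xy)).
(* No three of [b, x, y, a] that include [b] form a triangle: with [a] this is [FL], without [a] it
   would be a candidate avoiding [P]. So the four elements fit the dual of [minor_quad]. *)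
have q u : u \in [set x; y; a] -> r ([set b; x; y; a] :\ u) = r [set b; x; y; a].
  move=> uN; have := rk_mono (su_rk H) (subD1set [set b; x; y; a] u); rewrite r3.
  suff : 2 < r ([set b; x; y; a] :\ u) by nlia.
  move: uN; rewrite !inE -orbA => /or3P[] /eqP->; rewrite ltnNge; apply/negP;
    clear V RA' RP RF.
  - have -> : [set b; x; y; a] :\ x = [set a; b; y] by set_solve.
    exact: FL.
  - have -> : [set b; x; y; a] :\ y = [set a; b; x] by set_solve.
    exact: FL.
  - have -> : [set b; x; y; a] :\ a = [set b; x; y] by set_solve.
    by move=> hb; apply: (proj2 (clean_no b x y bP xP yP bx by' xy) hb cb).
have cy : con y.
  apply: (minor_quad (su_mn' H) by' bx ba yx ya xa _ _ cb (notinF H yP)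
           (or_introl (notinF H xP))).
    by have -> : [set y; x; a] = [set x; y; a] by set_solve.
  have -> : [set b; y; x; a] = [set b; x; y; a] by set_solve.
  by have -> : [set y; x; a] = [set x; y; a] by set_solve.
have [w wN hw] := tutte_triangle HF xy xa ya hs (st.2 _ xP cx) (st.2 _ yP cy).
move: wN; rewrite !inE !negb_or => /andP[/andP[wx wy] wa].
have [xw yw aw] : [/\ x != w, y != w & a != w] by split; rewrite eq_sym.
case: hw => hw.
  apply: (fan4_false H st ax ay aw xy xw yw _ hw xP yP).
  by have -> : [set a; x; y] = [set x; y; a] by set_solve.
have smw : small [set x; a; w] by apply: (small3 H) => //; left.
have wP : w \notin P.
  apply/negP => wP; have : a = w.
    by apply: (small_P H smw (x := x)) => //; rewrite !inE eqxx ?orbT.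
  by move/eqP; rewrite (negbTE aw).
apply: (fan_at H st ya yx ax wa wx _ _ aP xP wP cx).
  by have -> : [set y; a; x] = [set x; y; a] by set_solve.
by have -> : [set a; x; w] = [set x; a; w] by set_solve.
Qed.

Lemma min_card (Q : {set T} -> T -> Prop) : (exists A e, Q A e) ->
  exists A e, Q A e /\ forall A' e', Q A' e' -> #|A| <= #|A'|.
Proof.
case=> A [e]; have [n] := ubnP #|A|.
elim: n A e => // n IHn A e; rewrite ltnS => An QA.
case: (classic (exists A' e', Q A' e' /\ #|A'| < #|A|)) => [[A' [e' [Q' c]]]|no].
  exact: (IHn A' e' (leq_trans c An) Q').
exists A, e; split=> // A' e' Q'; rewrite leqNgt; apply/negP => c.
by apply: no; exists A', e'.
Qed.

(** Candidates avoiding [P] are minimised first, because the other case relies on all candidates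
    meeting [P]. *)
Lemma not_stuck r s del con e : setup r s del con -> e \notin P ->
  stuck r s del con -> False.
Proof.
move=> H eP st; have HF := setup_flip H; have stF : stuck s r con del by case: st.
have [A cA] : exists A, cand r s del con A e.
  case: (minor_or (su_mn H) (notinF H eP)) => [de|ce].
    by have [A t] := st.1 _ eP de; exists A; split=> //; left.
  by have [A t] := st.2 _ eP ce; exists A; split=> //; right.
pose Q A e := A \subset ~: P /\ cand r s del con A e.
case: (classic (exists A e, Q A e)) => [exQ|noQ].
  have [B [f [[BP [fP cB]] min]]] := min_card exQ.
  have minH A' e' : A' \subset ~: P -> cand r s del con A' e' -> #|B| <= #|A'|.
    by move=> h1 h2; apply: (min A' e').
  case: cB => [[t d]|[t c]]; first exact: (clean_false H st fP t d BP minH).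
  apply: (clean_false HF stF fP t c BP) => A' e' h /cand_flip; exact: minH.
have ex : exists A e, cand r s del con A e by exists A, e.
have [B [f [[fP cB] min]]] := min_card ex.
have nc A' e' : cand r s del con A' e' -> ~ A' \subset ~: P.
  by move=> h1 h2; apply: noQ; exists A', e'.
case: cB => [[t d]|[t c]]; first exact: (unclean_false H st fP t d nc min).
by apply: (unclean_false HF stF fP t c) => A' e' /cand_flip; [apply: nc | apply: min].
Qed.

Theorem single_step r s del con e : setup r s del con -> e \notin P ->
  exists2 f, f \notin P &
    (del f /\ ~ exists A, tri s A f) \/ (con f /\ ~ exists A, tri r A f).
Proof.
move=> H eP; apply: NNPP => no; apply: (not_stuck H eP).
split=> x xP dx; apply: NNPP => nt; apply: no; exists x; auto.
Qed.

End SingleStep.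

(** * Contraction sets realizing a fixed minor *)

Section Realizers.
Variables (T : finType) (F : {set T}).
Implicit Types (A B C D S V W X Y Z U : {set T}) (e f p q u v w x y z : T).

(* [C] realizes the minor with rank function [rho] on [F] as [M / C] restricted
   to [F]; the deleted set is the complement of [F :|: C]. *)
Definition realizes (r : {set T} -> nat) (rho : {set T} -> nat) C :=
  C \subset ~: F /\ forall W, W \subset F -> rho W + r C = r (W :|: C).

(** Quantifying over all realizing sets makes the notion depend only on the labelled minor; an
    element may be deletable and contractible at once. *)
Definition deletable r rho x := x \notin F /\ exists2 C, realizes r rho C & x \notin C.
Definition contractible r rho x := exists2 C, realizes r rho C & x \in C.

Definition co_rank (rho : {set T} -> nat) W := #|W| + rho (F :\: W) - rho F.

Section Moves.
Variables (lam : {set T} -> nat) (r s rho : {set T} -> nat).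
Hypotheses (R : rank_axioms lam r s) (R' : rank_axioms lam s r).
Hypothesis rank1 : forall x, r [set x] = 1 /\ s [set x] = 1.
Hypothesis rank2 : forall x y, x != y -> r [set x; y] = 2 /\ s [set x; y] = 2.
Hypothesis rho_loop : forall x, x \in F -> 0 < rho [set x].
Hypothesis rho_coloop : forall x, x \in F -> rho F <= rho (F :\ x).
Hypothesis ex_realizer : exists C, realizes r rho C.

Let real := realizes r rho.

(** Once [V] is deleted [x] is a coloop, and the minor has none. For the same reason such an element
    may be moved into or out of the contracted set, as in [co_add] and [co_rem]. *)
Lemma co_notinF C x V : real C -> V \subset ~: (F :|: C) -> x \notin V ->
  s (x |: V) = s V -> x \notin F.
Proof.
move=> [CF h] VN xV e; apply/negP => xF.
have xC : x \notin C by have := subsetP CF x; rewrite inE; case: (x \in C) => // /(_ isT); rewrite xF.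
have := h F (subxx _); have := h _ (subD1set F x); have := rho_coloop xF.
have xN : x \notin F :\ x :|: C by rewrite !inE eqxx.
have VN' : V \subset ~: (x |: (F :\ x :|: C)) by set_solve.
have := rank_add_co R' xN VN' e.
have -> : x |: (F :\ x :|: C) = F :|: C by set_solve.
nlia.
Qed.

Lemma co_add C x V : real C -> V \subset ~: (F :|: C) -> x \notin V ->
  x \notin F -> x \notin C -> s (x |: V) = s V -> real (x |: C).
Proof.
move=> [CF h] VN xV xF xC e; split; first by set_solve.
move=> W WF; have hW := h _ WF.
have add Z : x \notin Z -> Z \subset F :|: C -> r (x |: Z) = r Z + 1.
  by move=> xZ ZN; apply: (rank_add_co R' xZ _ e); set_solve.
have -> : W :|: (x |: C) = x |: (W :|: C) by set_solve.
have -> : r (x |: C) = r C + 1 by apply: add; set_solve.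
have -> : r (x |: (W :|: C)) = r (W :|: C) + 1 by apply: add; set_solve.
by nlia.
Qed.

Lemma co_rem C x V : real C -> V \subset ~: (F :|: C) -> x \notin V ->
  x \in C -> s (x |: V) = s V -> real (C :\ x).
Proof.
move=> [CF h] VN xV xC e; split; first by set_solve.
move=> W WF; have hW := h _ WF.
have add Z : x \notin Z -> Z \subset F :|: C -> r (x |: Z) = r Z + 1.
  by move=> xZ ZN; apply: (rank_add_co R' xZ _ e); set_solve.
have xF : x \notin F by set_solve.
have xW : x \notin W :|: C :\ x by set_solve.
have xC' : x \notin C :\ x by set_solve.
have := add _ xW; have -> : x |: (W :|: C :\ x) = W :|: C by set_solve.
have s1 : W :|: C :\ x \subset F :|: C by set_solve.
have s2 : C :\ x \subset F :|: C by set_solve.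
move=> /(_ s1); have := add _ xC' s2; rewrite setD1K //; nlia.
Qed.

(** Once [V] is contracted [x] is a loop, and the minor has none; [cl_add] and [cl_rem] move such an
    element freely. *)
Lemma cl_notinF C x V : real C -> V \subset C -> r (x |: V) = r V -> x \notin F.
Proof.
move=> [CF h] VC e; apply/negP => xF; have := rho_loop xF.
have s1 : [set x] \subset F by rewrite sub1set.
by have := h _ s1; have := rank_cl_mono R VC e; nlia.
Qed.

Lemma cl_add C x V : real C -> V \subset C -> r (x |: V) = r V -> real (x |: C).
Proof.
move=> rC VC e; have xF := cl_notinF rC VC e; case: rC => CF h.
split; first by set_solve.
move=> W WF; have := h _ WF; have := rank_cl_mono R VC e.
have VW : V \subset W :|: C by set_solve.
have := rank_cl_mono R VW e.
have -> : W :|: (x |: C) = x |: (W :|: C) by set_solve.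
nlia.
Qed.

Lemma cl_rem C x V : real C -> V \subset C -> x \notin V -> x \in C ->
  r (x |: V) = r V -> real (C :\ x).
Proof.
move=> rC VC xV xC e; have xF := cl_notinF rC VC e; case: rC => CF h.
split; first by set_solve.
move=> W WF; have := h _ WF.
have V1 : V \subset C :\ x by set_solve.
have V2 : V \subset W :|: C :\ x by set_solve.
have := rank_cl_mono R V1 e; have := rank_cl_mono R V2 e; rewrite setD1K //.
have -> : x |: (W :|: C :\ x) = W :|: C by set_solve.
nlia.
Qed.

Lemma cl3r x y z : y != z -> r [set x; y; z] <= 2 -> r (x |: [set y; z]) = r [set y; z].
Proof.
move=> yz h; have := proj1 (rank2 yz).
have := rk_mono R (subsetUr [set x] [set y; z]).
have -> : x |: [set y; z] = [set x; y; z] by set_solve.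
nlia.
Qed.

Lemma cl3s x y z : y != z -> s [set x; y; z] <= 2 -> s (x |: [set y; z]) = s [set y; z].
Proof.
move=> yz h; have := proj2 (rank2 yz).
have := rk_mono R' (subsetUr [set x] [set y; z]).
have -> : x |: [set y; z] = [set x; y; z] by set_solve.
nlia.
Qed.

Lemma rank_indep A : (forall x, x \in A -> r (A :\ x) < r A) -> r A = #|A|.
Proof.
have [n] := ubnP #|A|; elim: n A => // n IHn A; rewrite ltnS => cA h.
have [->|[y yA]] := set_0Vmem A; first by have := rk_card R set0; rewrite cards0; nlia.
have cy := cardsD1 y A; rewrite yA in cy.
have := rk_card R A; have := h y yA.
rewrite (IHn (A :\ y)); [nlia | nlia |].
move=> x; rewrite !inE => /andP[xy xA]; rewrite ltnNge; apply/negP => le.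
have e : r (x |: (A :\ y :\ x)) = r (A :\ y :\ x).
  have := rk_mono R (subsetUr [set x] (A :\ y :\ x)).
  have -> : x |: (A :\ y :\ x) = A :\ y by set_solve.
  nlia.
have s1 : A :\ y :\ x \subset A :\ x by set_solve.
by have := rank_cl_mono R s1 e; rewrite setD1K //; have := h x xA; nlia.
Qed.

(** Each axiom is an exchange in the realizing set: an element that is a loop or a coloop at the
    right moment changes between contracted and deleted. *)
Lemma minor_half : minor_axioms F r s (deletable r rho) (contractible r rho).
Proof.
split.
- move=> x xF; have [C rC] := ex_realizer.
  by case: (boolP (x \in C)) => xC; [right|left; split=> //]; exists C.
- move=> e a b ea eb ab h [eF [C rC eC]] bF.
  case: (boolP (b \in C)) => bC; first by exists C.
  have V1 : [set e; b] \subset ~: (F :|: C) by set_solve.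
  have aN : a \notin [set e; b] by rewrite !inE negb_or (eq_sym a e) ea ab.
  have e1 : s (a |: [set e; b]) = s [set e; b].
    by apply: cl3s => //; have -> : [set a; e; b] = [set e; a; b] by set_solve.
  have aF := co_notinF rC V1 aN e1.
  have [C1 rC1 [aC1 bC1 eC1]] : exists2 C1, real C1 & [/\ a \notin C1, b \notin C1 & e \notin C1].
    case: (boolP (a \in C)) => aC; last by exists C.
    exists (C :\ a); first exact: (co_rem rC V1 aN aC e1).
    by rewrite !inE eqxx (negbTE bC) (negbTE eC) !andbF.
  exists (b |: C1); last by rewrite setU11.
  have V2 : [set e; a] \subset ~: (F :|: C1) by set_solve.
  apply: (co_add rC1 V2) => //.
    by rewrite !inE negb_or !(eq_sym b) eb ab.
  by apply: cl3s => //; have -> : [set b; e; a] = [set e; a; b] by set_solve.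
(* A contracted [x] has to be traded away. If another element of the triangle is contracted, the
   third one is a loop and replaces [x]. If one is in [F] and the other is deleted, the deleted one
   replaces [x]. If both are deleted, [x] is a coloop and is deleted too. *)
- move=> e x y z ex ey ez xy xz yz hr hs [eF [C rC eC]] xF yzF.
  case: (boolP (x \in C)) => xC; last by split=> //; exists C.
  have [yx zx zy] : [/\ y != x, z != x & z != y] by split; rewrite eq_sym.
  split=> //.
  have in_C v w : v != x -> w != x -> v != w -> [set x; v; w] = [set x; y; z] ->
      v \in C -> exists2 C, realizes r rho C & x \notin C.
    move=> vx wx vw E vC.
    have xv : x != v by rewrite eq_sym.
    have e1 : r (w |: [set x; v]) = r [set x; v].
      apply: cl3r => //; have -> : [set w; x; v] = [set x; v; w] by set_solve.
      by rewrite E.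
    have V1 : [set x; v] \subset C by set_solve.
    have rC1 := cl_add rC V1 e1.
    exists ((w |: C) :\ x); last by rewrite !inE eqxx.
    apply: (cl_rem rC1 (V := [set v; w])); [by set_solve|by set_solve|by set_solve|].
    by apply: cl3r => //; rewrite E.
  case: (boolP (y \in C)) => yC; first by apply: (in_C y z).
  case: (boolP (z \in C)) => zC; first by apply: (in_C z y) => //; set_solve.
  have sS u : u \in [set x; y; z] ->
      s (u |: ([set e; x; y; z] :\ u)) = s ([set e; x; y; z] :\ u).
    move=> uN; rewrite setD1K ?hs //.
    by move: uN; rewrite !inE -!orbA => ->; rewrite orbT.
  have in_F v w : v != x -> w != x -> v != w -> [set x; v; w] = [set x; y; z] ->
      v \notin C -> w \notin C -> v \in F -> w \notin F ->
      exists2 C, realizes r rho C & x \notin C.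
    move=> vx wx vw E vC wC vF wF.
    have wv : w != v by rewrite eq_sym.
    have ES : [set e; x; y; z] = e |: [set x; v; w] by rewrite E; set_solve.
    have [ev ew] : e != v /\ e != w.
      have : (v \in [set x; y; z]) && (w \in [set x; y; z]) by rewrite -E !inE !eqxx !orbT.
      by case/andP => hv hw; split;
        [move: hv|move: hw]; rewrite !inE => /orP[/orP[]|] /eqP->.
    have e1 : r (w |: [set x; v]) = r [set x; v].
      apply: cl3r; first by rewrite eq_sym.
      have -> : [set w; x; v] = [set x; v; w] by set_solve.
      by rewrite E.
    have e2 : r (x |: [set v; w]) = r [set v; w] by apply: cl3r => //; rewrite E.
    have add u Z : u \in [set x; v; w] -> u \notin Z -> Z \subset ~: [set e; x; y; z] ->
        r (u |: Z) = r Z + 1.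
      rewrite E => uN uZ ZN; apply: (rank_add_co R' uZ _ (sS _ uN)).
      by set_solve.
    have [CF h] := rC; pose Z0 := C :\ x.
    exists (w |: Z0); last by rewrite /Z0; set_solve.
    split; first by rewrite /Z0; set_solve.
    have xZ0 : x \notin Z0 by rewrite !inE eqxx.
    have wZ0 : w \notin Z0 by rewrite !inE (negbTE wC) andbF.
    have Z0S : Z0 \subset ~: [set e; x; y; z] by rewrite ES /Z0; set_solve.
    have eC0 : r C = r Z0 + 1.
      by rewrite -{1}(setD1K xC); apply: add => //; rewrite !inE eqxx.
    have eC1 : r (w |: Z0) = r Z0 + 1.
      by apply: add => //; rewrite !inE eqxx !orbT.
    move=> W WF; have := h _ WF; rewrite eC0 eC1 => ->.
    case: (boolP (v \in W)) => vW.
      have V1 : [set x; v] \subset W :|: C by set_solve.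
      have V2 : [set v; w] \subset W :|: (w |: Z0) by set_solve.
      have := rank_cl_mono R V1 e1; have := rank_cl_mono R V2 e2.
      have -> : x |: (W :|: (w |: Z0)) = w |: (W :|: C) by rewrite /Z0; set_solve.
      by nlia.
    have WS : W :|: Z0 \subset ~: [set e; x; y; z].
      by clear Z0S; rewrite ES /Z0; set_solve.
    have -> : W :|: C = x |: (W :|: Z0) by rewrite /Z0; set_solve.
    have -> : W :|: (w |: Z0) = w |: (W :|: Z0) by rewrite /Z0; set_solve.
    have xN : x \notin W :|: Z0 by clear Z0S WS; rewrite /Z0; set_solve.
    have wN : w \notin W :|: Z0 by clear Z0S WS; rewrite /Z0; set_solve.
    have -> : r (x |: (W :|: Z0)) = r (W :|: Z0) + 1.
      by apply: add => //; rewrite !inE eqxx.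
    by rewrite add // !inE eqxx !orbT.
  case: (boolP (y \in F)) => yF.
    case: yzF => [|zF]; first by rewrite yF.
    exact: (in_F y z).
  case: (boolP (z \in F)) => zF; first by apply: (in_F z y) => //; set_solve.
  exists (C :\ x); last by rewrite !inE eqxx.
  have uN : x \in [set x; y; z] by rewrite !inE eqxx.
  by apply: (co_rem rC _ _ xC (sS _ uN)); set_solve.
(* Every realizing set contains [A], so an element spanned by the rest of [A] could be dropped from
   it. *)
- move=> A AF nd; apply: rank_indep => x xA; rewrite ltnNge; apply/negP => le.
  have [C rC] := ex_realizer.
  have xF : x \notin F by have := subsetP AF x xA; rewrite inE.
  have AC : A \subset C.
    apply/subsetP => y yA; apply/negPn/negP => yC; apply: (nd y yA).
    by split; [have := subsetP AF y yA; rewrite inE | exists C].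
  apply: (nd x xA); split=> //; exists (C :\ x); last by rewrite !inE eqxx.
  apply: (cl_rem rC (V := A :\ x)); [by set_solve|by set_solve|by set_solve|].
  by rewrite setD1K //; have := rk_mono R (subD1set A x); nlia.
(* If [A] is never contracted, it is always deleted, which lets [a] be deleted as well. In a minimal
   part [A0] of [A] cospanning [a], the element [a] can be exchanged with any [x] in [A0]; then [x]
   is a coloop after the other deletions and may be contracted. *)
move=> a A aA AF e; apply: NNPP => no.
have nC C x : real C -> x \in A -> x \notin C.
  by move=> rC xA; apply/negP => xC; apply: no; exists x => //; exists C.
have [C0 rC0] := ex_realizer.
have AN C : real C -> A \subset ~: (F :|: C).
  move=> rC; apply/subsetP => x xA; rewrite !inE negb_or (nC C x) //.
  by have := subsetP AF x xA; rewrite inE => ->.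
have aF := co_notinF rC0 (AN _ rC0) aA e.
have [C rC aC] : exists2 C, real C & a \notin C.
  case: (boolP (a \in C0)) => aC; last by exists C0.
  by exists (C0 :\ a); [apply: (co_rem rC0 (AN _ rC0)) | rewrite !inE eqxx].
have [A0 /minsetP[/eqP e0 min0] A0A] :
    {A0 | minset (fun B => s (a |: B) == s B) A0 & A0 \subset A}.
  by apply: minset_exists; apply/eqP.
have [A00|[x xA0]] := set_0Vmem A0.
  move: e0; rewrite A00 setU0 (proj2 (rank1 a)).
  by have := rk_card R' set0; rewrite cards0; nlia.
have xA := subsetP A0A _ xA0; apply: no; exists x => //.
exists (x |: C); last by rewrite setU11.
have ANC := AN _ rC.
have xa : x != a by apply: contraNneq aA => <-.
apply: (co_add rC (V := (a |: A0) :\ x)) => //.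
- by set_solve.
- by rewrite !inE eqxx.
- by have := subsetP AF x xA; rewrite inE.
- exact: nC.
have -> : x |: (a |: A0) :\ x = a |: A0 by set_solve.
have ne : s (a |: (A0 :\ x)) != s (A0 :\ x).
  apply/negP => /min0 /(_ (subD1set _ _)) E.
  by rewrite -E !inE eqxx in xA0.
have -> : (a |: A0) :\ x = a |: (A0 :\ x) by set_solve.
have := rank_add R' a (A0 :\ x); have := rank_add R' x (A0 :\ x).
rewrite setD1K // e0.
have : s (a |: (A0 :\ x)) <= s (a |: A0) by apply: (rk_mono R'); set_solve.
move/eqP: ne; rewrite e0; nlia.
Qed.

Lemma realizes_co C : realizes r rho C -> realizes s (co_rank rho) (~: (F :|: C)).
Proof.
case=> CF h; split; first by set_solve.
move=> W WF; have h0 := h F (subxx _); have hW := h _ (subsetDl F W).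
have := rk_dual R (W :|: ~: (F :|: C)); have := rk_dual R (~: (F :|: C)).
have -> : ~: (W :|: ~: (F :|: C)) = (F :\: W) :|: C by set_solve.
rewrite setCK; have := cardsUI W (~: (F :|: C)).
have -> : W :&: ~: (F :|: C) = set0 by set_solve.
have := rk_mono R' (subsetUr W (~: (F :|: C))); rewrite cards0 /co_rank; nlia.
Qed.

Lemma co_rank_loop x : x \in F -> 0 < co_rank rho [set x].
Proof. by move=> xF; have := rho_coloop xF; rewrite /co_rank cards1; nlia. Qed.

Lemma co_rank_coloop x : x \in F -> co_rank rho F <= co_rank rho (F :\ x).
Proof.
move=> xF; have := rho_loop xF; have [C [_ h]] := ex_realizer.
have := h _ (sub0set _); rewrite set0U /co_rank setDv.
have -> : F :\: (F :\ x) = [set x] by set_solve.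
by have := cardsD1 x F; rewrite xF; nlia.
Qed.

End Moves.

(** The second half is the first for the dual, where contracted and deleted sets change roles. *)
Lemma minor_both lam r s rho :
  rank_axioms lam r s -> rank_axioms lam s r ->
  (forall x, r [set x] = 1 /\ s [set x] = 1) ->
  (forall x y, x != y -> r [set x; y] = 2 /\ s [set x; y] = 2) ->
  (forall x, x \in F -> 0 < rho [set x]) ->
  (forall x, x \in F -> rho F <= rho (F :\ x)) ->
  (exists C, realizes r rho C) ->
  minor_axioms F r s (deletable r rho) (contractible r rho) /\
  minor_axioms F s r (contractible r rho) (deletable r rho).
Proof.
move=> R R' r1 r2 l cl ex; split; first exact: (minor_half R R').
have ex' : exists C, realizes s (co_rank rho) C.
  by have [C rC] := ex; exists (~: (F :|: C)); apply: (realizes_co R R' rC).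
have r1' x : s [set x] = 1 /\ r [set x] = 1 by have [] := r1 x.
have r2' x y : x != y -> s [set x; y] = 2 /\ r [set x; y] = 2 by move/r2 => [].
have := minor_half R' R r1' r2' (co_rank_loop cl) (co_rank_coloop l ex) ex'.
(* Subtraction in [co_rank] is truncated, so that applying it twice gives back [rho] on [F] is
   derived from an actual realizing set. *)
have back D : realizes s (co_rank rho) D -> realizes r rho (~: (F :|: D)).
  move=> rD; have [CF h] := realizes_co R' R rD; split=> // W WF; rewrite -h //.
  congr (_ + _); rewrite /co_rank.
  have [C [_ hC]] := ex; have [_ hD] := rD.
  have h0 := hC _ (sub0set _); rewrite set0U in h0.
  have hF := hC F (subxx _); have hW := hC W WF.
  have mW := rk_mono R (setSU C WF).
  have hFW := hC _ (subsetDl F W).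
  have -> : F :\: F = set0 by rewrite setDv.
  have -> : F :\: (F :\: W) = W by set_solve.
  have := cardsID W F; have -> : F :&: W = W by set_solve.
  have : r (F :|: C) <= #|F :\: W| + r (W :|: C).
    have := rk_sub R (F :\: W) (W :|: C); have := rk_card R (F :\: W).
    have -> : F :\: W :|: (W :|: C) = F :|: C by set_solve.
    by nlia.
  have : r (F :|: C) <= #|F| + r C.
    by have := rk_sub R F C; have := rk_card R F; nlia.
  by nlia.
have d1 x : contractible r rho x -> deletable s (co_rank rho) x.
  case=> C rC xC; split; first by case: rC => CF _; have := subsetP CF x xC; rewrite inE.
  by exists (~: (F :|: C)); [apply: (realizes_co R R' rC) | rewrite !inE xC orbT].
have d2 x : deletable s (co_rank rho) x -> contractible r rho x.
  case=> xF [D rD xD]; exists (~: (F :|: D)); first exact: back.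
  by rewrite !inE negb_or xF.
have c1 x : deletable r rho x -> contractible s (co_rank rho) x.
  case=> xF [C rC xC]; exists (~: (F :|: C)); first exact: (realizes_co R R' rC).
  by rewrite !inE negb_or xF.
have c2 x : contractible s (co_rank rho) x -> deletable r rho x.
  case=> D rD xD; split; first by case: rD => DF _; have := subsetP DF x xD; rewrite inE.
  by exists (~: (F :|: D)); [apply: back | rewrite !inE xD orbT].
case=> mo mt mq mi ms; split.
- by move=> x /mo[/d2|/c2]; auto.
- by move=> e a b h1 h2 h3 h4 /d1 h5 h6; apply: c2; apply: (mt e a b).
- move=> e x y z h1 h2 h3 h4 h5 h6 h7 h8 /d1 h9 h10 h11; apply: d2.
  exact: (mq e x y z).
- by move=> A AF h; apply: mi => // x xA /d2; apply: h.
- by move=> a A h1 h2 h3; have [x xA /c2 dx] := ms _ _ h1 h2 h3; exists x.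
Qed.

End Realizers.

(** * Tangles, and one removal step inside a minor *)

Section FullGround.
Variables (T : finType) (lam : {set T} -> nat) (small : {set T} -> Prop) (P F : {set T}).
Variables (r s : {set T} -> nat) (del con : T -> Prop).
Hypothesis H : setup lam small P F r s del con.
Let R := su_rk H.
Let R' := su_rk' H.

(** A violation bounds the connectivity of [A] and [x |: A] by [k], so both equal 2 and [k = 2]: for
    [k = 1] one side would still have two elements. The small side among [x |: A] and its complement
    then gives a witness, after adding [x] in the second case. *)
Lemma no_tri_conn x k (A : {set T}) : ~ (exists A, tri lam small s A x) ->
  0 < k < 3 -> x \notin A -> k <= #|A| -> k <= #|~: (x |: A)| ->
  r (~: [set x]) + k <= r A + r (~: (x |: A)).
Proof.
move=> nt k03 xA cA cB; rewrite leqNgt; apply/negP => lt.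
have rx : r (~: [set x]) = r setT.
  by have := rk_dual R [set x]; rewrite (proj2 (rk1 H x)) cards1; nlia.
have eB : ~: A = x |: ~: (x |: A) by set_solve.
have xB : x \notin ~: (x |: A) by rewrite !inE eqxx.
have kA : #|x |: A| = #|A| + 1 by rewrite cardsU1 xA addnC.
have kB : #|~: A| = #|~: (x |: A)| + 1 by rewrite eB cardsU1 xB addnC.
have l1 := lamE H (x |: A); have l2 := lamE H A; rewrite eB in l2.
have a1 := rk_add H x A; have a2 := rk_add H x (~: (x |: A)).
have c2A := su_conn2 H (A := x |: A); have c2B := su_conn2 H (A := A).
have k12 : k = 1 \/ k = 2 by nlia.
have k2 : k = 2.
  case: k12 => // k1; exfalso.
  have sx : small [set x] by apply: (su_pair H); rewrite cards1.
  have := card_co_small1 H sx.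
  have -> : ~: [set x] = A :|: ~: (x |: A) by set_solve.
  have := cardsUI A (~: (x |: A)); nlia.
have lxA : lam (x |: A) = 2 by nlia.
have lA : lam A = 2 by nlia.
have lxB : lam (x |: ~: (x |: A)) = 2 by rewrite -eB (lamC H).
have lB : lam (~: (x |: A)) = 2 by rewrite (lamC H).
have sx : small [set x] by apply: (su_pair H); rewrite cards1.
have tri_of (Z : {set T}) : x \notin Z -> 1 < #|Z| -> small (x |: Z) -> lam Z = 2 ->
    lam (x |: Z) = 2 -> r (x |: Z) = r Z + 1 -> exists A, tri lam small s A x.
  move=> xZ cZ sZ lZ lxZ rZ; exists Z; split=> //; first by rewrite lZ lxZ.
  have := rk_lam R Z; have := rk_lam R (x |: Z); rewrite cardsU1 xZ; nlia.
apply: nt; have [sA|sB] : small (x |: A) \/ small (~: (x |: A)).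
    by apply: (su_or H); rewrite lxA.
  by apply: (tri_of A) => //; nlia.
apply: (tri_of (~: (x |: A))) => //; try by nlia.
by apply: (small_un H) => //; rewrite lxB.
Qed.

End FullGround.

Section Dual.
Variables (U : finType) (r : {set U} -> nat).
Implicit Types X Y : {set U}.
Hypotheses (rc : forall X, r X <= #|X|)
  (rm : forall X Y : {set U}, X \subset Y -> r X <= r Y)
  (rs : forall X Y, r (X :|: Y) + r (X :&: Y) <= r X + r Y).

Definition dual_rank (X : {set U}) := #|X| + r (~: X) - r setT.
Definition conn (X : {set U}) := r X + r (~: X) - r setT.

Lemma rank_split (X : {set U}) : r setT <= r X + r (~: X).
Proof. by have := rs X (~: X); rewrite setUCr; nlia. Qed.

Lemma rank_axioms_dual :
  rank_axioms conn r dual_rank /\ rank_axioms conn dual_rank r.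
Proof.
have sp := rank_split; have r0 : r set0 = 0 by have := rc set0; rewrite cards0; nlia.
have le X : r setT <= #|X| + r (~: X) by have := rc X; have := sp X; nlia.
have co X : #|~: X| + #|X| = #|U| by have := cardsC X; nlia.
split; split=> //.
- by move=> X; have := le X; have := sp X; rewrite /conn /dual_rank; nlia.
- by move=> X; have := le X; rewrite /dual_rank; nlia.
- by move=> X; have := rm (subsetT (~: X)); rewrite /dual_rank; nlia.
- move=> X Y XY; rewrite /dual_rank.
  have := rs (Y :\: X) (~: Y); have := rc (Y :\: X); have := cardsID X Y.
  have -> : Y :&: X = X by set_solve.
  have -> : (Y :\: X) :|: ~: Y = ~: X by set_solve.
  by nlia.
- move=> X Y; rewrite /dual_rank; have := rs (~: X) (~: Y).
  rewrite -setCI -setCU; have := cardsUI X Y.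
  have := le X; have := le Y; have := le (X :|: Y); have := le (X :&: Y); nlia.
- by move=> X; have := le X; have := sp X; rewrite /conn /dual_rank; nlia.
- move=> X; rewrite /dual_rank setCK setCT r0; have := le X; have := le setT.
  by have := co X; rewrite cardsT setCT r0; have := sp X; have := rc setT; rewrite cardsT; have := le (~: X); rewrite setCK; nlia.
Qed.

End Dual.

(** * Matroids and tangles on a subset of a type *)

Section EMat.
Variables (T : finType) (E : {set T}).
Implicit Types (A B C D S V W X Y Z : {set T}) (e f x y z w : T).

(** Rank functions accept every subset of the type and ignore what lies outside [E], which spares
    inclusion hypotheses throughout. *)
Record emat (lam r s : {set T} -> nat) : Prop := {
  em_card : forall X, r X <= #|X|;
  em_mono : forall X Y, X \subset Y -> r X <= r Y;
  em_sub : forall X Y, r (X :|: Y) + r (X :&: Y) <= r X + r Y;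
  em_cap : forall X, r (X :&: E) = r X;
  em_lam : forall X, r X + s X = #|X :&: E| + lam X;
  em_dual : forall X, s X + r E = #|X :&: E| + r (E :\: X)
}.

(* 3-connectivity of the minor obtained by deleting [D] and contracting [C] *)
Definition conn3 (r : {set T} -> nat) D C := forall k A, 0 < k < 3 ->
  A \subset E :\: (D :|: C) -> k <= #|A| -> k <= #|E :\: (D :|: C) :\: A| ->
  r (E :\: D) + r C + k <= r (A :|: C) + r (E :\: D :\: A).

Record tangle (lam : {set T} -> nat) theta (Tg : {set {set T}}) : Prop := {
  tg_sub : forall X, X \in Tg -> X \subset E;
  tg_lt : forall X, X \in Tg -> lam X < theta;
  tg_or : forall X, X \subset E -> lam X < theta -> X \in Tg \/ E :\: X \in Tg;
  tg_cover : forall X Y Z, X \in Tg -> Y \in Tg -> Z \in Tg -> X :|: Y :|: Z <> E;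
  tg_co : forall e, e \in E -> E :\ e \notin Tg
}.

Section Facts.
Variables (lam r s : {set T} -> nat).
Hypotheses (R : emat lam r s) (R' : emat lam s r).

Lemma em_lamE X : lam X + r E = r X + r (E :\: X).
Proof. by have := em_lam R X; have := em_dual R X; nlia. Qed.

Lemma em_lam_sub X Y : lam (X :|: Y) + lam (X :&: Y) <= lam X + lam Y.
Proof.
have := em_lam R X; have := em_lam R Y; have := em_lam R (X :|: Y).
have := em_lam R (X :&: Y); have := em_sub R X Y; have := em_sub R' X Y.
have := cardsUI (X :&: E) (Y :&: E); rewrite -setIUl.
have -> : (X :&: E) :&: (Y :&: E) = (X :&: Y) :&: E by set_solve.
nlia.
Qed.

Lemma em_lam_card X : lam X <= #|X|.
Proof.
have := em_lam R X; have := em_card R (X :&: E); have := em_card R' (X :&: E).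
rewrite (em_cap R) (em_cap R'); have := subset_leq_card (subsetIl X E); nlia.
Qed.

Lemma em_lamU X Z : lam (X :|: Z) <= lam X + #|Z|.
Proof. by have := em_lam_sub X Z; have := em_lam_card Z; nlia. Qed.

Lemma em_add x X : r X <= r (x |: X) <= r X + 1.
Proof.
have := em_mono R (subsetUr [set x] X); have := em_sub R [set x] X.
have := em_card R [set x]; rewrite cards1; nlia.
Qed.

Lemma em_U X Y : r (X :|: Y) <= r X + r Y.
Proof. by have := em_sub R X Y; nlia. Qed.

Lemma em_cl x X Y : X \subset Y -> r (x |: X) = r X -> r (x |: Y) = r Y.
Proof.
move=> XY e; have := em_sub R (x |: X) Y; have := em_add x Y.
have -> : (x |: X) :|: Y = x |: Y by set_solve.
have : r X <= r ((x |: X) :&: Y) by apply: (em_mono R); set_solve.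
nlia.
Qed.

Section Tangle.
Variables (theta : nat) (Tg : {set {set T}}).
Hypothesis tg : tangle lam theta Tg.

Lemma tgS X Y : Y \in Tg -> X \subset Y -> lam X < theta -> X \in Tg.
Proof.
move=> YT XY lX; have YE := tg_sub tg YT.
case: (tg_or tg (subset_trans XY YE) lX) => // XT.
by case: (tg_cover tg YT YT XT); set_solve.
Qed.

Lemma tgU X Y : X \in Tg -> Y \in Tg -> lam (X :|: Y) < theta -> X :|: Y \in Tg.
Proof.
move=> XT YT l; have XE := tg_sub tg XT; have YE := tg_sub tg YT.
have UE : X :|: Y \subset E by set_solve.
case: (tg_or tg UE l) => // h.
by case: (tg_cover tg XT YT h); set_solve.
Qed.

(** Elements are added one at a time, connectivity being at most cardinality. Singletons are where
    [tg_co] enters, and the empty set is where [E] itself has to be excluded. *)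
Lemma tg_small X : X \subset E -> #|X| < theta -> X \in Tg.
Proof.
have [n] := ubnP #|X|; elim: n X => // n IHn X; rewrite ltnS => cX XE cT.
have lX : lam X < theta by have := em_lam_card X; nlia.
have [X0|[x xX]] := set_0Vmem X.
  case: (tg_or tg XE lX) => //; rewrite X0 setD0 => ET.
  by case: (tg_cover tg ET ET ET); rewrite !setUid.
have cx := cardsD1 x X; rewrite xX in cx.
have XT : X :\ x \in Tg.
  apply: IHn; [nlia | | nlia].
  exact: subset_trans (subD1set _ _) XE.
have [X1|ne] := eqVneq (X :\ x) set0; last first.
  rewrite -(setD1K xX); apply: tgU => //; last by rewrite setD1K.
  apply: IHn; rewrite ?cards1 ?sub1set; last 1 first.
  - by nlia.
  - by move: ne; rewrite -card_gt0; nlia.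
  - exact: (subsetP XE).
have eX : X = [set x] by rewrite -(setD1K xX) X1 setU0.
case: (tg_or tg XE lX) => //; rewrite eX => h.
by have := tg_co tg (subsetP XE _ xX); rewrite h.
Qed.

Lemma tg_co_card X Y : X \in Tg -> Y \in Tg -> theta <= #|E :\: (X :|: Y)|.
Proof.
move=> XT YT; rewrite leqNgt; apply/negP => c.
have ZT := tg_small (subsetDl _ _) c.
have XE := tg_sub tg XT; have YE := tg_sub tg YT.
by case: (tg_cover tg XT YT ZT); set_solve.
Qed.

End Tangle.
End Facts.
End EMat.

Lemma conn_sub (U : finType) (lam r s : {set U} -> nat) (X Y : {set U}) :
  rank_axioms lam r s -> rank_axioms lam s r ->
  lam (X :|: Y) + lam (X :&: Y) <= lam X + lam Y.
Proof.
move=> R R'; have := rk_sub R X Y; have := rk_sub R' X Y; have := cardsUI X Y.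
have := rk_lam R X; have := rk_lam R Y; have := rk_lam R (X :|: Y).
have := rk_lam R (X :&: Y); nlia.
Qed.

(** * Transfer to the subtype of a ground set *)

Definition subground (T : finType) (E : {set T}) : finType := {x : T | x \in E}.

Section Subground.
Variables (T : finType) (E : {set T}).
Implicit Types (A B : {set subground E}) (Y : {set T}) (x : subground E).

Definition elt x : T := sval x.

Lemma elt_inj : injective elt.
Proof. exact: val_inj. Qed.

Lemma eltP x : elt x \in E.
Proof. exact: valP. Qed.

Lemma elt_onto y : y \in E -> exists x, elt x = y.
Proof. by move=> yE; exists (exist _ y yE). Qed.

(** The single-step argument takes complements in a whole type, so the ground set of the current
    minor is made into a type; [lift] and [restr] translate back and forth. *)
Definition lift A : {set T} := [set elt x | x in A].
Definition restr Y : {set subground E} := [set x | elt x \in Y].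

Lemma mem_lift x A : (elt x \in lift A) = (x \in A).
Proof. exact: mem_imset elt_inj. Qed.

Lemma mem_liftP y A : reflect (exists2 x, x \in A & y = elt x) (y \in lift A).
Proof. exact: imsetP. Qed.

Lemma lift_sub A : lift A \subset E.
Proof. by apply/subsetP => y /mem_liftP[x _ ->]; apply: eltP. Qed.

Lemma liftC A : lift (~: A) = E :\: lift A.
Proof.
apply/setP => y; rewrite inE; apply/mem_liftP/andP.
  by case=> x; rewrite inE => xA ->; rewrite mem_lift; split=> //; apply: eltP.
case=> yA /elt_onto[x e]; exists x => //.
by rewrite inE -mem_lift e.
Qed.

Lemma lift0 : lift set0 = set0.
Proof. exact: imset0. Qed.

Lemma liftT : lift setT = E.
Proof. by rewrite -(setCK setT) liftC setCT lift0 setD0. Qed.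

Lemma liftU A B : lift (A :|: B) = lift A :|: lift B.
Proof. exact: imsetU. Qed.

Lemma liftI A B : lift (A :&: B) = lift A :&: lift B.
Proof. by apply: imsetI => x y _ _; apply: elt_inj. Qed.

Lemma lift1 x : lift [set x] = [set elt x].
Proof. exact: imset_set1. Qed.

Lemma card_lift A : #|lift A| = #|A|.
Proof. exact: card_imset elt_inj. Qed.

Lemma liftS A B : A \subset B -> lift A \subset lift B.
Proof. exact: imsetS. Qed.

Lemma lift_restr Y : Y \subset E -> lift (restr Y) = Y.
Proof.
move=> YE; apply/setP => y; apply/mem_liftP/idP => [[x]|yY].
  by rewrite inE => ? ->.
by have [x e] := elt_onto (subsetP YE _ yY); exists x; rewrite ?inE e.
Qed.

End Subground.

(** * One removal inside the current minor *)

Section Step.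
Variables (T : finType) (E : {set T}).
Implicit Types (A B C D G S V W X Y Z : {set T}) (e f x y z w : T).
Variables (lam r s : {set T} -> nat).
Hypotheses (R : emat E lam r s) (R' : emat E lam s r).
Variables (theta : nat) (Tg : {set {set T}}).
Hypothesis tg : tangle E lam theta Tg.
Variables (F : {set T}) (rho : {set T} -> nat) (t : nat).
Hypothesis FE : F \subset E.
Hypothesis rho_loop : forall x, x \in F -> 0 < rho [set x].
Hypothesis rho_coloop : forall x, x \in F -> rho F <= rho (F :\ x).
Hypothesis F_rank : exists Y, [/\ Y \in Tg, F \subset Y & lam Y <= t].

(* [M / C] restricted to [F] is the minor, [G] is contracted, [D] is deleted *)
Definition minor_via D G C :=
  [/\ C \subset E :\: F, G \subset C, D \subset ~: C &
      forall W, W \subset F -> rho W + r C = r (W :|: C)].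

(** When [t + #|X| <= theta], this says that the tangle rank of [F :|: X] is at least [t + #|X|],
    with no minimum to handle. *)
Definition tangle_free X :=
  forall Y, Y \in Tg -> F :|: X \subset Y -> t + #|X| <= lam Y.

(** The minor inherits a tangle: [A] counts as a member when [lift A :|: X] is one. Its connectivity
    is lower than that of [lift A :|: X] by at most [#|X|]; so sets of connectivity up to [t + #|X|]
    need [t + 2 * #|X| < theta] to be recognised, and small sets need [#|X| + 3 <= theta]. *)
Lemma step D G : D \subset E :\: F -> G \subset E :\: F -> D \subset ~: G ->
  conn3 E r D G -> tangle_free (D :|: G) -> (exists C, minor_via D G C) ->
  t + 2 * #|D :|: G| < theta -> #|D :|: G| + 3 <= theta ->
  exists g, [/\ g \in E :\: (F :|: (D :|: G)), tangle_free (g |: (D :|: G)) &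
    (conn3 E r (g |: D) G /\ exists C, minor_via (g |: D) G C) \/
    (conn3 E r D (g |: G) /\ exists C, minor_via D (g |: G) C)].
Proof.
move=> DE GE DG c3 free [C0 [C0E GC0 DC0 hC0]] b1 b2.
have [X EX] : exists X, X = D :|: G by exists (D :|: G).
rewrite -EX in free b1 b2 *.
have [E' EE'] : exists E', E' = E :\: X by exists (E :\: X).
have E1 : E' \subset E :\: X by rewrite EE'.
have E2 : E :\: X \subset E' by rewrite EE'.
have XE : X \subset E by rewrite EX; set_solve.
have XF : X \subset ~: F by rewrite EX; set_solve.
have DX : D \subset X by rewrite EX; set_solve.
have GX : G \subset X by rewrite EX; set_solve.
have XDG : X \subset D :|: G by rewrite EX.
(* The tangle rank of [F :|: X]. *)
pose m := t + #|X|.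
have [rU rUE] : exists rU : {set subground E'} -> nat,
    forall A : {set subground E'}, rU A + r G = r (lift A :|: G).
  exists (fun A : {set subground E'} => r (lift A :|: G) - r G) => A.
  by rewrite subnK //; apply: (em_mono R); apply: subsetUr.
have [RU RU'] : rank_axioms (conn rU) rU (dual_rank rU) /\
                rank_axioms (conn rU) (dual_rank rU) rU.
  apply: rank_axioms_dual.
  - move=> A; have := em_U R (lift A) G; have := em_card R (lift A).
    by have := rUE A; rewrite card_lift; nlia.
  - move=> A B AB; have := rUE A; have := rUE B.
    by have := em_mono R (setSU G (liftS AB)); nlia.
  - move=> A B; have := em_sub R (lift A :|: G) (lift B :|: G).
    have -> : (lift A :|: G) :|: (lift B :|: G) = lift (A :|: B) :|: G.
      by rewrite liftU; set_solve.
    have -> : (lift A :|: G) :&: (lift B :|: G) = lift (A :&: B) :|: G.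
      by rewrite liftI; set_solve.
    have := rUE A; have := rUE B; have := rUE (A :|: B); have := rUE (A :&: B); nlia.
have liftE (A : {set subground E'}) : lift A \subset E' by exact: lift_sub.
have coE Y : Y \subset E' -> (E' :\: Y) :|: G = E :\: D :\: Y.
  by move=> YE; rewrite EE' EX; rewrite EE' EX in YE; clear -YE DE GE DG; set_solve.
have E'G : E' :|: G = E :\: D by have := coE set0 (sub0set _); rewrite !setD0.
have cU (A : {set subground E'}) : conn rU A + r (E :\: D) + r G =
    r (lift A :|: G) + r (E :\: D :\: lift A).
  have := rk_lam RU A; have := rk_dual RU A.
  have := rUE A; have := rUE (~: A); have := rUE setT.
  by rewrite liftC liftT E'G coE //; nlia.
have lam_ge (A : {set subground E'}) : lam (lift A :|: X) <= conn rU A + #|X|.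
  have := em_lamE R (lift A :|: X); have := cU A.
  have := em_U R (lift A :|: G) D; have := em_card R D; have := em_card R G.
  have -> : (lift A :|: G) :|: D = lift A :|: X by rewrite EX; set_solve.
  have : r (E :\: (lift A :|: X)) <= r (E :\: D :\: lift A).
    by apply: (em_mono R); clear -DX; set_solve.
  have : r (E :\: D) <= r E by apply: (em_mono R); apply: subsetDl.
  have : #|X| = #|D| + #|G|.
    have := cardsUI D G; rewrite -EX.
    have -> : D :&: G = set0 by clear -DG; set_solve.
    by rewrite cards0; nlia.
  by nlia.
have lam_le (A : {set subground E'}) : conn rU A <= lam (lift A :|: X).
  have lE := liftE A.
  have := em_lamE R (lift A :|: X); have := cU A.
  have := em_U R (E :\: (lift A :|: X)) G.
  have -> : E :\: (lift A :|: X) :|: G = E :\: D :\: lift A.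
    rewrite -coE //; congr (_ :|: _); clear -E1 E2; set_solve.
  have := em_sub R (lift A :|: X) (E :\: D).
  have -> : (lift A :|: X) :|: (E :\: D) = E.
    by clear -lE E1 E2 XE DX; set_solve.
  have : r (lift A :|: G) <= r ((lift A :|: X) :&: (E :\: D)).
    apply: (em_mono R); clear -lE E1 E2 XE DX GX GE DG; set_solve.
  by nlia.
have XT : X \in Tg by apply: (tg_small R R' tg) => //; nlia.
have [Y0 [Y0T FY0 lY0]] := F_rank.
(* [Ys] plays the part of the closure of [F :|: X] in the tangle matroid of [M]. *)
have [Ys /maxsetP[/and3P[FYs YsT lYs] Ysmax] Y0Ys] :
    {Ys | maxset (fun Y => [&& F :|: X \subset Y, Y \in Tg & lam Y <= m]) Ys
        & Y0 :|: X \subset Ys}.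
  apply: maxset_exists; apply/and3P.
  have l : lam (Y0 :|: X) <= m by have := em_lamU R R' Y0 X; rewrite /m; nlia.
  split=> //; first exact: setSU.
  by apply: (tgU tg) => //; apply: leq_ltn_trans l _; rewrite /m; nlia.
have YsE := tg_sub tg YsT.
have XYs : X \subset Ys by clear -FYs; set_solve.
have YsE' : Ys :\: X \subset E' by rewrite EE'; clear -YsE; set_solve.
pose small (A : {set subground E'}) : Prop := lift A :|: X \in Tg /\ conn rU A <= 2.
(* Closure is taken a second time, now for the connectivity of the minor: [su_P] needs maximality
   there, and containing [Ys] ensures that an element outside [P] raises the tangle rank in [M]. *)
pose Q (A : {set subground E'}) := [&& restr E' Ys \subset A, lift A :|: X \in Tg & conn rU A <= m].
have liftYs : lift (restr E' Ys) :|: X = Ys.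
  have -> : restr E' Ys = restr E' (Ys :\: X).
    apply/setP => x; rewrite !inE; have := subsetP E1 _ (eltP x); rewrite inE.
    by case/andP => -> _.
  by rewrite lift_restr // setUC setDE setUIr setUCr setIT; apply/setUidPr.
have [P /maxsetP[/and3P[YsP PT lP] Pmax] _] : {P | maxset Q P & restr E' Ys \subset P}.
  apply: maxset_exists; apply/and3P; rewrite liftYs; split=> //.
  by apply: leq_trans lYs; rewrite -{2}liftYs; apply: lam_le.
pose F' : {set subground E'} := restr E' F.
have F'P : F' \subset P.
  apply: subset_trans YsP; apply/subsetP => x; rewrite !inE => xF.
  by apply: (subsetP FYs); rewrite inE xF.
have FE' : F \subset E' by rewrite EE'; clear -FE XF; apply/subsetP => u; set_point u.
have liftF : lift F' = F by apply: lift_restr.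
pose rho' (W : {set subground E'}) := rho (lift W).
have coU (A : {set subground E'}) : lift A :|: X \in Tg -> theta <= #|~: A|.
  move=> AT; have := tg_co_card R R' tg AT AT; rewrite setUid.
  suff -> : E :\: (lift A :|: X) = lift (~: A) by rewrite card_lift.
  by rewrite liftC; clear -E1 E2; set_solve.
have coE2 (A : {set subground E'}) : E :\: (D :|: G) :\: lift A = lift (~: A).
  by rewrite liftC -EX -EE'.
have con1 (A : {set subground E'}) k : 0 < k < 3 -> k <= #|A| -> k <= #|~: A| -> k <= conn rU A.
  move=> k3 cA cB; have := cU A.
  have := c3 k (lift A) k3; rewrite coE2 !card_lift -EX -EE' => /(_ (liftE A) cA cB).
  by nlia.
have lamU_card (A : {set subground E'}) : conn rU A <= #|A|.
  by have := rk_lam RU A; have := rk_card RU A; have := rk_card RU' A; nlia.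
have smallpair (A : {set subground E'}) : #|A| <= 2 -> small A.
  move=> cA; split; last by have := lamU_card A; nlia.
  apply: (tg_small R R' tg).
    by have lE := liftE A; clear -XE lE E1; set_solve.
  by have := cardsUI (lift A) X; rewrite card_lift; nlia.
have rank1 (x : subground E') : rU [set x] = 1 /\ dual_rank rU [set x] = 1.
  have c : #|[set x]| <= 2 by rewrite cards1.
  have := con1 [set x] 1 isT; have := coU _ (smallpair _ c).1.
  have := rk_lam RU [set x]; have := rk_card RU [set x].
  have := rk_card RU' [set x]; rewrite cards1; nlia.
have rank2 (x y : subground E') : x != y -> rU [set x; y] = 2 /\ dual_rank rU [set x; y] = 2.
  move=> xy; have c : #|[set x; y]| = 2 by rewrite cards2 xy.
  have := con1 [set x; y] 2 isT; have := coU _ (smallpair _ (eq_leq c)).1.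
  have := rk_lam RU [set x; y]; have := rk_card RU [set x; y].
  have := rk_card RU' [set x; y]; rewrite c; nlia.
have loop' (x : subground E') : x \in F' -> 0 < rho' [set x].
  by rewrite inE => xF; rewrite /rho' lift1; apply: rho_loop.
have coloop' (x : subground E') : x \in F' -> rho' F' <= rho' (F' :\ x).
  rewrite inE => xF; rewrite /rho' liftF setDE liftI liftF liftC lift1.
  have -> : F :&: (E' :\: [set elt x]) = F :\ elt x by clear -FE'; set_solve.
  exact: rho_coloop.
have toC (C' : {set subground E'}) : realizes F' rU rho' C' ->
    [/\ lift C' :|: G \subset E :\: F, G \subset lift C' :|: G,
        D \subset ~: (lift C' :|: G) &
        forall W, W \subset F -> rho W + r (lift C' :|: G) = r (W :|: (lift C' :|: G))].
  case=> CF h.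
  have lF : lift C' \subset ~: F.
    apply/subsetP => y /mem_liftP[x xC ->]; have := subsetP CF x xC.
    by rewrite !inE.
  have lE := liftE C'; split.
  - by clear -lF lE GE E1; set_solve.
  - exact: subsetUr.
  - by clear -lE DX DG E1; set_solve.
  move=> W WF; have WE := subset_trans WF FE'.
  have sW : restr E' W \subset F'.
    by apply/subsetP => x; rewrite !inE; apply: (subsetP WF).
  have := h _ sW; rewrite /rho' lift_restr //.
  have := rUE C'; have := rUE (restr E' W :|: C'); rewrite liftU lift_restr // -setUA.
  by nlia.
have exR : exists C : {set subground E'}, realizes F' rU rho' C.
  exists (restr E' C0); split.
    apply/subsetP => x; rewrite !inE => xC; have := subsetP C0E _ xC.
    by rewrite inE => /andP[].
  have eC0 : lift (restr E' C0) :|: G = C0.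
    have -> : restr E' C0 = restr E' (C0 :&: E').
      by apply/setP => x; rewrite !inE (eltP x) andbT.
    rewrite lift_restr ?subsetIr //.
    by clear -XDG C0E GC0 DC0 E1 E2; set_solve.
  move=> W WF; have lWF : lift W \subset F by rewrite -liftF; apply: liftS.
  have := hC0 _ lWF; rewrite -{1 2}eC0.
  have := rUE (restr E' C0); have := rUE (W :|: restr E' C0); rewrite liftU -setUA /rho'.
  by nlia.
have [mn mn'] := minor_both RU RU' rank1 rank2 loop' coloop' exR.
have su : setup (conn rU) small P F' rU (dual_rank rU)
            (deletable F' rU rho') (contractible F' rU rho').
  split=> //.
  - by move=> A; apply: con1.
  - by move=> A; apply: con1.
  - by move=> A [].
  - move=> A lA; have lA' : lam (lift A :|: X) < theta by have := lam_ge A; nlia.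
    have AE : lift A :|: X \subset E.
      by have lE := liftE A; clear -XE lE E1; set_solve.
    have lcA : conn rU (~: A) = conn rU A by rewrite /conn setCK addnC.
    case: (tg_or tg AE lA') => AT; [by left | right].
    split; last by rewrite lcA.
    have eC : E :\: (lift A :|: X) = lift (~: A) by rewrite liftC; clear -E1 E2; set_solve.
    rewrite eC in AT; apply: (tgU tg AT XT).
    by have := lam_ge (~: A); rewrite lcA; nlia.
  - move=> A B C [AT _] [BT _] [CT _] e; apply: (tg_cover tg AT BT CT).
    have -> : (lift A :|: X) :|: (lift B :|: X) :|: (lift C :|: X) =
              lift (A :|: B :|: C) :|: X by rewrite !liftU; clear; set_solve.
    by rewrite e liftT; clear -XE E1 E2; set_solve.
  (* Two elements of [P] in [S] give [S :&: P] connectivity at least 2, so [S :|: P] still has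
     connectivity at most [m], against the maximality of [P]. *)
  move=> S x [ST lS] xS xP; rewrite leqNgt; apply/negP => c.
  have c2 : 1 < #|~: (S :&: P)|.
    have := coU _ ST; have : ~: S \subset ~: (S :&: P) by clear; set_solve.
    by move/subset_leq_card; nlia.
  have l2 := con1 _ 2 isT c c2; have := conn_sub S P RU RU' => sb.
  have lU : conn rU (S :|: P) <= m by nlia.
  have eSP : (lift S :|: X) :|: (lift P :|: X) = lift (S :|: P) :|: X.
    by rewrite liftU; clear; set_solve.
  have QU : Q (S :|: P).
    apply/and3P; split=> //; first exact: subset_trans YsP (subsetUr _ _).
    rewrite -eSP; apply: (tgU tg ST PT); rewrite eSP.
    by have := lam_ge (S :|: P); move: lU; rewrite /m; nlia.
  have := Pmax _ QU (subsetUr _ _) => e.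
  by rewrite -e inE xS in xP.
have [e eP] : exists e : subground E', e \notin P.
  have : 0 < #|~: P| by have := coU _ PT; nlia.
  by case/card_gt0P=> e; rewrite inE => eP; exists e.
have [f fP hf] := single_step su eP.
have gE : elt f \in E' := eltP f.
have gX : elt f \notin X by have := subsetP E1 _ gE; rewrite inE => /andP[].
have gF : elt f \notin F.
  by apply: contra fP => fF; apply: (subsetP F'P); rewrite inE.
exists (elt f); split.
- by have := subsetP E1 _ gE; rewrite !inE !negb_or gF => /andP[-> ->].
(* A member [Y] violating freeness is uncrossed with [Ys]: the intersection has connectivity at
   least [m], so the union has at most [m], and maximality puts the new element inside [Ys]. *)
- move=> Y YT; rewrite cardsU1 gX => FY; rewrite leqNgt; apply/negP => lY.
  have FXY : F :|: X \subset Y by clear -FY; set_solve.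
  have lY' : lam Y <= m by rewrite /m; nlia.
  have lI : m <= lam (Y :&: Ys).
    rewrite leqNgt; apply/negP => lt.
    have IT : Y :&: Ys \in Tg.
      by apply: (tgS tg YT (subsetIl _ _)); move: lt; rewrite /m; nlia.
    have := free _ IT; rewrite subsetI FXY FYs => /(_ isT).
    by move: lt; rewrite /m; nlia.
  have lU : lam (Y :|: Ys) <= m by have := em_lam_sub R R' Y Ys; nlia.
  have QU : [&& F :|: X \subset Y :|: Ys, Y :|: Ys \in Tg & lam (Y :|: Ys) <= m].
    apply/and3P; split=> //; first exact: subset_trans FXY (subsetUl _ _).
    by apply: (tgU tg) => //; move: lU; rewrite /m; nlia.
  have e1 := Ysmax _ QU (subsetUr _ _).
  case/negP: fP; apply: (subsetP YsP); rewrite inE -e1 inE.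
  by rewrite (subsetP FY) // !inE eqxx !orbT.
have gD : elt f \notin D by apply: contra gX; apply: (subsetP DX).
have gG : elt f \notin G by apply: contra gX; apply: (subsetP GX).
have gEE : elt f \in E by have := subsetP E1 _ gE; rewrite inE => /andP[].
have liftfC (A : {set subground E'}) : lift (~: (f |: A)) = E' :\: (elt f |: lift A).
  by rewrite liftC liftU lift1.
have card_co A : A \subset E :\: (elt f |: X) ->
    [/\ A \subset E', lift (restr E' A) = A, f \notin restr E' A,
        #|restr E' A| = #|A| & #|~: (f |: restr E' A)| = #|E :\: (elt f |: X) :\: A|].
  move=> AE; have AE' : A \subset E' by clear -AE E2; set_solve.
  have eA := lift_restr AE'; split=> //.
  - by rewrite inE; apply/negP => /(subsetP AE); rewrite !inE eqxx.
  - by rewrite -card_lift eA.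
  - rewrite -card_lift liftfC eA; congr (#|pred_of_set _|).
    by clear -E1 E2; set_solve.
case: hf => [[[_ [C' rC' fC']] nt]|[[C' rC' fC'] nt]].
  left; split; last first.
    have [h1 h2 h3 h4] := toC _ rC'; exists (lift C' :|: G); split=> //.
    by rewrite subUset h3 andbT sub1set in_setC in_setU negb_or gG andbT mem_lift.
  move=> k A k3; have -> : (elt f |: D) :|: G = elt f |: X by rewrite EX setUA.
  move=> AE cA cB; have [AE' eA fA c1 c2] := card_co _ AE.
  have := no_tri_conn su nt k3 fA; rewrite c1 c2 => /(_ cA cB).
  have := rUE (~: [set f]); have := rUE (restr E' A); have := rUE (~: (f |: restr E' A)).
  rewrite liftfC liftC lift1 eA.
  have -> : (E' :\: [set elt f]) :|: G = E :\: (elt f |: D).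
    rewrite coE ?sub1set //; clear; set_solve.
  have -> : (E' :\: (elt f |: A)) :|: G = E :\: (elt f |: D) :\: A.
    rewrite coE ?subUset ?sub1set ?gE //; clear; set_solve.
  by nlia.
right; split; last first.
  have [h1 h2 h3 h4] := toC _ rC'; exists (lift C' :|: G); split=> //.
  by rewrite subUset h2 sub1set inE mem_lift fC'.
move=> k A k3; have -> : D :|: (elt f |: G) = elt f |: X by rewrite EX setUCA.
move=> AE cA cB; have [AE' eA fA c1 c2] := card_co _ AE.
have := no_tri_conn (setup_flip su) nt k3 fA; rewrite c1 c2 => /(_ cA cB).
have := rk_dual RU (~: [set f]); have := rk_dual RU (restr E' A).
have := rk_dual RU (~: (f |: restr E' A)); rewrite !setCK.
have := rUE [set f]; have := rUE (~: restr E' A); have := rUE (f |: restr E' A).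
have := rUE setT; rewrite liftT E'G liftC liftU lift1 eA coE //.
have -> : (elt f |: A) :|: G = A :|: (elt f |: G) by clear; set_solve.
have : #|~: [set f]| = #|restr E' A| + #|~: (f |: restr E' A)|.
  have := cardsC [set f]; have := cardsC (f |: restr E' A).
  by rewrite cardsU1 fA cards1; nlia.
by nlia.
Qed.

End Step.

(** * Undoing removals of one kind *)

Lemma subset_card (T : finType) (A : {set T}) k : k <= #|A| ->
  exists2 K : {set T}, K \subset A & #|K| = k.
Proof.
have [n] := ubnP #|A|; elim: n A => // n IHn A; rewrite ltnS => cA kA.
have [e|ne] := eqVneq k #|A|; first by exists A.
have lt : k < #|A| by lia.
have /card_gt0P[x xA] : 0 < #|A| by nlia.
have cx := cardsD1 x A; rewrite xA in cx.
have [||K KA cK] := IHn (A :\ x); [nlia | nlia |].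
by exists K => //; apply: subset_trans KA (subD1set _ _).
Qed.

(** * A forest of conflicts *)

Section Forest.
Variables (T : finType) (D G : {set T}) (tau : T -> nat) (a : pred T) (p : T -> T).
Hypothesis DG : D \subset ~: G.
Let X := D :|: G.
Implicit Types K Z : {set T}.
Hypothesis later : forall v, v \in X -> a v -> tau v < tau (p v).
Hypothesis pD : forall v, v \in G -> a v -> p v \in D.
Hypothesis pG : forall v, v \in D -> a v -> p v \in G.

Let B := (\max_(v in X) tau v).+1.

(** Following [p] strictly increases [tau], which stays below [B]; fuel [B - tau v] therefore never
    runs out before a root. *)
Fixpoint depth_fuel n v :=
  if n is n'.+1 then if a v then (depth_fuel n' (p v)).+1 else 0 else 0.
Definition depth v := depth_fuel (B - tau v) v.

Lemma tauB v : v \in X -> tau v < B.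
Proof. by move=> vX; rewrite ltnS; apply: (leq_bigmax_cond (F := tau)). Qed.

Lemma pX v : v \in X -> a v -> p v \in X.
Proof. by rewrite !inE => /orP[] h av; rewrite ?(pG h av) ?(pD h av) ?orbT. Qed.

Lemma depth_stable n m v : v \in X -> B <= n + tau v -> B <= m + tau v ->
  depth_fuel n v = depth_fuel m v.
Proof.
elim: n m v => [|n IHn] [|m] v vX hn hm //=; have tv := tauB vX; try by nlia.
case: ifP => // av; congr _.+1; have := later vX av => lt.
apply: IHn; [exact: pX | nlia | nlia].
Qed.

Lemma depth_step v : v \in X -> a v -> depth v = (depth (p v)).+1.
Proof.
move=> vX av; rewrite /depth; have tv := tauB vX; have lt := later vX av.
have -> : B - tau v = (B - tau v).-1.+1 by nlia.
by rewrite /= av; congr _.+1; apply: depth_stable; [exact: pX | nlia | nlia].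
Qed.

(** [K] stays removed. An active vertex [z] is harmless if its chosen partner is outside [K], or if
    some child is, the child being a partner of [z] by symmetry of conflicts. *)
Definition keepable (K Z : {set T}) := forall z, z \in Z -> a z ->
  p z \notin K \/ exists c, [/\ c \in X, a c, p c = z & c \notin K].

Definition leaves := [set v in X | ~~ [exists c in X, a c && (p c == v)]].

Lemma notleaf z : z \in X -> z \notin leaves ->
  exists c, [/\ c \in X, a c & p c = z].
Proof.
move=> zX; rewrite inE zX negbK => /existsP[c /andP[cX /andP[ac /eqP e]]].
by exists c.
Qed.

Lemma p_notleaf z : z \in X -> a z -> p z \notin leaves.
Proof.
move=> zX az; rewrite inE negb_and negbK; apply/orP; right.
by apply/existsP; exists z; rewrite zX az eqxx.
Qed.

(** Every child of such a vertex has a child of its own, the escape used two levels below. *)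
Definition upper := [set v in X | (v \notin leaves) && (v \notin p @: leaves)].

Lemma keep_leaves K Z : Z \subset X -> K \subset leaves -> keepable K Z.
Proof.
move=> ZX KL z zZ az; left; apply: contra (p_notleaf (subsetP ZX _ zZ) az).
exact: (subsetP KL).
Qed.

(* Two steps up the forest change the parity of [depth ./2]. *)
Lemma keep_upper (b : bool) K Z : Z \subset X ->
  K \subset [set v in upper | odd (depth v)./2 == b] -> keepable K Z.
Proof.
move=> ZX KU z zZ az; have zX := subsetP ZX _ zZ.
case: (boolP (p z \in K)) => pK; [right|by left].
have := subsetP KU _ pK; rewrite !inE => /andP[/andP[pX' /andP[_ pN]] /eqP hb].
have zL : z \notin leaves by apply: contra pN => zL; apply: imset_f.
have [c [cX ac e]] := notleaf zX zL; exists c; split=> //.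
apply/negP => cK; have := subsetP KU _ cK; rewrite !inE => /andP[_ /eqP].
rewrite (depth_step cX ac) e (depth_step zX az) /= hb.
by case: b {KU hb}.
Qed.

(** If neither side has [k] leaves, leaves and their parents number at most [4k - 4], which leaves
    at least [4k - 3] vertices in [upper]. Side and parity of [(depth v)./2] divide these into four
    classes, one of which has [k] elements. *)
Lemma forest_keep k : 0 < k -> 10 * k - 6 <= #|X| ->
  (exists K, [/\ #|K| = k, K \subset D & keepable K G]) \/
  (exists K, [/\ #|K| = k, K \subset G & keepable K D]).
Proof.
move=> k0 cX; have DX : D \subset X by apply: subsetUl.
have GX : G \subset X by apply: subsetUr.
have split_card (A : {set T}) : A \subset X -> #|A| = #|A :&: D| + #|A :&: G|.
  move=> AX; have := cardsUI (A :&: D) (A :&: G).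
  have -> : (A :&: D) :&: (A :&: G) = set0 by clear -DG; set_solve.
  have -> : (A :&: D) :|: (A :&: G) = A by rewrite /X in AX; clear -AX; set_solve.
  by rewrite cards0; nlia.
have LX : leaves \subset X by apply/subsetP => v; rewrite inE => /andP[].
case: (leqP k #|leaves :&: D|) => cLD.
  have [K KL cK] := subset_card cLD; left; exists K; split=> //.
    exact: subset_trans KL (subsetIr _ _).
  by apply: keep_leaves GX _; apply: subset_trans KL (subsetIl _ _).
case: (leqP k #|leaves :&: G|) => cLG.
  have [K KL cK] := subset_card cLG; right; exists K; split=> //.
    exact: subset_trans KL (subsetIr _ _).
  by apply: keep_leaves DX _; apply: subset_trans KL (subsetIl _ _).
have cU : 4 * k - 3 <= #|upper|.
  have : X \subset upper :|: (leaves :|: p @: leaves).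
    apply/subsetP => v vX; rewrite !in_setU.
    case: (boolP (v \in leaves)) => vL; first by rewrite orbT.
    case: (boolP (v \in p @: leaves)) => vP; first by rewrite !orbT.
    by rewrite in_set vX vL vP.
  move/subset_leq_card; have := cardsUI upper (leaves :|: p @: leaves).
  have := cardsUI leaves (p @: leaves); have := leq_imset_card p leaves.
  have := split_card _ LX; nlia.
pose cls b := [set v in upper | odd (depth v)./2 == b].
have clsX b : cls b \subset X by apply/subsetP => v; rewrite !inE => /andP[/andP[]].
have cc : #|upper| = #|cls true| + #|cls false|.
  have := cardsUI (cls true) (cls false).
  have -> : cls true :&: cls false = set0.
    by apply/setP => v; rewrite !inE; case: odd; rewrite ?andbF ?andbT.
  have -> : cls true :|: cls false = upper.
    by apply/setP => v; rewrite !inE; case: odd; rewrite ?andbF ?andbT ?orbF.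
  by rewrite cards0; nlia.
have := split_card _ (clsX true); have := split_card _ (clsX false) => c1 c2.
have fin b : k <= #|cls b :&: D| \/ k <= #|cls b :&: G| ->
    (exists K, [/\ #|K| = k, K \subset D & keepable K G]) \/
    (exists K, [/\ #|K| = k, K \subset G & keepable K D]).
  case=> /subset_card[K KC cK]; [left|right]; exists K; split=> //.
  - exact: subset_trans KC (subsetIr _ _).
  - by apply: (@keep_upper b) GX _; apply: subset_trans KC (subsetIl _ _).
  - exact: subset_trans KC (subsetIr _ _).
  - by apply: (@keep_upper b) DX _; apply: subset_trans KC (subsetIl _ _).
have : (k <= #|cls true :&: D| \/ k <= #|cls true :&: G|) \/
       (k <= #|cls false :&: D| \/ k <= #|cls false :&: G|) by nlia.
by case; apply: fin.
Qed.

End Forest.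

(** * When putting elements back preserves 3-connectivity *)

Section Select.
Variables (T : finType) (E : {set T}).
Implicit Types (A B C D G K S V W X Y Z : {set T}) (c d e f x y z w : T).

Lemma conn3_flip lam r s D C : emat E lam r s -> emat E lam s r ->
  D \subset E -> C \subset E -> D \subset ~: C ->
  conn3 E r D C -> conn3 E s C D.
Proof.
move=> R R' DE CE DC c3 k A k3; rewrite setUC => AE cA cB.
have := c3 k A k3 AE cA cB.
have := em_dual R (E :\: C); have := em_dual R D; have := em_dual R (A :|: D).
have := em_dual R (E :\: C :\: A).
have -> : E :\: (E :\: C) = C by set_solve.
have -> : E :\: (E :\: C :\: A) = A :|: C by set_solve.
have -> : E :\: (A :|: D) = E :\: D :\: A by set_solve.
have -> : D :&: E = D by apply/setIidPl.
have -> : (E :\: C) :&: E = E :\: C by set_solve.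
have -> : (E :\: C :\: A) :&: E = E :\: C :\: A by set_solve.
have -> : (A :|: D) :&: E = A :|: D by set_solve.
have := cardsUI A D; have -> : A :&: D = set0 by set_solve.
have := cardsID A (E :\: C); have -> : (E :\: C) :&: A = A by set_solve.
rewrite cards0; nlia.
Qed.

(* [z] and [w] are in series in [M \ D]; [breaks] says that [d] belongs to the
   cocircuit of [M] responsible for it. *)
Definition active (r : {set T} -> nat) D G z w :=
  [/\ z \in G, w \in E :\: (D :|: G) & r (E :\: D :\: [set z; w]) < r E].

Definition breaks (r : {set T} -> nat) D z w d :=
  d \in D /\ r (d |: (E :\: D :\: [set z; w])) = r E.

Section Half.
Variables (lam r s : {set T} -> nat).
Hypotheses (R : emat E lam r s) (R' : emat E lam s r).
Variables (theta : nat) (Tg : {set {set T}}).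
Hypothesis tg : tangle E lam theta Tg.
Variables (D G : {set T}).
Let X := D :|: G.
Hypotheses (XE : X \subset E) (DG : D \subset ~: G).
Hypothesis indep : forall X' Y, X' \subset X -> Y \in Tg -> X' \subset Y ->
  #|X'| <= lam Y.
Hypothesis cM : conn3 E r set0 set0.
Hypothesis cN : conn3 E r D G.
Hypothesis cX : #|X| + 3 <= theta.

Let XT : X \in Tg. Proof. by apply: (tg_small R R' tg) => //; nlia. Qed.
Let DX : D \subset X. Proof. exact: subsetUl. Qed.
Let GX : G \subset X. Proof. exact: subsetUr. Qed.

Lemma big_co Z : Z \subset E -> #|Z| <= 2 -> theta <= #|E :\: X :\: Z|.
Proof.
move=> ZE cZ; have ZT : Z \in Tg by apply: (tg_small R R' tg) => //; nlia.
by have := tg_co_card R R' tg XT ZT; rewrite setDDl.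
Qed.

(** Independence in the tangle matroid gives [X'] connectivity [#|X'|], so it is both independent
    and coindependent. *)
Lemma sel_rank X' : X' \subset X -> r X' = #|X'| /\ s X' = #|X'|.
Proof.
move=> sX; have c := subset_leq_card sX.
have XE' := subset_trans sX XE.
have T' : X' \in Tg by apply: (tg_small R R' tg) => //; nlia.
have := indep sX T' (subxx _); have := em_lam R X'.
have -> : X' :&: E = X' by apply/setIidPl.
have := em_card R X'; have := em_card R' X'; nlia.
Qed.

Lemma sel_co X' : X' \subset X -> r (E :\: X') = r E.
Proof.
move=> sX; have := em_dual R X'; rewrite (sel_rank sX).2.
have -> : X' :&: E = X' by apply/setIidPl; apply: subset_trans XE.
by nlia.
Qed.

Lemma sel_no_coloop w : w \in E :\: X -> r (E :\: D :\ w) = r E.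
Proof.
move=> wE; have wE1 : [set w] \subset E :\: X by rewrite sub1set.
have := cN (k := 1) (A := [set w]) isT wE1; rewrite cards1 => /(_ isT).
have c3 : 1 <= #|E :\: X :\ w|.
  have wEE : [set w] \subset E by clear -wE1; set_solve.
  by have := big_co wEE; rewrite cards1 => /(_ isT); nlia.
move=> /(_ c3); have := em_add R w G; have := sel_co DX.
have : r (E :\: D :\ w) <= r E by apply: (em_mono R); clear; set_solve.
by nlia.
Qed.

Lemma sel_no_series w w' : w != w' -> w \in E :\: X -> w' \in E :\: X ->
  r (E :\: D :\: [set w; w']) = r E.
Proof.
move=> ww wE wE'; have wE1 : [set w; w'] \subset E :\: X by rewrite subUset !sub1set wE.
have := cN (k := 2) (A := [set w; w']) isT wE1; rewrite cards2 ww => /(_ isT).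
have c3 : 2 <= #|E :\: X :\: [set w; w']|.
  have wEE : [set w; w'] \subset E by clear -wE1; set_solve.
  by have := big_co wEE; rewrite cards2 ww => /(_ isT); nlia.
move=> /(_ c3); have := em_U R [set w; w'] G; have := em_card R [set w; w'].
rewrite cards2 ww; have := sel_co DX.
have : r (E :\: D :\: [set w; w']) <= r E by apply: (em_mono R); clear; set_solve.
by nlia.
Qed.

(** Being in series is transitive: two partners of [z] would be in series in [M \ D], although both
    lie in the ground set of the 3-connected minor. *)
Lemma active_uniq z w w' : active r D G z w -> active r D G z w' -> w = w'.
Proof.
move=> [zG wE h] [_ wE' h']; apply/eqP/negPn/negP => ww.
have := sel_no_series ww wE wE'.
have zX : D :|: [set z] \subset X by rewrite subUset DX sub1set (subsetP GX).
have := sel_co zX; have := em_sub R (E :\: D :\: [set z; w]) (E :\: D :\: [set z; w']).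
have -> : (E :\: D :\: [set z; w]) :|: (E :\: D :\: [set z; w']) = E :\: (D :|: [set z]).
  by clear -ww; set_solve.
have : r (E :\: D :\: [set w; w']) <=
       r (z |: ((E :\: D :\: [set z; w]) :&: (E :\: D :\: [set z; w']))).
  by apply: (em_mono R); clear; set_solve.
have := em_add R z ((E :\: D :\: [set z; w]) :&: (E :\: D :\: [set z; w'])).
by nlia.
Qed.

Lemma active_span z w : active r D G z w -> r E <= r (E :\: D :\: [set z; w]) + 1.
Proof.
case=> zG wE h; have zX : D :|: [set z] \subset X.
  by rewrite subUset DX sub1set (subsetP GX).
have := sel_co zX; have := em_add R w (E :\: D :\: [set z; w]).
have : r (E :\: (D :|: [set z])) <= r (w |: (E :\: D :\: [set z; w])).
  by apply: (em_mono R); clear; set_solve.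
by nlia.
Qed.

(** If all elements of [D] outside [D2] were spanned by the hyperplane [H0], the pair [{z, w}] would
    still be in series in [M \ D2 / G2]. Applied to the minor from which [z] was removed, this
    produces a partner removed after [z]. *)
Lemma active_later z w D2 G2 : active r D G z w -> D2 \subset D -> G2 \subset G ->
  z \notin G2 -> conn3 E r D2 G2 -> exists2 d, breaks r D z w d & d \notin D2.
Proof.
move=> ac D2D G2G zG2 c2; apply: NNPP => no.
have [zG wE h] := ac; have sp := active_span ac.
have [H0 EH] : exists H0, H0 = E :\: D :\: [set z; w] by exists (E :\: D :\: [set z; w]).
have [wE' wX] : w \in E /\ w \notin X by move: wE; rewrite inE => /andP[].
have zX := subsetP GX _ zG; have zE := subsetP XE _ zX.
have zw : z != w by apply: contraNneq wX => <-.
have cl V : V \subset D :\: D2 -> r (V :|: H0) = r H0.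
  have [n] := ubnP #|V|; elim: n V => // n IHn V; rewrite ltnS => cV VD.
  have [->|[d dV]] := set_0Vmem V; first by rewrite set0U.
  have cd := cardsD1 d V; rewrite dV in cd.
  have V'D : V :\ d \subset D :\: D2 by apply: subset_trans VD; apply: subD1set.
  have e1 := IHn (V :\ d) _ V'D.
  have dD : d \in D :\: D2 := subsetP VD _ dV.
  have e2 : r (d |: H0) = r H0.
    have := em_add R d H0; have : r (d |: H0) <> r E.
      move=> e; apply: no; exists d; last by move: dD; rewrite inE => /andP[].
      by split; [move: dD; rewrite inE => /andP[] | rewrite -EH].
    have : r (d |: H0) <= r E.
      rewrite -(em_cap R (d |: H0)); apply: (em_mono R); apply: subsetIr.
    by rewrite EH; rewrite -EH in sp h *; nlia.
  rewrite -(setD1K dV) -setUA.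
  rewrite (em_cl R (X := H0)) ?subsetUr // e1 //; nlia.
have := cl _ (subxx _).
have -> : (D :\: D2) :|: H0 = E :\: D2 :\: [set z; w].
  rewrite EH; have DE := subset_trans DX XE.
  have zD : z \notin D by apply/negP => /(subsetP DG); rewrite inE zG.
  have wD : w \notin D by apply: contra wX; apply: (subsetP DX).
  by clear -D2D DE zD wD; set_solve.
move=> e; have zwE : [set z; w] \subset E :\: (D2 :|: G2).
  have zD : z \notin D by apply/negP => /(subsetP DG); rewrite inE zG.
  have wD : w \notin D by apply: contra wX; apply: (subsetP DX).
  have wG : w \notin G by apply: contra wX; apply: (subsetP GX).
  rewrite subUset !sub1set !inE zE wE' !andbT !negb_or zG2 andbT.
  rewrite (contra (subsetP D2D z)) // (contra (subsetP D2D w)) //.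
  by rewrite (contra (subsetP G2G w)).
have := c2 2 _ isT zwE; rewrite cards2 zw => /(_ isT).
have c3 : 2 <= #|E :\: (D2 :|: G2) :\: [set z; w]|.
  have zwEE : [set z; w] \subset E by clear -zwE; set_solve.
  have : E :\: X :\: [set z; w] \subset E :\: (D2 :|: G2) :\: [set z; w].
    by rewrite /X; clear -D2D G2G; set_solve.
  move/subset_leq_card; have := big_co zwEE; rewrite cards2 zw => /(_ isT); nlia.
move=> /(_ c3); rewrite e.
have := em_U R [set z; w] G2; have := em_card R [set z; w]; rewrite cards2 zw.
have D2X : D2 \subset X by apply: subset_trans DX.
by rewrite -EH in h; rewrite (sel_co D2X); nlia.
Qed.

Lemma sel_conn K : K \subset D ->
  (forall z w, active r D G z w -> exists2 d, breaks r D z w d & d \notin K) ->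
  conn3 E r K set0.
Proof.
move=> KD br k A k3; rewrite !setU0 => AE cA cB.
have r0 : r set0 = 0 by have := em_card R set0; rewrite cards0; nlia.
rewrite r0 addn0 leqNgt; apply/negP => lt.
have KX := subset_trans KD DX.
have rK := sel_co KX; have rD := sel_co DX.
(* If [Z] has fewer than [k] elements outside [X], then [Z :|: K] is in the tangle, and independence
   of [X] bounds [Z :&: X] below [k] too. So [k = 2] and [Z] is a pair [{z, w}] with only [z] in
   [X]: for [z] in [D] the element [w] would be a coloop of [M \ D], for [z] in [G] a breaker
   outside [K] restores the rank. *)
have key Z : Z \subset E :\: K -> k <= #|Z| ->
    r Z + r (E :\: K :\: Z) < r (E :\: K) + k -> #|Z :\: X| < k -> False.
  move=> ZE cZ ltZ cZX.
  have cZK : #|Z :|: K| <= #|Z :\: X| + #|X|.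
    have : Z :|: K \subset (Z :\: X) :|: X by clear -KX; set_solve.
    by move/subset_leq_card; have := cardsUI (Z :\: X) X; nlia.
  have ZKE : Z :|: K \subset E by clear -ZE KX XE; set_solve.
  have ZKT : Z :|: K \in Tg by apply: (tg_small R R' tg) => //; nlia.
  have X'X : (Z :&: X) :|: K \subset X by clear -KX; set_solve.
  have X'Z : (Z :&: X) :|: K \subset Z :|: K by clear; set_solve.
  have := indep X'X ZKT X'Z.
  have := cardsUI (Z :&: X) K.
  have -> : (Z :&: X) :&: K = set0 by clear -ZE; set_solve.
  have := em_lamE R (Z :|: K); have := em_U R Z K; have := em_card R K.
  have -> : E :\: (Z :|: K) = E :\: K :\: Z by clear; set_solve.
  have cID := cardsID X Z.
  rewrite cards0 => i1 i2 i3 i4 i5.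
  have [k2 [c1 c2]] : k = 2 /\ #|Z :&: X| = 1 /\ #|Z :\: X| = 1 by nlia.
  have /cards1P[z ez] : #|Z :&: X| == 1 by rewrite c1.
  have /cards1P[w ew] : #|Z :\: X| == 1 by rewrite c2.
  have [zZ zX] : z \in Z /\ z \in X.
    by have : z \in Z :&: X by [rewrite ez set11]; rewrite inE => /andP[].
  have [wZ wX] : w \in Z /\ w \notin X.
    by have : w \in Z :\: X by [rewrite ew set11]; rewrite inE => /andP[].
  have eZ : Z = [set z; w] by rewrite -(setID Z X) ez ew.
  have zw : z != w by apply: contraNneq wX => <-.
  have wE : w \in E by have := subsetP ZE _ wZ; rewrite inE => /andP[].
  have wEX : w \in E :\: X by rewrite inE wX.
  have rZ : 2 <= r Z.
    have ZE0 : Z \subset E :\: (set0 :|: set0).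
      by rewrite setU0 setD0; apply: subset_trans ZE (subsetDl _ _).
    have := cM (k := 2) isT ZE0; rewrite !setU0 !setD0 eZ cards2 zw => /(_ isT).
    have zwE : [set z; w] \subset E by rewrite -eZ; apply: subset_trans ZE (subsetDl _ _).
    have c3 : 2 <= #|E :\: [set z; w]|.
      have : E :\: X :\: [set z; w] \subset E :\: [set z; w] by clear; set_solve.
      move/subset_leq_card; have := big_co zwE; rewrite cards2 zw => /(_ isT); nlia.
    move=> /(_ c3); have : r (E :\: [set z; w]) <= r E.
      by apply: (em_mono R); apply: subsetDl.
    by nlia.
  have ltE : r (E :\: K :\: [set z; w]) < r E by rewrite -eZ; nlia.
  case: (boolP (z \in D)) => zD.
    have : r (E :\: D :\ w) <= r (E :\: K :\: [set z; w]).
      by apply: (em_mono R); clear -KD zD; set_solve.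
    by rewrite (sel_no_coloop wEX); nlia.
  have zG : z \in G by move: zX; rewrite inE (negbTE zD).
  have ac : active r D G z w.
    split=> //; apply: leq_ltn_trans ltE; apply: (em_mono R).
    by clear -KD; set_solve.
  have [d [dD rd] dK] := br _ _ ac.
  have dz : d != z by apply: contraNneq zD => <-.
  have dw : d != w by apply: contraNneq wX => <-; apply: (subsetP DX).
  have dE : d \in E by apply: (subsetP XE); apply: (subsetP DX).
  have : r (d |: (E :\: D :\: [set z; w])) <= r (E :\: K :\: [set z; w]).
    by apply: (em_mono R); clear -KD dz dw dE dK; set_solve.
  by nlia.
pose B := E :\: K :\: A.
have eBA : E :\: K :\: B = A by rewrite /B; clear -AE; set_solve.
have AX : A :\: X \subset E :\: (D :|: G) by rewrite /X; clear -AE; set_solve.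
have eBX : E :\: (D :|: G) :\: (A :\: X) = B :\: X.
  by rewrite /B /X; clear -KD; set_solve.
case: (ltnP #|A :\: X| k) => cAX; first exact: (key A).
case: (ltnP #|B :\: X| k) => cBX.
  by apply: (key B) => //; [apply: subsetDl | rewrite eBA addnC].
(* Both sides keep [k] elements outside [X], so the separation descends to [M \ D / G]. Each element
   of the independent set [G] is charged once, to the side opposite its own, and these charges
   cancel [r G]. *)
have := cN k3 AX cAX; rewrite eBX => /(_ cBX).
have GE := subset_trans GX XE.
have KG : K \subset ~: G by apply: subset_trans DG.
have -> : (A :\: X) :|: G = (A :\: D) :|: (G :&: B).
  by rewrite /B /X; clear -AE GE KG DG; set_solve.
have -> : E :\: D :\: (A :\: X) = (B :\: D) :|: (G :&: A).
  by rewrite /B /X; clear -AE GE KD KG DG; set_solve.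
have u1 := em_U R (A :\: D) (G :&: B); have u2 := em_U R (B :\: D) (G :&: A).
have c1 := em_card R (G :&: B); have c2 := em_card R (G :&: A).
have m1 := em_mono R (subsetDl A D); have m2 := em_mono R (subsetDl B D).
have := (sel_rank GX).1; have := cardsUI (G :&: A) (G :&: B).
have -> : (G :&: A) :|: (G :&: B) = G by rewrite /B; clear -GE KG; set_solve.
have -> : (G :&: A) :&: (G :&: B) = set0 by rewrite /B; clear; set_solve.
rewrite cards0 -/B in lt *; nlia.
Qed.

(** Because [z] breaks the parallel pair of [x], it is spanned by [V], that is [G :\ z] with [x] and
    [y]. Since [y != w], [V] lies in the hyperplane of [{z, w}] enlarged by [x]; this set then spans
    [z], hence all of [E :\: D :\ w], which has full rank. *)
Lemma sel_orth z w x y : active r D G z w -> active s G D x y ->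
  breaks s G x y z -> breaks r D z w x.
Proof.
move=> [zG wE lw] [xD yE ly] [_ ez]; split=> //.
rewrite setUC in yE.
have [yE' yX] : y \in E /\ y \notin X by move: yE; rewrite inE => /andP[].
have [wE' wX] : w \in E /\ w \notin X by move: wE; rewrite inE => /andP[].
have xX := subsetP DX _ xD; have zX := subsetP GX _ zG.
have xE := subsetP XE _ xX; have zE := subsetP XE _ zX.
have GE := subset_trans GX XE; have DE := subset_trans DX XE.
have xG : x \notin G by have := subsetP DG _ xD; rewrite inE.
have zD : z \notin D by apply/negP => /(subsetP DG); rewrite inE zG.
have yG : y \notin G by apply: contra yX; apply: (subsetP GX).
have yD : y \notin D by apply: contra yX; apply: (subsetP DX).
have wG : w \notin G by apply: contra wX; apply: (subsetP GX).
have wD : w \notin D by apply: contra wX; apply: (subsetP DX).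
have xy : x != y by apply: contraNneq yX => <-.
have zw : z != w by apply: contraNneq wX => <-.
have zy : z != y by apply: contraNneq yX => <-.
have cX2 : #|X| = #|D| + #|G|.
  have := cardsUI D G; have -> : D :&: G = set0 by clear -DG; set_solve.
  by rewrite cards0 -/X; nlia.
have c2 (Z : {set T}) u v : u \notin Z -> v \notin Z -> u != v ->
    #|Z :|: [set u; v]| = #|Z| + 2.
  move=> uZ vZ uv; have := cardsUI Z [set u; v]; rewrite cards2 uv.
  have -> : Z :&: [set u; v] = set0 by clear -uZ vZ; set_solve.
  by rewrite cards0; nlia.
have rG : r (G :|: [set x; y]) <= #|G| + 1.
  have := em_dual R' (G :|: [set x; y]).
  have -> : (G :|: [set x; y]) :&: E = G :|: [set x; y].
    by clear -GE xE yE'; set_solve.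
  by rewrite setDDl in ly; rewrite c2 //; nlia.
have sD : s (D :|: [set z; w]) <= #|D| + 1.
  have := em_dual R (D :|: [set z; w]).
  have -> : (D :|: [set z; w]) :&: E = D :|: [set z; w].
    by clear -DE zE wE'; set_solve.
  by rewrite setDDl in lw; rewrite c2 //; nlia.
(* If [y = w], both ranks of [y |: X] are at most [#|X|], so its connectivity is below [#|X|],
   against independence of [X] in the tangle matroid. *)
have yw : y != w.
  apply/negP => /eqP yw; rewrite -yw in sD.
  have UE : y |: X \subset E by clear -yE' XE; set_solve.
  have cU : #|y |: X| = #|X| + 1 by rewrite cardsU1 yX addnC.
  have UT : y |: X \in Tg by apply: (tg_small R R' tg) => //; nlia.
  have := indep (subxx X) UT (subsetUr _ _).
  have := em_lam R (y |: X).
  have -> : (y |: X) :&: E = y |: X by apply/setIidPl.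
  have := em_U R (G :|: [set x; y]) (D :\ x); have := em_card R (D :\ x).
  have := em_U R' (D :|: [set z; y]) (G :\ z); have := em_card R' (G :\ z).
  have -> : (G :|: [set x; y]) :|: (D :\ x) = y |: X by rewrite /X; clear -xD; set_solve.
  have -> : (D :|: [set z; y]) :|: (G :\ z) = y |: X by rewrite /X; clear -zG; set_solve.
  by have := cardsD1 x D; have := cardsD1 z G; rewrite xD zG cU; nlia.
have [V EV] : exists V, V = (G :\ z) :|: [set x; y] by exists ((G :\ z) :|: [set x; y]).
have VE : V \subset E by rewrite EV; clear -GE xE yE' zE; set_solve.
have cV : #|V| = #|G| + 1.
  rewrite EV c2 //; first by have := cardsD1 z G; rewrite zG; nlia.
    by rewrite !inE (negbTE xG) andbF.
  by rewrite !inE (negbTE yG) andbF.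
have rV : r (z |: V) = r V.
  have := em_dual R' V; have -> : V :&: E = V by apply/setIidPl.
  have -> : E :\: V = z |: (E :\: G :\: [set x; y]).
    have xz : z != x by apply: contraNneq xG => <-.
    by rewrite EV; clear -xz zy zE; set_solve.
  have -> : z |: V = G :|: [set x; y] by rewrite EV; clear -zG; set_solve.
  have : r V <= r (G :|: [set x; y]) by apply: (em_mono R); rewrite EV; clear; set_solve.
  by rewrite ez cV; nlia.
have VH : V \subset x |: (E :\: D :\: [set z; w]).
  by rewrite EV; clear -GE DG yE' yD zy yw wG; set_solve.
have := em_cl R VH rV; have := sel_no_coloop wE.
have : r (E :\: D :\ w) <= r (z |: (x |: (E :\: D :\: [set z; w]))).
  by apply: (em_mono R); clear; set_solve.
have : r (x |: (E :\: D :\: [set z; w])) <= r E.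
  by apply: (em_mono R); clear -xE; set_solve.
by nlia.
Qed.

End Half.
End Select.

(** * Selection by removal time *)

Section Selection.
Variables (T : finType) (E : {set T}) (theta : nat) (Tg : {set {set T}}) (tau : T -> nat).
Implicit Types (A B C D G K S V W X Y Z : {set T}) (c d e f u v x y z w : T).
Variable (lam : {set T} -> nat).

(** [tau] is the time of removal. [se_before] records for each [v] a 3-connected minor still
    containing [v], in which every other removed element still present is removed later. *)
Record selection (r s : {set T} -> nat) D G : Prop := {
  se_R : emat E lam r s;
  se_R' : emat E lam s r;
  se_tg : tangle E lam theta Tg;
  se_XE : D :|: G \subset E;
  se_DG : D \subset ~: G;
  se_indep : forall X' Y, X' \subset D :|: G -> Y \in Tg -> X' \subset Y ->
    #|X'| <= lam Y;
  se_cM : conn3 E r set0 set0;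
  se_cN : conn3 E r D G;
  se_cX : #|D :|: G| + 3 <= theta;
  se_before : forall v, v \in D :|: G -> exists D2 G2,
    [/\ D2 \subset D, G2 \subset G, v \notin D2 :|: G2, conn3 E r D2 G2 &
        forall u, u \in D :|: G -> u \notin D2 :|: G2 -> u != v -> tau v < tau u]
}.

Lemma selection_flip r s D G : selection r s D G -> selection s r G D.
Proof.
case=> R R' tg XE DG indep cM cN cX before.
have DE : D \subset E by clear -XE; set_solve.
have GE : G \subset E by clear -XE; set_solve.
have UC : G :|: D = D :|: G by rewrite setUC.
split=> //; rewrite ?UC //.
- by clear -DG; set_solve.
- by apply: (conn3_flip R R') cM; rewrite sub0set.
- exact: (conn3_flip R R').
- move=> v /before[D2 [G2 [D2D G2G vN c2 h]]].
  exists G2, D2; rewrite (setUC G2); split=> //.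
  apply: (conn3_flip R R') c2.
  - exact: subset_trans DE.
  - exact: subset_trans GE.
  - by clear -D2D G2G DG; set_solve.
Qed.

Section Side.
Variables (r s : {set T} -> nat) (D G : {set T}).
Hypothesis H : selection r s D G.

Lemma se_later z w : active E r D G z w ->
  exists2 d, breaks E r D z w d & tau z < tau d.
Proof.
move=> ac; have [zG _ _] := ac.
have zX : z \in D :|: G by rewrite inE zG orbT.
have [D2 [G2 [D2D G2G zN c2 h]]] := se_before H zX.
move: zN; rewrite inE negb_or => /andP[zD2 zG2].
have [d [dD rd] dD2] := active_later (se_R H) (se_R' H) (se_tg H) (se_XE H)
  (se_DG H) (se_indep H) (se_cX H) ac D2D G2G zG2 c2.
exists d => //; have dG : d \notin G by have := subsetP (se_DG H) _ dD; rewrite inE.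
apply: h; first by rewrite inE dD.
  by rewrite inE negb_or dD2; apply: contra dG; apply: (subsetP G2G).
by apply: contraNneq dG => ->.
Qed.

(** A partner outside [K] breaks the series pair of [z] directly; a child outside [K] does so by
    [sel_orth]. Uniqueness of [w] identifies the pair behind the chosen partner with the given
    one. *)
Lemma se_keep (a : pred T) (p : T -> T) K : K \subset D ->
  (forall z w, active E r D G z w -> a z) ->
  (forall z, z \in G -> a z -> exists2 w, active E r D G z w & breaks E r D z w (p z)) ->
  (forall x, x \in D -> a x -> exists2 y, active E s G D x y & breaks E s G x y (p x)) ->
  keepable D G a p K G -> conn3 E r K set0.
Proof.
move=> KD aP pG pD keep.
apply: (sel_conn (se_R H) (se_R' H) (se_tg H) (se_XE H) (se_DG H) (se_indep H)
          (se_cM H) (se_cN H) (se_cX H) KD).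
move=> z w ac; have [zG _ _] := ac; have az := aP _ _ ac.
case: (keep z zG az) => [pK|[c [cX acc pc cK]]].
  have [w' ac' br] := pG z zG az.
  have e := active_uniq (se_R H) (se_R' H) (se_tg H) (se_XE H) (se_indep H)
              (se_cN H) (se_cX H) ac ac'.
  by exists (p z) => //; rewrite e.
have cD : c \in D.
  move: cX; rewrite inE => /orP[//|cG]; have [w' _ [pcD _]] := pG c cG acc.
  by have := subsetP (se_DG H) _ pcD; rewrite pc inE zG.
have [y acy br] := pD c cD acc; rewrite pc in br.
exists c => //; exact: (sel_orth (se_R H) (se_R' H) (se_tg H) (se_XE H) (se_DG H)
  (se_indep H) (se_cN H) (se_cX H) ac acy br).
Qed.

End Side.

Lemma select r s D G k : selection r s D G -> 0 < k -> 10 * k - 6 <= #|D :|: G| ->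
  (exists K, [/\ #|K| = k, K \subset D & conn3 E r K set0]) \/
  (exists K, [/\ #|K| = k, K \subset G & conn3 E s K set0]).
Proof.
move=> H k0 cX; have HF := selection_flip H.
(* Later conflict partners for both orientations at once; [epsilon] chooses one as the parent in the
   forest. *)
pose Q v u := ((exists2 w, active E r D G v w & breaks E r D v w u) \/
  (exists2 w, active E s G D v w & breaks E s G v w u)) /\ tau v < tau u.
pose a v : bool := if excluded_middle_informative (exists u, Q v u) then true else false.
pose p v := epsilon (inhabits v) (Q v).
have aQ v : a v -> Q v (p v).
  by rewrite /a; case: excluded_middle_informative => // ex _; apply: epsilon_spec.
have Qa v u : Q v u -> a v.
  by rewrite /a; case: excluded_middle_informative => // no h; case: no; exists u.
have disj v : v \in D -> v \in G -> False.
  by move=> vD vG; have := subsetP (se_DG H) _ vD; rewrite inE vG.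
have pG v : v \in G -> a v -> exists2 w, active E r D G v w & breaks E r D v w (p v).
  by move=> vG /aQ[[//|[w [vD _ _] _]] _]; case: (disj v).
have pD v : v \in D -> a v -> exists2 w, active E s G D v w & breaks E s G v w (p v).
  by move=> vD /aQ[[[w [vG _ _] _]|//] _]; case: (disj v).
have a1 z w : active E r D G z w -> a z.
  by move=> ac; have [d br lt] := se_later H ac; apply: (Qa z d); split=> //; left; exists w.
have a2 z w : active E s G D z w -> a z.
  by move=> ac; have [d br lt] := se_later HF ac; apply: (Qa z d); split=> //; right; exists w.
have [||||] := @forest_keep _ D G tau a p (se_DG H) _ _ _ k k0 cX.
- by move=> v _ /aQ[].
- by move=> v vG av; have [w _ []] := pG v vG av.
- by move=> v vD av; have [w _ []] := pD v vD av.
- case=> K [cK KD keep]; left; exists K; split=> //.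
  exact: (se_keep H KD a1 pG pD keep).
case=> K [cK KG keep]; right; exists K; split=> //.
apply: (se_keep HF KG a2 pD pG) => z zD az.
case: (keep z zD az) => [|[c [cX' ac pc cK']]]; [by left | right].
by exists c; rewrite setUC.
Qed.

End Selection.

(** * Iteration of the removal step *)

Section Iterate.
Variables (T : finType) (E : {set T}).
Implicit Types (A B C D G K S V W X Y Z : {set T}) (c d e f u v x y z w : T).
Variables (lam r s : {set T} -> nat).
Hypotheses (R : emat E lam r s) (R' : emat E lam s r).
Variables (theta : nat) (Tg : {set {set T}}).
Hypothesis tg : tangle E lam theta Tg.
Variables (F : {set T}) (rho : {set T} -> nat) (t : nat).
Hypothesis FE : F \subset E.
Hypothesis rho_loop : forall x, x \in F -> 0 < rho [set x].
Hypothesis rho_coloop : forall x, x \in F -> rho F <= rho (F :\ x).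
Hypothesis F_rank : exists Y, [/\ Y \in Tg, F \subset Y & lam Y <= t].
Hypothesis F_min : forall Y, Y \in Tg -> F \subset Y -> t <= lam Y.
Hypothesis cM : conn3 E r set0 set0.
Hypothesis exC : exists C, minor_via E r F rho set0 set0 C.

(** The last of [n] steps starts with [n - 1] removed elements and needs [t + 2(n - 1) < theta],
    which is the bound on [n]. The element removed at a step gets the largest time so far. *)
Lemma iterate n : t + 2 * n <= theta + 1 -> n + 2 <= theta ->
  exists D G (tau : T -> nat),
  [/\ [/\ D \subset E :\: F, G \subset E :\: F, D \subset ~: G & #|D :|: G| = n],
      conn3 E r D G, tangle_free lam Tg F t (D :|: G),
      exists C, minor_via E r F rho D G C &
      (forall v, v \in D :|: G -> tau v < n) /\
      forall v, v \in D :|: G -> exists D2 G2,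
      [/\ D2 \subset D, G2 \subset G, v \notin D2 :|: G2, conn3 E r D2 G2 &
          forall u, u \in D :|: G -> u \notin D2 :|: G2 -> u != v -> tau v < tau u]].
Proof.
elim: n => [|n IHn] b1 b2.
  exists set0, set0, (fun=> 0); split=> //; first by rewrite setU0 cards0 !sub0set.
    by move=> Y YT; rewrite !setU0 cards0 addn0; apply: F_min.
  by split=> v; rewrite !inE.
have [||D [G [tau [[DE GE DG cX] c3 free exC' [tn before]]]]] := IHn; [nlia | nlia |].
have [||g [gE free' hg]] := step R R' tg FE rho_loop rho_coloop F_rank DE GE DG c3 free exC'.
- by rewrite cX; nlia.
- by rewrite cX; nlia.
move: gE; rewrite inE inE negb_or => /andP[/andP[gF gX] gE].
have gEF : g \in E :\: F by rewrite inE gF.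
pose tau' u := if u == g then n else tau u.
have gD : g \notin D by apply: contra gX => h; rewrite inE h.
have gG : g \notin G by apply: contra gX => h; rewrite inE h orbT.
have common D' G' : D' :|: G' = g |: (D :|: G) -> D \subset D' -> G \subset G' ->
   (forall v, v \in D' :|: G' -> tau' v < n.+1) /\
   forall v, v \in D' :|: G' -> exists D2 G2,
      [/\ D2 \subset D', G2 \subset G', v \notin D2 :|: G2, conn3 E r D2 G2 &
          forall u, u \in D' :|: G' -> u \notin D2 :|: G2 -> u != v -> tau' v < tau' u].
  move=> eX DD GG; split=> v; rewrite eX in_setU1 => /orP[/eqP->|vX].
  - by rewrite /tau' eqxx.
  - by rewrite /tau'; case: eqP => // _; have := tn _ vX; nlia.
  - exists D, G; split=> // u; rewrite in_setU1 => /orP[/eqP->|uX]; first by rewrite eqxx.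
    by rewrite uX.
  have vg : v != g by apply: contraNneq gX => <-.
  have [D2 [G2 [D2D G2G vN c2 h]]] := before _ vX; exists D2, G2; split=> //.
  - exact: subset_trans DD.
  - exact: subset_trans GG.
  move=> u; rewrite in_setU1 /tau' (negbTE vg) => /orP[/eqP->|uX] uN uv.
    by rewrite eqxx; apply: tn.
  case: eqP => [_|_]; first exact: tn.
  exact: h.
have cX' : #|g |: (D :|: G)| = n.+1 by rewrite cardsU1 gX cX.
case: hg => [[c3' ex']|[c3' ex']].
  exists (g |: D), G, tau'; rewrite -setUA; split=> //.
    by split=> //; rewrite subUset sub1set ?gEF ?DE // inE gG DG.
  by rewrite setUA; apply: common => //; [rewrite setUA | apply: subsetUr].
exists D, (g |: G), tau'; rewrite setUCA; split=> //.
  split=> //; first by rewrite subUset sub1set gEF GE.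
  by clear -DG gD; set_solve.
by rewrite setUCA; apply: common => //; [rewrite setUCA | apply: subsetUr].
Qed.

(** A member [Y] with connectivity below [#|X'|], joined with the rest of [X] and a member realizing
    the rank of [F], would contain [F :|: X] with connectivity below [t + #|X|]. *)
Lemma free_indep X X' Y : X \subset E -> tangle_free lam Tg F t X ->
  t + #|X| <= theta -> 0 < theta ->
  X' \subset X -> Y \in Tg -> X' \subset Y -> #|X'| <= lam Y.
Proof.
move=> XE free b b0 X'X YT X'Y; rewrite leqNgt; apply/negP => lt.
have [Y0 [Y0T FY0 lY0]] := F_rank.
have cX : #|X| = #|X'| + #|X :\: X'|.
  have := cardsID X' X; have -> : X :&: X' = X' by apply/setIidPr.
  by nlia.
have DE : X :\: X' \subset E by apply: subset_trans XE; apply: subsetDl.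
have DT : X :\: X' \in Tg by apply: (tg_small R R' tg) => //; nlia.
have l1 := em_lam_sub R R' Y0 Y.
have l2 := em_lamU R R' (Y0 :|: Y) (X :\: X').
have UT : Y0 :|: Y :|: (X :\: X') \in Tg.
  apply: (tgU tg) => //; last by nlia.
  by apply: (tgU tg) => //; nlia.
have := free _ UT.
have -> : F :|: X \subset Y0 :|: Y :|: (X :\: X') by clear -FY0 X'Y; set_solve.
by move=> /(_ isT); nlia.
Qed.

(** Adding [X :\: K] to a violating member contradicts freeness of [X]. The empty [K] is separate
    because [X] itself may have [theta] elements. *)
Lemma free_sub X K : X \subset E -> tangle_free lam Tg F t X ->
  t + #|X| <= theta -> 0 < theta -> K \subset X -> tangle_free lam Tg F t K.
Proof.
move=> XE free b b0 KX Y YT FY; rewrite leqNgt; apply/negP => lt.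
have cX : #|X| = #|K| + #|X :\: K|.
  have := cardsID K X; have -> : X :&: K = K by apply/setIidPr.
  by nlia.
have [c0|c0] := posnP #|K|.
  have FY' : F \subset Y by clear -FY; set_solve.
  by have := F_min YT FY'; nlia.
have DE : X :\: K \subset E by apply: subset_trans XE; apply: subsetDl.
have DT : X :\: K \in Tg by apply: (tg_small R R' tg) => //; nlia.
have l2 := em_lamU R R' Y (X :\: K).
have UT : Y :|: (X :\: K) \in Tg by apply: (tgU tg) => //; nlia.
have := free _ UT.
have -> : F :|: X \subset Y :|: (X :\: K) by clear -FY; set_solve.
by move=> /(_ isT); nlia.
Qed.

(** For [n = 10k - 6] the bound [t + 2n <= theta + 1] of [iterate] reads [20k + t <= theta + 13]. *)
Lemma free_set k : 0 < k -> 20 * k + t <= theta + 13 ->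
  exists K, [/\ K \subset E, #|K| = k, tangle_free lam Tg F t K &
    (conn3 E r K set0 /\ exists C, minor_via E r F rho K set0 C) \/
    (conn3 E r set0 K /\ exists C, minor_via E r F rho set0 K C)].
Proof.
move=> k0 b.
have [||D [G [tau [[DE GE DG cX] c3 free exC' [_ before]]]]] := @iterate (10 * k - 6).
- by nlia.
- by nlia.
have XE : D :|: G \subset E by clear -DE GE; set_solve.
have b1 : t + #|D :|: G| <= theta by nlia.
have b0 : 0 < theta by nlia.
have H : selection E theta Tg tau lam r s D G.
  split=> //; last by nlia.
  by move=> X' Y; apply: free_indep.
have cX' : 10 * k - 6 <= #|D :|: G| by rewrite cX.
have [C [CE GC DC hC]] := exC'.
have [[K [cK KD c]]|[K [cK KG c]]] := select H k0 cX'.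
  exists K; have KX : K \subset D :|: G by clear -KD; set_solve.
  split=> //; first exact: subset_trans KX XE.
    exact: (free_sub XE free b1 b0).
  left; split=> //; exists C; split=> //; first exact: sub0set.
  exact: subset_trans KD DC.
exists K; have KX : K \subset D :|: G by clear -KG; set_solve.
have KE := subset_trans KX XE.
split=> //; first exact: (free_sub XE free b1 b0).
right; split; last first.
  by exists C; split=> //; [apply: subset_trans KG GC | apply: sub0set].
by apply: (conn3_flip R' R) c => //; clear; set_solve.
Qed.

End Iterate.

(** * Matroids *)

Section FromMatroid.
Variables (T : finType) (M : matroid T).
Implicit Types (A B C D K W X Y Z : {set T}).
Hypothesis hM : is_matroid M.
Let E := ground M.

Definition mrk X := rk M (X :&: ground M).
Definition mlam X := mrk X + mrk (ground M :\: X) - mrk (ground M).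
Definition mcork X := #|X :&: ground M| + mrk (ground M :\: X) - mrk (ground M).

Lemma mrkE X : X \subset E -> mrk X = rk M X.
Proof. by move=> XE; rewrite /mrk (setIidPl XE). Qed.

Lemma mlamE X : X \subset E -> mlam X = lambda M X.
Proof. by move=> XE; rewrite /mlam /lambda !mrkE // subsetDl. Qed.

Lemma mrk_card X : mrk X <= #|X :&: E|.
Proof. by case: hM => h _ _; apply: h; apply: subsetIr. Qed.

Lemma mrk_mono X Y : X \subset Y -> mrk X <= mrk Y.
Proof. by case: hM => _ h _ XY; apply: h; [apply: setSI | apply: subsetIr]. Qed.

Lemma mrk_sub X Y : mrk (X :|: Y) + mrk (X :&: Y) <= mrk X + mrk Y.
Proof.
case: hM => _ _ h; have := h (X :&: E) (Y :&: E) (subsetIr _ _) (subsetIr _ _).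
rewrite -setIUl; have -> // : (X :&: E) :&: (Y :&: E) = (X :&: Y) :&: E by set_solve.
Qed.

Lemma emat_matroid : emat E mlam mrk mcork /\ emat E mlam mcork mrk.
Proof.
have cap X : mrk (X :&: E) = mrk X by rewrite /mrk -setIA setIid.
have sp X : mrk E <= mrk X + mrk (E :\: X).
  have := mrk_sub X (E :\: X); have : mrk E <= mrk (X :|: (E :\: X)).
    by apply: mrk_mono; set_solve.
  by nlia.
have le X : mrk E <= #|X :&: E| + mrk (E :\: X).
  by have := mrk_card X; have := sp X; nlia.
have r0 : mrk set0 = 0 by have := mrk_card set0; rewrite set0I cards0; nlia.
have cE X : X :&: E \subset E by apply: subsetIr.
have DI X : E :\: (X :&: E) = E :\: X by set_solve.
split; split.
- by move=> X; apply: leq_trans (mrk_card X) (subset_leq_card (subsetIl _ _)).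
- exact: mrk_mono.
- exact: mrk_sub.
- exact: cap.
- by move=> X; rewrite /mlam /mcork -/E; have := sp X; have := le X; nlia.
- by move=> X; rewrite /mcork -/E; have := le X; nlia.
- move=> X; rewrite /mcork -/E.
  have := mrk_mono (subsetDl E X); have := subset_leq_card (subsetIl X E); nlia.
- move=> X Y XY; rewrite /mcork -/E.
  have := mrk_sub ((Y :\: X) :&: E) (E :\: Y); have := mrk_card (Y :\: X).
  rewrite cap; have := cardsID X (Y :&: E).
  have -> : (Y :&: E) :&: X = X :&: E by set_solve.
  have -> : (Y :&: E) :\: X = (Y :\: X) :&: E by set_solve.
  have -> : (Y :\: X) :&: E :|: E :\: Y = E :\: X by set_solve.
  by nlia.
- move=> X Y; rewrite /mcork -/E; have := mrk_sub (E :\: X) (E :\: Y).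
  rewrite -setDIr -setDUr.
  have := cardsUI (X :&: E) (Y :&: E); rewrite -setIUl.
  have -> : (X :&: E) :&: (Y :&: E) = (X :&: Y) :&: E by set_solve.
  by have := le X; have := le Y; have := le (X :|: Y); have := le (X :&: Y); nlia.
- by move=> X; rewrite /mcork -/E DI -setIA setIid.
- by move=> X; rewrite /mlam /mcork -/E; have := sp X; have := le X; nlia.
move=> X; rewrite /mcork -/E setIid setDv r0.
have := cardsID X E; rewrite (setIC E X).
have -> : (E :\: X) :&: E = E :\: X by set_solve.
have -> : E :\: (E :\: X) = X :&: E by set_solve.
rewrite cap; have := le E; rewrite setIid setDv r0.
have := le (E :\: X).
have -> : (E :\: X) :&: E = E :\: X by set_solve.
have -> : E :\: (E :\: X) = X :&: E by set_solve.
by rewrite cap; nlia.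
Qed.

Lemma tangle_matroid theta (Tg : {set {set T}}) :
  is_tangle M theta Tg -> tangle E mlam theta Tg.
Proof.
case=> h1 h2 h3 h4; split=> //.
- by move=> X /h1[].
- by move=> X /h1[XE]; rewrite mlamE.
- by move=> X XE; rewrite mlamE // => lX; apply: h2.
Qed.

Lemma conn3_matroid : three_connected M -> conn3 E mrk set0 set0.
Proof.
move=> h k A k3; rewrite !setU0 !setD0 => AE cA cB; rewrite leqNgt; apply/negP => lt.
apply: (h k k3 A); split=> //; rewrite -mlamE //.
have r0 : mrk set0 = 0 by have := mrk_card set0; rewrite set0I cards0; nlia.
by rewrite /mlam -/E; move: lt; rewrite r0; case/andP: k3 => k0 _; nlia.
Qed.

Lemma conn3_delete K : K \subset E -> conn3 E mrk K set0 -> three_connected (delete M K).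
Proof.
move=> KE h k k3 A [/= AE cA cB lt]; have := h k A k3; rewrite !setU0 => /(_ AE cA cB).
have AE' : A \subset E by apply: subset_trans AE (subsetDl _ _).
move: lt; rewrite /lambda /= -!mrkE // -?/E; first by case/andP: k3 => k0 _; nlia.
  by apply: subsetDl.
by clear; set_solve.
Qed.

Lemma conn3_contract K : K \subset E -> conn3 E mrk set0 K -> three_connected (contract M K).
Proof.
move=> KE h k k3 A [/= AE cA cB lt]; have := h k A k3; rewrite !set0U !setD0 => /(_ AE cA cB).
have AE' : A \subset E by apply: subset_trans AE (subsetDl _ _).
move: lt; rewrite /lambda /=.
have -> : (ground M :\: K) :\: A :|: K = E :\: A.
  by rewrite -/E in AE *; clear -AE KE; set_solve.
have -> : (ground M :\: K) :|: K = E by rewrite -/E; clear -KE; set_solve.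
have AKE : A :|: K \subset E by clear -AE' KE; set_solve.
rewrite -!mrkE // ?subsetDl //; case/andP: k3 => k0 _.
have := mrk_mono (subsetUr A K).
have : mrk K <= mrk (E :\: A).
  by apply: mrk_mono; rewrite -/E in AE; clear -AE KE; set_solve.
have := mrk_mono KE; nlia.
Qed.

Lemma minor_delete (N : matroid T) K C :
  ground N \subset E -> minor_via E mrk (ground N) (rk N) K set0 C ->
  K \subset E :\: ground N -> has_minor (delete M K) N.
Proof.
move=> FE [CE _ KC h] KE; exists C, (E :\: K :\: C :\: ground N); split=> /=.
- by rewrite -/E; clear -CE KC; set_solve.
- by rewrite -/E; clear; set_solve.
- by rewrite disjoints_subset; clear; set_solve.
split=> /=; first by rewrite -/E; clear -FE CE KC KE; set_solve.
move=> W WF; have CE' : C \subset E by clear -CE; set_solve.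
have WCE : W :|: C \subset E by clear -CE' WF FE; set_solve.
by have := h W WF; rewrite !mrkE //; nlia.
Qed.

Lemma minor_contract (N : matroid T) K C :
  ground N \subset E -> minor_via E mrk (ground N) (rk N) set0 K C ->
  has_minor (contract M K) N.
Proof.
move=> FE [CE KC _ h]; exists (C :\: K), (E :\: C :\: ground N); split=> /=.
- by rewrite -/E; clear -CE KC; set_solve.
- by rewrite -/E; clear -KC; set_solve.
- by rewrite disjoints_subset; clear; set_solve.
split=> /=; first by rewrite -/E; clear -FE CE KC; set_solve.
move=> W WF; have CE' : C \subset E by clear -CE; set_solve.
have WCE : W :|: C \subset E by clear -CE' WF FE; set_solve.
have -> : W :|: (C :\: K) :|: K = W :|: C by clear -KC; set_solve.
have -> : C :\: K :|: K = C by clear -KC; set_solve.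
have := mrk_mono KC; have := mrk_mono (subsetUr W C).
have KE := subset_trans KC CE'.
by have := h W WF; rewrite !mrkE //; nlia.
Qed.

End FromMatroid.

Lemma bigmin_le (I : eqType) (l : seq I) (P : pred I) (f : I -> nat) n i :
  i \in l -> P i -> \big[minn/n]_(j <- l | P j) f j <= f i.
Proof.
elim: l => // j l IH; rewrite inE big_cons => /orP[/eqP<-|il] Pi.
  by rewrite Pi geq_minl.
case: ifP => _; last exact: IH.
by apply: leq_trans (geq_minr _ _) _; apply: IH.
Qed.

(** * The tangle rank as a minimum *)

Section TangleRank.
Variables (T : finType) (M : matroid T) (theta : nat) (Tg : {set {set T}}).
Implicit Types X Y : {set T}.

Lemma tangle_rank_le X Y : Y \in Tg -> X \subset Y ->
  tangle_rank M theta Tg X <= lambda M Y.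
Proof.
move=> YT XY; rewrite /tangle_rank; case: existsP => [_|[]]; last first.
  by exists Y; rewrite YT.
by apply: bigmin_le; rewrite ?mem_index_enum ?YT.
Qed.

(** The bound [n <= theta] covers both the default of the minimum and the sets contained in no
    member. *)
Lemma tangle_rank_ge X n : n <= theta ->
  (forall Y, Y \in Tg -> X \subset Y -> n <= lambda M Y) ->
  n <= tangle_rank M theta Tg X.
Proof.
move=> nt h; rewrite /tangle_rank; case: existsP => // _.
apply: (big_ind (fun x => n <= x)) => //; first by move=> x y; rewrite leq_min => -> ->.
by move=> Y /andP[YT XY]; apply: h.
Qed.

Lemma tangle_rank_ex X : tangle_rank M theta Tg X < theta ->
  exists Y, [/\ Y \in Tg, X \subset Y & lambda M Y <= tangle_rank M theta Tg X].
Proof.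
move=> lt; apply: NNPP => no.
have := @tangle_rank_ge X (tangle_rank M theta Tg X).+1 lt; rewrite ltnn => h.
suff : false by []. apply: h => Y YT XY; rewrite ltnNge; apply/negP => le.
by apply: no; exists Y.
Qed.

End TangleRank.

Unset Implicit Arguments.

Theorem theorem5p3 (T : finType) (k : nat) (M N : matroid T) (theta : nat)
    (Tg : {set {set T}}) :
  is_matroid M -> three_connected M -> is_tangle M theta Tg ->
  has_minor M N -> no_loops N -> no_coloops N ->
  let t := tangle_rank M theta Tg (ground N) in
  20 * k + t <= theta + 13 ->
  exists X : {set T},
    [/\ X \subset ground M, #|X| = k,
        tangle_rank M theta Tg (ground N :|: X) = t + k &
        (three_connected (delete M X) /\ has_minor (delete M X) N) \/
        (three_connected (contract M X) /\ has_minor (contract M X) N)].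
Proof.
move=> hM c3 hT [C [D [CE DE CD [eF hN]]]] nl ncl t b.
rewrite /= in eF.
have FE : ground N \subset ground M by rewrite eF; clear; set_solve.
have via : minor_via (ground M) (mrk M) (ground N) (rk N) set0 set0 C.
  split; rewrite ?sub0set //; first by rewrite eF; clear -CE; set_solve.
  move=> W WF; have := hN _ WF => /= ->.
  have WE : W :|: C \subset ground M by clear -WF FE CE; set_solve.
  by rewrite !mrkE // subnK //; case: hM => _ h _; apply: h => //; apply: subsetUr.
(* For [k = 0] the empty set works, whatever the order. *)
have [k0|kp] := posnP k.
  exists set0; rewrite sub0set cards0 setU0 k0 addn0; split=> //; left; split.
    exact: (conn3_delete (sub0set _) (conn3_matroid hM c3)).
  by apply: (minor_delete FE via); rewrite sub0set.
have [R R'] := emat_matroid hM; have tg := tangle_matroid hT.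
(* So [t] is attained by a member of the tangle and is not the default value. *)
have lt : t < theta by nlia.
have F_rank : exists Y, [/\ Y \in Tg, ground N \subset Y & mlam M Y <= t].
  have [Y [YT FY le]] := tangle_rank_ex lt; exists Y; split=> //.
  by rewrite mlamE //; apply: (tg_sub tg).
have F_min Y : Y \in Tg -> ground N \subset Y -> t <= mlam M Y.
  by move=> YT FY; rewrite mlamE ?(tg_sub tg) //; apply: tangle_rank_le.
have loop x : x \in ground N -> 0 < rk N [set x].
  by move=> xF; rewrite lt0n; apply/eqP => e; apply: (nl x).
have coloop x : x \in ground N -> rk N (ground N) <= rk N (ground N :\ x).
  by move=> xF; rewrite leqNgt; apply/negP => e; apply: (ncl x).
have exC : exists C, minor_via (ground M) (mrk M) (ground N) (rk N) set0 set0 C by exists C.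
have [K [KE cK free h]] :=
  free_set R R' tg FE loop coloop F_rank F_min (conn3_matroid hM c3) exC kp b.
exists K; split=> //.
  apply/eqP; rewrite eqn_leq; apply/andP; split.
    have [Y [YT FY lY]] := F_rank; have := em_lamU R R' Y K; rewrite cK => lU.
    have KT : K \in Tg by apply: (tg_small R R' tg) => //; nlia.
    have UT : Y :|: K \in Tg by apply: (tgU tg) => //; nlia.
    have := tangle_rank_le M theta UT (setSU K FY).
    by rewrite -mlamE ?(tg_sub tg) //; nlia.
  apply: tangle_rank_ge; first by nlia.
  by move=> Y YT FY; rewrite -mlamE ?(tg_sub tg) // -cK; apply: free.
case: h => [[c [C' v]]|[c [C' v]]]; [left | right]; split.
- exact: (conn3_delete KE c).
- apply: (minor_delete FE v); apply/subsetP => x xK; rewrite inE (subsetP KE) // andbT.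
  (* An element of [K] in the ground set of [N] would make [Y :|: (K :\ x)] contain the union of
     that ground set with [K], at connectivity at most [t + k - 1]. *)
  apply/negP => xF.
  have [Y [YT FY lY]] := F_rank.
  have KT : K :\ x \in Tg.
    apply: (tg_small R R' tg); first by apply: subset_trans KE; apply: subD1set.
    by have := cardsD1 x K; rewrite xK; nlia.
  have cx := cardsD1 x K; rewrite xK in cx.
  have lU := em_lamU R R' Y (K :\ x).
  have UT : Y :|: (K :\ x) \in Tg by apply: (tgU tg) => //; nlia.
  have := free _ UT; have -> : ground N :|: K \subset Y :|: (K :\ x).
    by clear -FY xF; set_solve.
  by move=> /(_ isT); nlia.
- exact: (conn3_contract hM KE c).
- exact: (minor_contract hM FE v).
Qed.
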